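(* An Apollonian triangle $\mathcal{T}$ with vertices $p_1,p_2,p_3$ has area $\frac47A(T)$, where $A(T)$ is the area of the (Euclidean) triangle $T=\triangle p_1p_2p_3$.
   Context: Lines are allowed as circles. Circles are pairwise tangent if any two of them are tangent and the tangency points are distinct; they are externally tangent if they bound tangent closed discs with disjoint interiors, none of which is the complement of a bounded open disc (for a line the disc is a closed half-plane). Given three pairwise externally tangent circles, at most one of which is a line, the corresponding three closed discs divide the plane into exactly two regions, exactly one of which is bounded; the circle lying in the bounded region and tangent to all three circles is called the successor of the triple. Apollonian curves. Fix a circle $C_0$ with center $c_0$. For a circle $C$ with center $c$ tangent to $C_0$, let $v(C)=c-c_0$, let $\alpha(C)$ be the angle of the vector $v(C)$ with the positive $x$-axis, let $v^{1/2}(C)$ be a complex square root of $v(C)\in\mathbb{R}^2=\mathbb{C}$, and let $\ell^{1/2}(C)=\mathbb{R}\,v^{1/2}(C)$ be the real line it spans. For tangent circles $C,C'$ that are both tangent to $C_0$, let $s(C,C')$ be the successor of the triple $(C_0,C,C')$. Let $C_1,C_2$ be circles such that $C_0,C_1,C_2$ are pairwise externally tangent, and let $\mathcal{C}$ be the smallest set of circles such that $C_1,C_2\in\mathcal{C}$ and $s(C,C')\in\mathcal{C}$ for all tangent $C,C'\in\mathcal{C}$. A continuous curve $\gamma:[\alpha(C_1),\alpha(C_2)]\to\mathbb{R}^2$ is an Apollonian curve associated to the triple $(C_0,C_1,C_2)$ if $\gamma(\alpha(C))-\gamma(\alpha(C'))\in\ell^{1/2}(s(C,C'))$ for all tangent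 circles $C,C'\in\mathcal{C}$. Such a curve exists and is unique up to translation and scaling. Apollonian triangles. Given an unordered triple of externally tangent circles $C_1,C_2,C_3$ (pairwise tangent) and a circle $C_0$ externally tangent to each of them, the corresponding Apollonian triangle is the bounded region (unique up to translation and scaling) enclosed by the images of the Apollonian curves $\gamma_{12},\gamma_{23},\gamma_{31}$ corresponding to the triples $(C_0,C_1,C_2)$, $(C_0,C_2,C_3)$, $(C_0,C_3,C_1)$, chosen so that consecutive curves share endpoints, $\gamma_{ij}(\alpha(C_j))=\gamma_{jk}(\alpha(C_j))$ for $\{i,j,k\}=\{1,2,3\}$. These three common endpoints are the vertices of the Apollonian triangle. *)

(* Defs.v *)
From HB Require Import structures.
From mathcomp Require Import all_boot all_order all_algebra.
From mathcomp Require Import complex.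
From mathcomp Require Import all_classical all_reals all_analysis.

Set Implicit Arguments.
Unset Strict Implicit.
Unset Printing Implicit Defensive.

Import Order.TTheory GRing.Theory Num.Theory.
Import numFieldTopology.Exports numFieldNormedType.Exports.

Local Open Scope classical_set_scope.
Local Open Scope ring_scope.

(* The plane is R * R, which carries the product topology and the product
   Lebesgue measure.  The library norm on R * R is the sup norm, so the
   Euclidean one is defined here. *)

Section Plane.
Variable R : realType.
Implicit Types (z w : R * R) (t : R) (A V : set (R * R)).

Definition dotp z w : R := z.1 * w.1 + z.2 * w.2.

Definition enorm z : R := Num.sqrt (dotp z z).

Definition to_complex z : R[i] := Complex z.1 z.2.

(* Determined modulo 2 * pi; no real is an angle of the zero vector. *)
Definition angle_of z t : Prop :=
  z != 0 /\ z = (enorm z * cos t, enorm z * sin t).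

(* The real line spanned by a complex square root of z; it does not depend on
   which of the two roots is taken. *)
Definition sqrt_line z : set (R * R) :=
  [set w | exists (u : R[i]) (t : R),
     u ^+ 2 = to_complex z /\ to_complex w = real_complex R t * u].

Definition bounded_region A V : Prop :=
  exists2 z, A z & V = connected_component A z /\ bounded_set V.

Definition area A : \bar R :=
  ((@lebesgue_measure R) \x (@lebesgue_measure R))%E A.

Definition triangle (p1 p2 p3 : R * R) : set (R * R) :=
  [set z | exists a b c : R,
     [/\ 0 <= a, 0 <= b, 0 <= c, a + b + c = 1 &
         z = a *: p1 + b *: p2 + c *: p3]].

End Plane.

Section Circles.
Variable R : realType.

(* Lines are allowed as circles.  [Line n d _] is the line <n, z> = d, so that
   a line has several representations; nothing below depends on the choice. *)
Inductive gcircle : Type :=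
| Circle (c : R * R) (r : R) of 0 < r
| Line (n : R * R) (d : R) of n != 0.

Implicit Types (C S : gcircle) (D : set (R * R)).

Definition is_line C : Prop := if C is Line _ _ _ then True else False.

Definition points C : set (R * R) :=
  match C with
  | Circle c r _ => [set z | enorm (z - c) = r]
  | Line n d _ => [set z | dotp n z = d]
  end.

(* The closed discs bounded by C, complements of bounded open discs being left
   out: one for a proper circle, two (the closed half-planes) for a line. *)
Definition bounds C D : Prop :=
  match C with
  | Circle c r _ => D = [set z | enorm (z - c) <= r]
  | Line n d _ => D = [set z | dotp n z <= d] \/ D = [set z | d <= dotp n z]
  end.

(* Tangency points are points of the plane: two lines are never tangent.  As
   soon as one of the curves is not a line, meeting in exactly one point is
   tangency, internal or external. *)
Definition tangent_at C1 C2 (p : R * R) : Prop :=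
  ~ (is_line C1 /\ is_line C2) /\ points C1 `&` points C2 = [set p].

Definition tangent C1 C2 : Prop := exists p, tangent_at C1 C2 p.

Definition disjoint_interiors D1 D2 : Prop :=
  interior D1 `&` interior D2 = set0.

Definition externally_tangent C1 C2 : Prop :=
  tangent C1 C2 /\
  exists D1 D2, [/\ bounds C1 D1, bounds C2 D2 & disjoint_interiors D1 D2].

Definition pairwise_tangent C1 C2 C3 : Prop :=
  exists p12 p23 p31 : R * R,
    [/\ tangent_at C1 C2 p12, tangent_at C2 C3 p23, tangent_at C3 C1 p31 &
        [/\ p12 <> p23, p23 <> p31 & p31 <> p12]].

Definition tangent_discs C1 C2 C3 D1 D2 D3 : Prop :=
  [/\ bounds C1 D1, bounds C2 D2, bounds C3 D3 &
      [/\ disjoint_interiors D1 D2, disjoint_interiors D2 D3 &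
          disjoint_interiors D3 D1]].

Definition pairwise_externally_tangent C1 C2 C3 : Prop :=
  pairwise_tangent C1 C2 C3 /\
  exists D1 D2 D3, tangent_discs C1 C2 C3 D1 D2 D3.

(* S touches the boundary of the open region V at the three tangency points,
   hence the closure. *)
Definition successor C1 C2 C3 S : Prop :=
  pairwise_tangent C1 C2 C3 /\
  exists D1 D2 D3 V,
    [/\ tangent_discs C1 C2 C3 D1 D2 D3,
        bounded_region (~` (D1 `|` D2 `|` D3)) V,
        points S `<=` closure V &
        [/\ tangent S C1, tangent S C2 & tangent S C3]].

(* The smallest set of circles containing C1 and C2 and closed under taking
   successors of (C0, C, C') for tangent members C, C'. *)
Inductive family (C0 C1 C2 : gcircle) : gcircle -> Prop :=
| family_left : family C0 C1 C2 C1
| family_right : family C0 C1 C2 C2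
| family_succ C C' S :
    family C0 C1 C2 C -> family C0 C1 C2 C' -> tangent C C' ->
    successor C0 C C' S -> family C0 C1 C2 S.

(* v(C) = c - c0.  A line has no center; v is then the vector from c0 to its
   foot on the line.  For C externally tangent to a circle centered at c0, v(C)
   is in both cases a positive multiple of the vector from c0 to the tangency
   point, and only its direction is used. *)
Definition vec_from (c0 : R * R) C : R * R :=
  match C with
  | Circle c _ _ => c - c0
  | Line n d _ => ((d - dotp n c0) / dotp n n) *: n
  end.

Definition angular_interval (a1 a2 : R) : set R :=
  `[Num.min a1 a2, Num.max a1 a2].

(* a1 and a2 are the values alpha(C1) and alpha(C2).  Angles being defined
   modulo 2 * pi, the lifts are chosen with |a1 - a2| < pi, so that the interval
   between them, in either order, parametrizes the arc of C0 facing the bounded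
   region, which contains the tangency points of all the circles in the
   family.  For C in the family, alpha(C) is its angle in that interval. *)
Definition apollonian_curve (c0 : R * R) (r0 : R) (hr0 : 0 < r0)
    (C1 C2 : gcircle) (a1 a2 : R) (gamma : R -> R * R) : Prop :=
  let C0 := Circle c0 hr0 in
  [/\ pairwise_externally_tangent C0 C1 C2,
      [/\ angle_of (vec_from c0 C1) a1, angle_of (vec_from c0 C2) a2 &
          `|a1 - a2| < pi],
      {within angular_interval a1 a2, continuous gamma} &
      forall (C C' S : gcircle) (t t' : R),
        family C0 C1 C2 C -> family C0 C1 C2 C' -> tangent C C' ->
        successor C0 C C' S ->
        angular_interval a1 a2 t -> angle_of (vec_from c0 C) t ->
        angular_interval a1 a2 t' -> angle_of (vec_from c0 C') t' ->
        sqrt_line (vec_from c0 S) (gamma t - gamma t')].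

(* Each curve has its own lifts of the angles.  The region enclosed by the
   curves is a bounded connected component of the complement of their images.
   There is none for constant curves, nor when one of C1, C2, C3 is the
   successor of C0 and the other two, since the curves then overlap along a
   single arc. *)
Definition apollonian_triangle (c0 : R * R) (r0 : R) (hr0 : 0 < r0)
    (C1 C2 C3 : gcircle) (p1 p2 p3 : R * R) (T : set (R * R)) : Prop :=
  let C0 := Circle c0 hr0 in
  [/\ pairwise_externally_tangent C1 C2 C3,
      [/\ externally_tangent C0 C1, externally_tangent C0 C2 &
          externally_tangent C0 C3] &
      exists (g12 g23 g31 : R -> R * R) (a1 a2 b2 b3 e3 e1 : R),
        [/\ [/\ apollonian_curve c0 hr0 C1 C2 a1 a2 g12,
                apollonian_curve c0 hr0 C2 C3 b2 b3 g23 &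
                apollonian_curve c0 hr0 C3 C1 e3 e1 g31],
            [/\ g31 e1 = p1 /\ g12 a1 = p1,
                g12 a2 = p2 /\ g23 b2 = p2 &
                g23 b3 = p3 /\ g31 e3 = p3] &
            bounded_region
              (~` (g12 @` angular_interval a1 a2 `|`
                   g23 @` angular_interval b2 b3 `|`
                   g31 @` angular_interval e3 e1)) T]].

End Circles.

(* Main.v *)
(* Write C0 for the circle of center c0 and radius r0.  A circle C externally
   tangent to C0 is encoded by a vector u, unique up to sign, whose complex
   square is a positive multiple of v(C) and with |u|^2 = 1 + r0 / r, r being the
   radius of C (|u| = 1 for a line).  Tangency of the circles of u and v becomes
   det (u, v) = 1 up to sign, and the successor belongs to u + v: the family is a
   Farey tree.  If gamma(v) - gamma(u) = l (u + v), the directions 2 u + v and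
   u + 2 v of the two halves force the scale l / 3 on each.  Hence in the frame
   (- l u, l v) based at gamma(u) + l u, every Apollonian curve is the same arc
   from (1, 0) to (0, 1), the attractor of two affine maps of determinant 1 / 9.
   Cutting off the triangle x + y < 2 / 3, the region under this arc is
   made of two copies of itself, so that its area a satisfies
   a = 4 / 9 * (1 / 2) + 2 / 9 * a, which is 4 / 7 of the area of the simplex.

   The vectors of C1, C2, C3 can be given signs with w1 + w2 + w3 = 0.  If no
   product w_i . w_j is positive, the frames of the three curves are based at the
   centroid of p1 p2 p3, which they cut into three triangles; the curves bound a
   region that is star-shaped about the centroid and occupies 4 / 7 of each.  If
   some product is positive, one circle is the successor of C0 and the other two,
   two of the curves are parts of the third, and no bounded region exists; nor
   does one when l = 0, the curves being then constant. *)
Require Import Defs.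
From HB Require Import structures.
From mathcomp Require Import all_boot all_order all_algebra.
From mathcomp Require Import ring lra.
From mathcomp Require Import all_classical all_reals all_analysis.
From mathcomp Require Import measurable_realfun.

Set Implicit Arguments.
Unset Strict Implicit.
Unset Printing Implicit Defensive.

Import Order.TTheory GRing.Theory Num.Theory.
Import numFieldTopology.Exports numFieldNormedType.Exports.

Local Open Scope classical_set_scope.
Local Open Scope ring_scope.

(** * Areas of affine images *)

Section AreaAffine.
Variable R : realType.
Local Notation mR := (measurableTypeR R).
Implicit Types (a c s t : R) (q e f : R * R).

(** A curve is given only through directions of differences, at the angles of an inductively
    generated family, and successors are defined through an unspecified bounded region. Uniqueness
    of successors is bypassed: the curve condition holds for every successor, so it suffices to
    exhibit one, the circle of [u + v], at each step. The arc has no formula either: [arc] is the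
    closure of the orbit of the two ends under two affine maps, and continuity together with the
    shrinking of the subdivision intervals shows that every nonconstant curve, read in its frame,
    has exactly this image, whatever its parametrization. Monotonicity and the intermediate value
    property of [arc] are then read off such a curve. Rays from one center replace the Jordan curve
    theorem: each ray meets the boundary exactly once, so a bounded component can only be the union
    of the inner segments. Areas are compared with that of one open simplex, whose value is never
    computed, and only pieces of straight lines have to be discarded as null sets. *)

Lemma measurable_fun_line s t :
  measurable_fun setT ((fun y => s * y + t) : mR -> mR).
Proof.
apply: measurable_funD => //; exact: measurable_funM.
Qed.

(** Uniqueness of Lebesgue measure: the scaled pushforward agrees with it on half-open intervals.
    For [s < 0] the preimage is half-open on the other side, with the same length. *)
Lemma lebesgue_measure_line s t (B : set mR) : s != 0 -> measurable B ->
  (@lebesgue_measure R B =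
   `|s|%:E * @lebesgue_measure R ((fun y => s * y + t)%R @^-1` B))%E.
Proof.
move=> s0 mB.
have as0 : 0 <= `|s| by [].
pose k : {nonneg R} := NngNum as0.
have mf := measurable_fun_line s t.
pose p : {measure set mR -> \bar R} :=
  pushforward (@lebesgue_measure R) ((fun y => s * y + t)%R : mR -> mR).
pose m := mscale k (p mf).
rewrite -[RHS]/(m B).
apply: lebesgue_measure_unique => // X [[x y] _ <-] /=.
rewrite /m /mscale /= /pushforward.
have -> : (fun y0 : R => s * y0 + t) @^-1` `]x, y]%classic =
  if 0 < s then `](x - t) / s, (y - t)/ s]%classic else `[(y - t) / s, (x - t)/ s[%classic.
  apply/seteqP; split => z /=.
    case: ltrgt0P s0 => // s0 _; rewrite /= !in_itv /=.
      by rewrite ltr_pdivrMr// ler_pdivlMr// ltrBlDr lerBrDr mulrC.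
    by rewrite ler_ndivrMr// ltr_ndivlMr// ltrBlDr lerBrDr mulrC andbC.
  case: ltrgt0P s0 => // s0 _; rewrite /= !in_itv /=.
    by rewrite ltr_pdivrMr// ler_pdivlMr// ltrBlDr lerBrDr mulrC.
  by rewrite ler_ndivrMr// ltr_ndivlMr// ltrBlDr lerBrDr mulrC andbC.
rewrite lebesgue_measure_itv /= lte_fin.
case: ltrgt0P s0 => // s0 _.
  rewrite lebesgue_measure_itv /= lte_fin ltr_pM2r ?invr_gt0// ltrD2r.
  case: ifPn; rewrite ?mule0// => _; rewrite -!EFinB -EFinM.
  by congr EFin; field; exact: lt0r_neq0.
rewrite lebesgue_measure_itv /= lte_fin ltr_nM2r ?invr_lt0// ltrD2r.
case: ifPn; rewrite ?mule0// => _; rewrite -!EFinB -EFinM.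
by congr EFin; field; exact: ltr0_neq0.
Qed.

Definition plane_measurable (A : set (R * R)) := measurable (A : set (mR * mR)).

(** Stated with preimages, so that measurability and composition need no injectivity; images come
    back through [aff_image]. *)
Definition scales_area (h : R * R -> R * R) (d : R) :=
  measurable_fun setT (h : mR * mR -> mR * mR) /\
  forall B, plane_measurable B -> (area B = `|d|%:E * area (h @^-1` B))%E.

Lemma scales_area_comp (g h : R * R -> R * R) (d d' : R) :
  scales_area g d -> scales_area h d' -> scales_area (g \o h) (d * d').
Proof.
move=> [mg gE] [mh hE]; split.
  exact: (measurableT_comp mg mh).
move=> B mB; rewrite gE// hE.
  by rewrite muleA -EFinM normrM.
by rewrite -[X in plane_measurable X]setTI; exact: mg.
Qed.

Definition swap (z : R * R) : R * R := (z.2, z.1).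

Lemma scales_area_swap : scales_area swap 1.
Proof.
have ms : measurable_fun setT (swap : mR * mR -> mR * mR).
  by apply/measurable_fun_pairP; split; [exact: measurable_snd|exact: measurable_fst].
split=> // B mB; rewrite normr1 mul1e.
pose m : {measure set (mR * mR) -> \bar R} :=
  pushforward ((@lebesgue_measure R) \x (@lebesgue_measure R))%E (swap : mR * mR -> mR * mR).
rewrite -[RHS]/(m ms B).
apply: product_measure_unique => // X Y mX mY.
rewrite /m /pushforward/=.
transitivity (((@lebesgue_measure R) \x (@lebesgue_measure R))%E (Y `*` X)).
  by congr (product_measure1 _ _ _); apply/seteqP; split=> -[x y] [].
by rewrite product_measure1E// muleC.
Qed.

(** Fubini: the vertical section of the preimage at [x] is the preimage of a section under an affine
    map of the line with slope [s]. *)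
Lemma scales_area_shear s c t : s != 0 ->
  scales_area (fun z => (z.1, s * z.2 + c * z.1 + t)) s.
Proof.
move=> s0.
have ms : measurable_fun setT ((fun z => (z.1, s * z.2 + c * z.1 + t)) : mR * mR -> mR * mR).
  apply/measurable_fun_pairP; split; first exact: measurable_fst.
  by apply: measurable_funD => //; apply: measurable_funD => //;
    exact: measurable_funM.
split=> // B mB; rewrite /area.
rewrite /product_measure1 -ge0_integralZl//; last first.
  apply: measurable_fun_xsection; rewrite -[X in measurable X]setTI; exact: ms.
apply: eq_integral => x _ /=.
rewrite (@lebesgue_measure_line s (c * x + t))//; last exact: measurable_xsection.
congr (_ * lebesgue_measure _)%E.
apply/seteqP; split=> y /=; rewrite /xsection /= !inE /= addrA//.
Qed.

Definition aff q e f (z : R * R) : R * R := q + z.1 *: e + z.2 *: f.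

Definition vdet (e f : R * R) : R := e.1 * f.2 - e.2 * f.1.

(** An LU factorization: if [e.1 != 0] the map is a shear conjugated by [swap], followed by a shear.
    Otherwise the output coordinates are exchanged first; the sign this gives the determinant is
    lost in the absolute value. *)
Lemma scales_area_aff q e f : vdet e f != 0 -> scales_area (aff q e f) (vdet e f).
Proof.
wlog e0 : q e f / e.1 != 0.
  move=> H d0.
  have [e0|] := eqVneq e.1 0; last by move=> e0; exact: H.
  have dE : vdet (swap e) (swap f) = - vdet e f by rewrite /vdet /=; ring.
  have se0 : (swap e).1 != 0.
    by apply: contraNneq d0; rewrite /vdet e0 /= => ->; rewrite !mul0r subrr.
  have sd0 : vdet (swap e) (swap f) != 0 by rewrite dE oppr_eq0.
  have := scales_area_comp scales_area_swap (H (swap q) _ _ se0 sd0).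
  rewrite mul1r dE.
  have -> : swap \o aff (swap q) (swap e) (swap f) = aff q e f by [].
  move=> -[ms mE]; split=> //.
  by move=> B mB; rewrite mE// normrN.
move=> d0.
have H1 := scales_area_comp scales_area_swap
  (scales_area_comp (@scales_area_shear e.1 f.1 q.1 e0) scales_area_swap).
have s0 : vdet e f / e.1 != 0 by rewrite mulf_neq0// invr_eq0.
have H2 := @scales_area_shear (vdet e f / e.1) (e.2 / e.1) (q.2 - e.2 / e.1 * q.1) s0.
have := scales_area_comp H2 H1.
rewrite mul1r mulr1 (divfK e0).
congr scales_area; apply/funext => -[x y]; rewrite /aff /swap /= /vdet.
congr pair => /=; first by rewrite /GRing.scale/=; ring.
by rewrite /GRing.scale/=; field.
Qed.

(** Cramer's rule: the inverse frame turns images into preimages. *)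
Lemma aff_image q e f (A : set (R * R)) : vdet e f != 0 ->
  aff q e f @` A =
    aff (- vdet q f / vdet e f, - vdet e q / vdet e f)
        (f.2 / vdet e f, - e.2 / vdet e f)
        (- f.1 / vdet e f, e.1 / vdet e f) @^-1` A.
Proof.
case: q e f => q1 q2 [e1 e2] [f1 f2]; rewrite /vdet /= => d0.
apply/seteqP; split=> z /=.
  move=> [[x y] Axy <-]; congr (A _): Axy.
  by rewrite /aff; congr pair => /=; rewrite /GRing.scale/=; field.
move=> Az; eexists; first exact: Az.
case: z {Az} => x y.
by rewrite /aff; congr pair => /=; rewrite /GRing.scale/=; field.
Qed.

Lemma area_aff_image q e f A : vdet e f != 0 -> plane_measurable A ->
  plane_measurable (aff q e f @` A) /\
  (area (aff q e f @` A) = `|vdet e f|%:E * area A)%E.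
Proof.
move=> d0 mA; rewrite aff_image//.
set q' := (X in aff X _ _); set e' := (X in aff _ X _); set f' := (X in aff _ _ X).
have dE : vdet e' f' = (vdet e f)^-1.
  rewrite /e' /f' {e' f' q'}.
  case: e f d0 => e1 e2 [f1 f2]; rewrite /vdet /= => d0; field.
  by rewrite d0.
have d'0 : vdet e' f' != 0 by rewrite dE invr_eq0.
have [ms mE] := scales_area_aff q' d'0.
split; first by rewrite /plane_measurable -[X in measurable X]setTI; exact: ms.
rewrite [in RHS]mE// muleA -EFinM -normrM dE mulfV// normr1 mul1e//.
Qed.

Lemma area0_axis : area [set z : R * R | z.1 = 0] = 0%E /\
  plane_measurable [set z : R * R | z.1 = 0].
Proof.
have E : [set z : R * R | z.1 = 0] = [set 0] `*` setT.
  by apply/seteqP; split=> -[x y] //= [].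
rewrite E; split.
  rewrite /area product_measure1E//.
  rewrite -[RHS](mul0e (@lebesgue_measure R setT)); congr (_ * _)%E.
  exact: lebesgue_measure_set1.
exact: measurableX.
Qed.

Lemma area_line q e f : vdet e f != 0 ->
  area (aff q e f @` [set z | z.1 = 0]) = 0%E /\
  plane_measurable (aff q e f @` [set z | z.1 = 0]).
Proof.
move=> d0; have [a0 m0] := area0_axis.
by have [? ->] := area_aff_image q d0 m0; rewrite a0 mule0.
Qed.

Lemma area0_subset (A B : set (R * R)) : plane_measurable A -> plane_measurable B ->
  A `<=` B -> area B = 0%E -> area A = 0%E.
Proof.
move=> mA mB AB B0; apply/eqP; rewrite eq_le measure_ge0 andbT -B0.
by apply: le_measure => //; rewrite inE.
Qed.

Lemma area_setU (A B : set (R * R)) : plane_measurable A -> plane_measurable B ->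
  A `&` B = set0 -> (area (A `|` B) = area A + area B)%E.
Proof. by move=> mA mB AB; apply: measureU. Qed.

Lemma area_setU_null (X Y : set (R * R)) : plane_measurable X -> plane_measurable Y ->
  area Y = 0%E -> area (X `|` Y) = area X.
Proof.
move=> mX mY Y0; apply/eqP; rewrite eq_le; apply/andP; split; last first.
  by apply: le_measure; rewrite ?inE//; exact: measurableU.
apply: (le_trans (measureU2 _ _ _)) => //.
by rewrite [X in (_ + X)%E](_ : _ = 0%E) ?adde0.
Qed.

End AreaAffine.

(** * The region under a monotone arc *)

Section ArcArea.
Variable R : realType.
Local Notation mR := (measurableTypeR R).
Implicit Types (z k : R * R) (K : set (R * R)).

Lemma measurable_halfplane (a b c : R) :
  plane_measurable [set z : R * R | 0 < a * z.1 + b * z.2 + c] /\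
  plane_measurable [set z : R * R | 0 <= a * z.1 + b * z.2 + c].
Proof.
pose h : mR * mR -> mR := fun z => a * z.1 + b * z.2 + c.
have mh : measurable_fun setT h.
  by apply: measurable_funD => //; apply: measurable_funD => //;
    exact: measurable_funM.
have E1 : [set z : R * R | 0 < a * z.1 + b * z.2 + c] = h @^-1` `]0, +oo[%classic.
  by apply/seteqP; split=> z /=; rewrite in_itv /= andbT.
have E2 : [set z : R * R | 0 <= a * z.1 + b * z.2 + c] = h @^-1` `[0, +oo[%classic.
  by apply/seteqP; split=> z /=; rewrite in_itv /= andbT.
by rewrite E1 E2; split; rewrite /plane_measurable -[X in measurable X]setTI;
  apply: mh => //; exact: measurable_itv.
Qed.

Lemma measurable_rect (A B : set mR) : measurable A -> measurable B ->
  plane_measurable (A `*` B).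
Proof. by move=> mA mB; exact: measurableX. Qed.

Definition open_simplex : set (R * R) := [set z | [/\ 0 < z.1, 0 < z.2 & z.1 + z.2 < 1]].
Definition closed_simplex : set (R * R) :=
  [set z | [/\ 0 <= z.1, 0 <= z.2 & z.1 + z.2 <= 1]].

Lemma measurable_open_simplex : plane_measurable open_simplex.
Proof.
have -> : open_simplex =
    [set z | 0 < 1 * z.1 + 0 * z.2 + 0] `&` [set z | 0 < 0 * z.1 + 1 * z.2 + 0] `&`
    [set z | 0 < (-1) * z.1 + (-1) * z.2 + 1].
  apply/seteqP; split=> z /=; first by case=> ? ? ?; repeat split; lra.
  by case=> -[? ?] ?; split; lra.
by apply: measurableI; [apply: measurableI|]; exact: (measurable_halfplane _ _ _).1.
Qed.

Lemma measurable_closed_simplex : plane_measurable closed_simplex.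
Proof.
have -> : closed_simplex =
    [set z | 0 <= 1 * z.1 + 0 * z.2 + 0] `&` [set z | 0 <= 0 * z.1 + 1 * z.2 + 0] `&`
    [set z | 0 <= (-1) * z.1 + (-1) * z.2 + 1].
  apply/seteqP; split=> z /=; first by case=> ? ? ?; repeat split; lra.
  by case=> -[? ?] ?; split; lra.
by apply: measurableI; [apply: measurableI|]; exact: (measurable_halfplane _ _ _).2.
Qed.

Lemma scale_pairE (t : R) z : t *: z = (t * z.1, t * z.2). Proof. by []. Qed.

Lemma area_bounded_fin (A : set (R * R)) : plane_measurable A ->
  A `<=` [set z | 0 <= z.1 <= 1 /\ 0 <= z.2 <= 1] -> area A \is a fin_num.
Proof.
move=> mA AS; rewrite ge0_fin_numE; last exact: measure_ge0.
have E : [set z : R * R | 0 <= z.1 <= 1 /\ 0 <= z.2 <= 1] =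
    `[0, 1]%classic `*` `[0, 1]%classic.
  by apply/seteqP; split=> z /=; rewrite !in_itv.
rewrite E in AS.
have mS : plane_measurable (`[0, 1]%classic `*` `[0, 1]%classic : set (R * R)).
  exact: (measurable_rect (measurable_itv _) (measurable_itv _)).
apply: (@le_lt_trans _ _ (area (`[0, 1]%classic `*` `[0, 1]%classic : set (R * R)))).
  by apply: le_measure => //; rewrite inE.
rewrite /area product_measure1E; [|exact: measurable_itv..].
have l1 : @lebesgue_measure R `[0, 1]%classic = 1%E.
  by rewrite lebesgue_measure_itv /= lte_fin ltr01 -EFinB subr0.
apply: (@le_lt_trans _ _ (1 * 1)%E); last by rewrite mule1 ltry.
by rewrite le_eqVlt; apply/orP; left; apply/eqP; congr (_ * _)%E; exact: l1.
Qed.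

Lemma area_closed_simplex : area closed_simplex = area open_simplex.
Proof.
pose N1 := [set z : R * R | z.1 = 0].
pose N2 := aff 0 (0, 1) (1, 0) @` [set z : R * R | z.1 = 0].
pose N3 := aff (1, 0) (1, 0) (-1, 1) @` [set z : R * R | z.1 = 0].
have [n1 m1] := area0_axis R.
have [|n2 m2] := @area_line R 0 (0, 1) (1, 0).
  by rewrite /vdet /= mul0r mul1r sub0r oppr_eq0 oner_neq0.
have [|n3 m3] := @area_line R (1, 0) (1, 0) (-1, 1).
  by rewrite /vdet /= mul0r mul1r subr0 oner_neq0.
have mo := measurable_open_simplex; have mc := measurable_closed_simplex.
have n12 : area (N1 `|` N2 `|` N3) = 0%E.
  by rewrite (area_setU_null (measurableU _ _ m1 m2) m3 n3) (area_setU_null m1 m2 n2).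
have mN : plane_measurable (N1 `|` N2 `|` N3).
  by apply: measurableU => //; exact: measurableU.
apply/eqP; rewrite eq_le; apply/andP; split; last first.
  apply: le_measure; rewrite ?inE// => z [? ? ?]; split; lra.
apply: (@le_trans _ _ (area (open_simplex `|` (N1 `|` N2 `|` N3)))).
  apply: le_measure; rewrite ?inE//; first exact: measurableU.
  move=> z [z1 z2 z3].
  have [z10|z10] := eqVneq z.1 0; first by right; left; left.
  have [z20|z20] := eqVneq z.2 0.
    right; left; right; exists (0, z.1) => //.
    case: z z1 z2 z3 z10 z20 => x y /= *; rewrite /aff /= !scale_pairE.
    by congr pair => /=; lra.
  have [z30|z30] := eqVneq (z.1 + z.2) 1.
    right; right; exists (0, z.2) => //.
    case: z z1 z2 z3 z10 z20 z30 => x y /= *; rewrite /aff /= !scale_pairE.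
    by congr pair => /=; lra.
  by left; split; rewrite ?lt_neqAle ?z10 ?z20 ?z30// eq_sym ?z10 ?z20.
by rewrite (area_setU_null mo mN n12).
Qed.

(** The two halves of the arc, which join at (1/3, 1/3), in their own frames. The origins (2/3, 0)
    and (0, 2/3) of these frames and the joining point lie on the line x + y = 2/3. *)
Definition third1 z : R * R := aff (2/3, 0) (1/3, 0) (-1/3, 1/3) z.
Definition third2 z : R * R := aff (0, 2/3) (1/3, -1/3) (0, 1/3) z.

Lemma third1E z : third1 z = ((2 + z.1 - z.2) / 3, z.2 / 3).
Proof. by rewrite /third1 /aff !scale_pairE; congr pair => /=; field. Qed.

Lemma third2E z : third2 z = (z.1 / 3, (2 - z.1 + z.2) / 3).
Proof. by rewrite /third2 /aff !scale_pairE; congr pair => /=; field. Qed.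

(** A decreasing arc as a bare set of points. [arc_anti], used in both orders, also settles equal
    coordinates. [arc_ivt] is the trace of the intermediate value theorem: the linear form equals
    [a] at (1, 0) and [- b] at (0, 1). *)
Record monotone_arc K : Prop := MonotoneArc {
  arc_left : K (1, 0);
  arc_right : K (0, 1);
  arc_ge0 : forall k, K k -> 0 <= k.1 /\ 0 <= k.2;
  arc_anti : forall k k', K k -> K k' -> (k.1 < k'.1) = (k'.2 < k.2);
  arc_ivt : forall a b c : R, - b <= c -> c <= a ->
    exists2 k, K k & a * k.1 - b * k.2 = c }.

Definition self_similar K := K = third1 @` K `|` third2 @` K.

(** The strict inequalities make this a union of open rectangles; the arc itself is left out, so its
    measure never matters. *)
Definition under K : set (R * R) :=
  [set z | [/\ 0 < z.1, 0 < z.2 & exists2 k, K k & z.1 < k.1 /\ z.2 < k.2]].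

Lemma arc_le1 K : monotone_arc K -> forall k, K k -> k.1 <= 1 /\ k.2 <= 1.
Proof.
move=> mK k Kk; have [k1 k2] := arc_ge0 mK Kk; split; rewrite leNgt; apply/negP.
  by rewrite (arc_anti mK (arc_left mK) Kk) /= ltNge k2.
by rewrite -(arc_anti mK Kk (arc_right mK)) /= ltNge k1.
Qed.

(** Rational corners make the union countable; each [F r1 r2] is a full rectangle or empty. *)
Lemma measurable_under K : plane_measurable (under K).
Proof.
pose F (r1 r2 : rat) : set (R * R) :=
  [set z | [/\ 0 < z.1 < ratr r1, 0 < z.2 < ratr r2 &
     exists2 k, K k & ratr r1 < k.1 /\ ratr r2 < k.2]].
have -> : under K = \bigcup_r1 \bigcup_r2 F r1 r2.
  apply/seteqP; split=> z.
    move=> [z1 z2 [k Kk [zk1 zk2]]].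
    have [r1] := rat_in_itvoo zk1; rewrite in_itv /= => /andP[? ?].
    have [r2] := rat_in_itvoo zk2; rewrite in_itv /= => /andP[? ?].
    exists r1 => //; exists r2 => //; split; [exact/andP|exact/andP|by exists k].
  case=> r1 _ [r2 _] /= [/andP[z1 zr1] /andP[z2 zr2] [k Kk [rk1 rk2]]].
  split=> //; exists k => //.
  by split; [exact: lt_trans rk1|exact: lt_trans rk2].
apply: bigcupT_measurable_rat => r1; apply: bigcupT_measurable_rat => r2.
have [[k Kk kE]|nk] := pselect (exists2 k, K k & ratr r1 < k.1 /\ ratr r2 < k.2).
  have -> : F r1 r2 = `]0, ratr r1[%classic `*` `]0, ratr r2[%classic.
    apply/seteqP; split=> z; rewrite /F /= !in_itv /=; first by case.
    by case=> ? ?; split=> //; exists k.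
  exact: (measurable_rect (measurable_itv _) (measurable_itv _)).
have -> : F r1 r2 = set0 by apply/seteqP; split=> z // [].
exact: measurable0.
Qed.

End ArcArea.

(** * The linear equation for the area under a self-similar arc *)

Section ArcAreaValue.
Variable R : realType.
Implicit Types (z k : R * R) (K : set (R * R)).

Lemma vdet_third1 : vdet (1/3, 0) (-1/3, 1/3) = 1/9 :> R.
Proof. by rewrite /vdet /=; field. Qed.

Lemma vdet_third2 : vdet (1/3, -1/3) (0, 1/3) = 1/9 :> R.
Proof. by rewrite /vdet /=; field. Qed.

Lemma arc_sum_ge K k : monotone_arc K -> self_similar K -> K k ->
  2 / 3 <= k.1 + k.2.
Proof.
move=> mK sK; rewrite [in X in X -> _]sK => -[] [k' /(arc_ge0 mK) [? ?] <-].
  by rewrite third1E /=; lra.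
by rewrite third2E /=; lra.
Qed.

Lemma arc_ray K z : monotone_arc K -> 0 <= z.1 -> 0 <= z.2 ->
  exists2 k, K k & z.2 * k.1 = z.1 * k.2.
Proof.
move=> mK z1 z2.
have [||k Kk kE] := @arc_ivt _ _ mK z.2 z.1 0; [by rewrite oppr_le0|by []|].
by exists k => //; apply/eqP; rewrite -subr_eq0 kE.
Qed.

(** The ray through [z] meets the arc at a point of larger coordinate sum, which therefore dominates
    [z]. *)
Lemma under_low K : monotone_arc K -> self_similar K ->
  [set z | [/\ 0 < z.1, 0 < z.2 & z.1 + z.2 < 2 / 3]] `<=` under K.
Proof.
move=> mK sK z [z1 z2 zlt]; split=> //.
have [k Kk kE] := arc_ray mK (ltW z1) (ltW z2).
have sk := arc_sum_ge mK sK Kk.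
exists k => //; split; rewrite ltNge; apply/negP => kz.
  have : k.2 <= z.2.
    by rewrite -(ler_pM2l z1) -kE [leRHS]mulrC ler_pM2l.
  lra.
have : k.1 <= z.1.
  by rewrite -(ler_pM2l z2) kE [leRHS]mulrC ler_pM2l.
lra.
Qed.

Lemma under_lt1 K z : monotone_arc K -> under K z -> z.1 < 1 /\ z.2 < 1.
Proof.
by move=> mK [z1 z2 [k /(arc_le1 mK) [? ?] [? ?]]]; split; lra.
Qed.

(** [third1] and [third2] do not preserve the product order, so an arbitrary dominating point cannot
    be transported. One found in the direction (b, a) can: the linear parts send (2, 1),
    respectively (1, 2), to a positive vector. *)
Lemma under_slope K z a b : monotone_arc K -> under K z ->
  - b <= a * z.1 - b * z.2 -> a * z.1 - b * z.2 <= a -> 0 < a -> 0 < b ->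
  exists k, [/\ K k, a * (k.1 - z.1) = b * (k.2 - z.2), z.1 < k.1 & z.2 < k.2].
Proof.
move=> mK [z1 z2 [k' Kk' [zk1 zk2]]] h1 h2 a0 b0.
have [k Kk kE] := arc_ivt mK h1 h2.
have E : a * (k.1 - z.1) = b * (k.2 - z.2) by lra.
have k2 : z.2 < k.2.
  rewrite ltNge; apply/negP => kz.
  have : k.1 <= z.1.
    have : a * (k.1 - z.1) <= 0 by rewrite E pmulr_rle0// subr_le0.
    by rewrite pmulr_rle0// subr_le0.
  move=> kz1; have := arc_anti mK Kk Kk'.
  by rewrite (le_lt_trans kz1 zk1) => /esym; rewrite ltNge (le_trans kz (ltW zk2)).
exists k; split=> //.
have : 0 < a * (k.1 - z.1) by rewrite E mulr_gt0// subr_gt0.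
by rewrite pmulr_rgt0// subr_gt0.
Qed.

Lemma under_third1 K : monotone_arc K -> self_similar K ->
  @third1 R @` under K `<=`
    under K `&` [set z | 2 / 3 < z.1 + z.2 /\ z.2 < 1 / 3].
Proof.
move=> mK sK _ [z Uz <-]; have [z11 z21] := under_lt1 mK Uz.
have [z1 z2 _] := Uz.
have [| | | |k [Kk kE zk1 zk2]] := under_slope (a := 1) (b := 2) mK Uz; [lra..|].
rewrite third1E; split; last by split => /=; lra.
split=> /=; [lra|lra|].
exists (third1 k); first by rewrite sK; left; exists k.
by rewrite third1E /=; split; lra.
Qed.

Lemma under_third2 K : monotone_arc K -> self_similar K ->
  @third2 R @` under K `<=`
    under K `&` [set z | 2 / 3 < z.1 + z.2 /\ 1 / 3 < z.2].
Proof.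
move=> mK sK _ [z Uz <-]; have [z11 z21] := under_lt1 mK Uz.
have [z1 z2 _] := Uz.
have [| | | |k [Kk kE zk1 zk2]] := under_slope (a := 2) (b := 1) mK Uz; [lra..|].
rewrite third2E; split; last by split => /=; lra.
split=> /=; [lra|lra|].
exists (third2 k); first by rewrite sK; right; exists k.
by rewrite third2E /=; split; lra.
Qed.

(** The inverses of [third1] and [third2], unlike the maps themselves, are monotone in both
    coordinates, so domination transports directly; the line x + y = 2/3 goes to a coordinate
    axis. *)
Lemma under_high K z : monotone_arc K -> self_similar K -> under K z ->
  2 / 3 < z.1 + z.2 -> (@third1 R @` under K `|` @third2 R @` under K) z.
Proof.
move=> mK sK [z1 z2 [k Kk [zk1 zk2]]] zs.
have : (@third1 R @` K `|` @third2 R @` K) k by rewrite -sK.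
case=> -[l Kl lk]; move: zk1 zk2; rewrite -lk.
  rewrite third1E /= => zk1 zk2; left.
  exists (3 * z.1 + 3 * z.2 - 2, 3 * z.2); last first.
    rewrite third1E /=; case: z {z1 z2 zs zk1 zk2} => x y /=.
    by congr pair; field.
  split=> /=; [lra|lra|exists l; [exact: Kl|split=> /=; lra]].
rewrite third2E /= => zk1 zk2; right.
exists (3 * z.1, 3 * z.1 + 3 * z.2 - 2); last first.
  rewrite third2E /=; case: z {z1 z2 zs zk1 zk2} => x y /=.
  by congr pair; field.
split=> /=; [lra|lra|exists l; [exact: Kl|split=> /=; lra]].
Qed.

Let low_simplex : set (R * R) := [set z | [/\ 0 < z.1, 0 < z.2 & z.1 + z.2 < 2 / 3]].

Lemma area_low : plane_measurable low_simplex /\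
  (area low_simplex = (4 / 9)%:E * area (@open_simplex R))%E.
Proof.
have dE : vdet (2/3, 0) (0, 2/3) = 4 / 9 :> R by rewrite /vdet /=; field.
have -> : low_simplex = aff 0 (2/3, 0) (0, 2/3) @` @open_simplex R.
  apply/seteqP; split=> z.
    move=> [z1 z2 zs]; exists (3/2 * z.1, 3 / 2 * z.2).
      by split=> /=; lra.
    rewrite /aff !scale_pairE; case: z {z1 z2 zs} => x y.
    by congr pair => /=; field.
  move=> [[x y] [/= x0 y0 xy] <-]; rewrite /aff !scale_pairE add0r.
  by split=> /=; lra.
have d0 : vdet (2/3, 0) (0, 2/3) != 0 :> R by rewrite dE lt0r_neq0//; lra.
have [m ->] := area_aff_image 0 d0 (@measurable_open_simplex R).
by rewrite dE ger0_norm//; lra.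
Qed.

Lemma area_under K : monotone_arc K -> self_similar K ->
  (area (under K) = (4 / 7)%:E * area (@open_simplex R))%E.
Proof.
move=> mK sK; set T0 := low_simplex.
pose N := aff (2/3, 0) (1, 0) (-1, 1) @` [set z : R * R | z.1 = 0].
have [|n0 mN] := @area_line R (2/3, 0) (1, 0) (-1, 1).
  by rewrite /vdet /= mul0r mul1r subr0 oner_neq0.
have [mT aT] := area_low; rewrite -/T0 in mT aT.
have mU := measurable_under K.
have d1 : vdet (1/3, 0) (-1/3, 1/3) != 0 :> R.
  by rewrite vdet_third1 lt0r_neq0//; lra.
have d2 : vdet (1/3, -1/3) (0, 1/3) != 0 :> R.
  by rewrite vdet_third2 lt0r_neq0//; lra.
have [m1 a1] := area_aff_image (2/3, 0) d1 mU.
have [m2 a2] := area_aff_image (0, 2/3) d2 mU.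
rewrite -/(@third1 R) in m1 a1; rewrite -/(@third2 R) in m2 a2.
set U1 := @third1 R @` under K; set U2 := @third2 R @` under K.
have aE : (area (under K) = area (T0 `|` U1 `|` U2))%E.
  have UE : under K = (T0 `|` U1 `|` U2) `|` (under K `&` N).
    apply/seteqP; split=> z.
      move=> Uz; case: (ltrgtP (z.1 + z.2) (2 / 3)) => zs.
      - by left; left; left; have [? ? _] := Uz.
      - have [] := under_high mK sK Uz zs => ?; first by left; left; right.
        by left; right.
      - right; split=> //; exists (0, z.2) => //.
        case: z zs {Uz} => x y /= zs; rewrite /aff !scale_pairE.
        by congr pair => /=; lra.
    case; last by case.
    move=> [[|]|]; first exact: under_low.
      by move/(under_third1 mK sK) => [].
    by move/(under_third2 mK sK) => [].
  have mUN : plane_measurable (under K `&` N) by exact: measurableI.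
  have UN0 : area (under K `&` N) = 0%E by apply: (area0_subset mUN mN _ n0) => z [].
  rewrite {1}UE; apply: area_setU_null mUN UN0.
  by apply: measurableU => //; exact: measurableU.
have disj12 : T0 `&` U1 = set0.
  apply/seteqP; split=> // z [[_ _ zs]] /(under_third1 mK sK) [_ [h _]].
  by have := lt_trans zs h; rewrite ltxx.
have disj3 : (T0 `|` U1) `&` U2 = set0.
  apply/seteqP; split=> // z [[|]].
    move=> [_ _ zs] /(under_third2 mK sK) [_ [h _]].
    by have := lt_trans zs h; rewrite ltxx.
  move=> /(under_third1 mK sK) [_ [_ h1]] /(under_third2 mK sK) [_ [_ h2]].
  by have := lt_trans h1 h2; rewrite ltxx.
move: aE; rewrite (area_setU (measurableU _ _ mT m1) m2 disj3) (area_setU mT m1 disj12).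
rewrite {}a1 {}a2 {}aT vdet_third1 vdet_third2.
(* Finiteness is what allows the equation u = 4/9 o + 2/9 u to be solved: infinity satisfies it
   too. *)
have fU : area (under K) \is a fin_num.
  apply: area_bounded_fin => // z Uz; have [? ?] := under_lt1 mK Uz.
  by have [? ? _] := Uz; split; apply/andP; split; apply: ltW.
have fO : area (@open_simplex R) \is a fin_num.
  apply: area_bounded_fin; first exact: measurable_open_simplex.
  by move=> z [? ? ?]; split; apply/andP; split; lra.
rewrite -(fineK fU) -(fineK fO).
move: (fine _) (fine _) => u o.
rewrite ger0_norm; last lra.
by rewrite -!EFinM -!EFinD => -[uE]; congr EFin; lra.
Qed.

End ArcAreaValue.

(** * The self-similar arc *)

Section Plane_topology.
Variable R : realType.
Implicit Types (z k : R * R).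

Lemma nbhs_planeP z (P : set (R * R)) : nbhs z P <->
  exists2 e : R, 0 < e &
    forall z', `|z.1 - z'.1| < e -> `|z.2 - z'.2| < e -> P z'.
Proof.
split; first move=> /nbhs_ballP [e /= e0 H].
  by exists e => // z' h1 h2; apply: H; split.
move=> [e e0 H]; apply/nbhs_ballP; exists e => //= z' [h1 h2]; exact: H.
Qed.

Lemma closure_planeP (A : set (R * R)) z : closure A z <->
  forall e : R, 0 < e -> exists z', [/\ A z', `|z.1 - z'.1| < e & `|z.2 - z'.2| < e].
Proof.
split=> [cA e e0|H B].
  have [|z' [Az' [h1 h2]]] := cA [set z' | `|z.1 - z'.1| < e /\ `|z.2 - z'.2| < e].
    by apply/nbhs_planeP; exists e.
  by exists z'.
by move=> /nbhs_planeP [e e0 HB]; have [z' [? ? ?]] := H e e0; exists z'; split=> //; exact: HB.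
Qed.

Lemma plane_fst_continuous : continuous (fun z : R * R => z.1 : R).
Proof. by move=> z; exact: cvg_fst. Qed.

Lemma plane_snd_continuous : continuous (fun z : R * R => z.2 : R).
Proof. by move=> z; exact: cvg_snd. Qed.

Lemma plane_pair_continuous (f g : R * R -> R) : continuous f -> continuous g ->
  continuous (fun z => (f z, g z) : R * R).
Proof. by move=> cf cg z; exact: (cvg_pair (cf z) (cg z)). Qed.

Lemma continuous_lin2 (a b c : R) : continuous (fun z : R * R => a * z.1 + b * z.2 + c : R).
Proof.
move=> z; apply: cvgD; last exact: cvg_cst.
apply: cvgD.
  by apply: cvgM; [exact: cvg_cst|exact: plane_fst_continuous].
by apply: cvgM; [exact: cvg_cst|exact: plane_snd_continuous].
Qed.

Lemma within_comp (A : set R) (g : R -> R * R) (h : R * R -> R) :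
  {within A, continuous g} -> continuous h -> {within A, continuous (h \o g)}.
Proof.
move=> /subspace_continuousP cg ch; apply/subspace_continuousP => s As.
by apply: (cvg_comp _ _ (cg s As)); exact: ch.
Qed.

Lemma within_compP (A : set R) (g : R -> R * R) (h : R * R -> R * R) :
  {within A, continuous g} -> continuous h -> {within A, continuous (h \o g)}.
Proof.
move=> /subspace_continuousP cg ch; apply/subspace_continuousP => s As.
by apply: (cvg_comp _ _ (cg s As)); exact: ch.
Qed.

Lemma aff_continuous (q e f : R * R) : continuous (aff q e f).
Proof.
have E : aff q e f = fun z => ((e.1 * z.1 + f.1 * z.2 + q.1 : R),
    (e.2 * z.1 + f.2 * z.2 + q.2 : R)).
  apply/funext => z; rewrite /aff !scale_pairE.
  by congr pair => /=; ring.
by rewrite E; apply: plane_pair_continuous; exact: continuous_lin2.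
Qed.

Lemma within_segmentP (a b s e : R) (g : R -> R * R) :
  {within `[a, b], continuous g} -> a <= s <= b -> 0 < e ->
  exists2 d, 0 < d & forall t, a <= t <= b -> `|s - t| < d ->
    `|(g s).1 - (g t).1| < e /\ `|(g s).2 - (g t).2| < e.
Proof.
move=> /subspace_continuousP cg ab e0.
have /cg cs : `[a, b]%classic s by rewrite /= in_itv.
have : nbhs (g s) [set z' | `|(g s).1 - z'.1| < e /\ `|(g s).2 - z'.2| < e].
  by apply/nbhs_planeP; exists e.
move/cs; rewrite /nbhs /= /within /= => /nbhs_ballP [d /= d0 H]; exists d => // t abt st.
by apply: H => //; rewrite in_itv.
Qed.

End Plane_topology.

(** * Systems of subdivided curves and their common image *)

Section Subdivision.
Variable R : realType.
Implicit Types (z k : R * R) (r a b c s t e : R) (g : R -> R * R).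

(** At each split, keep the half that contains [s]. After n splits the rank exceeds n, so the length
    is less than 2 / n. *)
Lemma refinement (G : R -> R -> R -> Prop) :
  (forall r a b, G r a b -> [/\ 0 < r, a <= b & (b - a) * r <= 2] /\
     exists c, [/\ a <= c, c <= b, G (r + 1) a c & G (r + 1) c b]) ->
  forall r a b s e, G r a b -> a <= s <= b -> 0 < e ->
  exists r' a' b', [/\ G r' a' b', a <= a', b' <= b, a' <= s <= b' & b' - a' < e].
Proof.
move=> HG r a b s e Gr sab e0.
have H n : exists r' a' b',
    [/\ G r' a' b', a <= a', b' <= b, a' <= s <= b' & n%:R < r'].
  elim: n => [|n [r' [a' [b' [G' aa bb /andP[as' sb] nr]]]]].
    by exists r, a, b; have [[? ? ?] _] := HG _ _ _ Gr.
  have [_ [c [ac cb G1 G2]]] := HG _ _ _ G'.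
  have nr' : n.+1%:R < r' + 1 by rewrite -natr1 ltrD2r.
  have [sc|cs] := leP s c.
    by exists (r' + 1), a', c; split=> //; [exact: le_trans cb bb|rewrite as'].
  by exists (r' + 1), c, b'; split=> //; [exact: le_trans aa ac|rewrite (ltW cs)].
have [n nE] : exists n, 2 / e < n%:R.
  by exists (Num.truncn (2 / e)).+1; apply: truncnS_gt.
have [r' [a' [b' [G' aa bb as' nr]]]] := H n.
exists r', a', b'; split=> //.
have [[r0 ab' ba] _] := HG _ _ _ G'.
rewrite -(ltr_pM2r r0); apply: (le_lt_trans ba).
by rewrite mulrC -ltr_pdivrMr//; exact: lt_trans nr.
Qed.

(** The left ends of ever shorter intervals around [s] converge to [s]. *)
Lemma refinement_closed (G : R -> R -> R -> Prop) (Z : set (R * R)) g :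
  (forall r a b, G r a b -> [/\ 0 < r, a <= b & (b - a) * r <= 2] /\
     exists c, [/\ a <= c, c <= b, G (r + 1) a c & G (r + 1) c b]) ->
  (forall r a b, G r a b -> Z (g a)) -> closed Z ->
  forall r a b s, G r a b -> {within `[a, b], continuous g} -> a <= s <= b -> Z (g s).
Proof.
move=> HG GZ cZ r a b s Gr cg sab; apply: cZ; apply/closure_planeP => e e0.
have [d d0 H] := within_segmentP cg sab e0.
have [r' [a' [b' [G' aa bb /andP[as' sb'] ba]]]] := refinement HG Gr sab d0.
have [h1 h2] : `|(g s).1 - (g a').1| < e /\ `|(g s).2 - (g a').2| < e.
  apply: H; first by rewrite aa (le_trans as')// (le_trans sb').
  by rewrite ger0_norm; [lra|rewrite subr_ge0].
by exists (g a'); split=> //; exact: GZ G'.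
Qed.

Inductive arc_orbit : R * R -> Prop :=
| arc_orbit_left : arc_orbit (1, 0)
| arc_orbit_right : arc_orbit (0, 1)
| arc_orbit_third1 z : arc_orbit z -> arc_orbit (third1 z)
| arc_orbit_third2 z : arc_orbit z -> arc_orbit (third2 z).

Definition arc : set (R * R) := closure arc_orbit.

(* The rank r increases by one at each subdivision, so the bound on (b - a) * r
   makes the intervals of the subdivision arbitrarily short. *)
Definition subdivides (F : R -> R -> R -> (R -> R * R) -> Prop) :=
  forall r a b g, F r a b g ->
    [/\ 0 < r, a < b, (b - a) * r <= 2 & {within `[a, b], continuous g}] /\
    [/\ g a = (1, 0), g b = (0, 1) &
        exists c g1 g2, [/\ a < c < b, F (r + 1) a c g1, F (r + 1) c b g2,
          forall t, g t = third1 (g1 t) & forall t, g t = third2 (g2 t)]].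

Section System.
Variable F : R -> R -> R -> (R -> R * R) -> Prop.
Hypothesis subF : subdivides F.

(* P is an invariant of the compositions w of third1 and third2 that express g
   through its renormalized restrictions. *)
Definition descendant (P : (R * R -> R * R) -> Prop) g r a b :=
  exists g' w, [/\ F r a b g', forall t, g t = w (g' t) & P w].

Lemma descendantP P g : (forall w, P w -> P (w \o @third1 R) /\ P (w \o @third2 R)) ->
  forall r a b, descendant P g r a b -> [/\ 0 < r, a <= b & (b - a) * r <= 2] /\
     exists c, [/\ a <= c, c <= b, descendant P g (r + 1) a c &
                   descendant P g (r + 1) c b].
Proof.
move=> HP r a b [g' [w [Fg gw Pw]]].
have [[r0 ab ba cg] [ga gb [c [g1 [g2 [/andP[ac cb] F1 F2 E1 E2]]]]]] := subF Fg.
have [P1 P2] := HP _ Pw.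
split; first by split=> //; exact: ltW.
exists c; split; [exact: ltW|exact: ltW| |].
  by exists g1, (w \o @third1 R); split=> // t; rewrite gw E1.
by exists g2, (w \o @third2 R); split=> // t; rewrite gw E2.
Qed.

(** At the left end of a subdivision interval, [g] takes the value at (1, 0) of a word in the two
    maps, an orbit point. *)
Lemma system_sub_arc r a b g s : F r a b g -> a <= s <= b -> arc (g s).
Proof.
move=> Fg sab.
pose P (w : R * R -> R * R) := forall z, arc_orbit z -> arc_orbit (w z).
have HP w : P w -> P (w \o @third1 R) /\ P (w \o @third2 R).
  by move=> Pw; split=> z Oz; apply: Pw; constructor.
have Gg : descendant P g r a b by exists g, id; split.
have [[_ _ _ cg] _] := subF Fg.
apply: (refinement_closed (descendantP HP) _ _ Gg cg sab).
  move=> r' a' b' [g' [w [Fg' gw Pw]]].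
  have [_ [ga _ _]] := subF Fg'.
  by apply: subset_closure; rewrite gw ga; apply: Pw; constructor.
exact: closed_closure.
Qed.

(** The induction removes the outermost map and passes to a half of the interval, hence the
    generalization over all members of [F]. *)
Lemma orbit_sub_system z : arc_orbit z -> forall r a b g, F r a b g ->
  exists2 s, a <= s <= b & g s = z.
Proof.
elim=> [r a b g Fg|r a b g Fg|z' _ IH r a b g Fg|z' _ IH r a b g Fg];
  have [[r0 ab ba cg] [ga gb [c [g1 [g2 [/andP[ac cb] F1 F2 E1 E2]]]]]] := subF Fg.
- by exists a => //; rewrite lexx ltW.
- by exists b => //; rewrite lexx ltW.
- have [s /andP[? ?] sE] := IH _ _ _ _ F1; exists s; last by rewrite E1 sE.
  by apply/andP; split=> //; lra.
- have [s /andP[? ?] sE] := IH _ _ _ _ F2; exists s; last by rewrite E2 sE.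
  by apply/andP; split=> //; lra.
Qed.

(** The image is compact, hence closed, so it contains the closure of the orbit as soon as it
    contains the orbit. *)
Lemma system_image r a b g : F r a b g -> arc = g @` `[a, b].
Proof.
move=> Fg; apply/seteqP; split=> z; last first.
  by move=> [s sab <-]; apply: (system_sub_arc Fg); move: sab; rewrite /= in_itv.
have [[_ _ _ cg] _] := subF Fg.
have cI : closed (g @` `[a, b]).
  apply: compact_closed; first exact: norm_hausdorff.
  by apply: continuous_compact => //; exact: segment_compact.
move=> arcz; apply: cI; apply: closure_subset arcz => z' /orbit_sub_system.
by move=> /(_ _ _ _ _ Fg) [s sab <-]; exists s => //; rewrite /= in_itv.
Qed.

Lemma system_simplex r a b g s : F r a b g -> a <= s <= b ->
  [/\ 0 <= (g s).1, 0 <= (g s).2 & (g s).1 + (g s).2 <= 1].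
Proof.
move=> Fg sab; have : arc (g s) := system_sub_arc Fg sab.
have Oz z : arc_orbit z -> [/\ 0 <= z.1, 0 <= z.2 & z.1 + z.2 <= 1].
  elim=> [||{}z _ [? ? ?]|{}z _ [? ? ?]]; rewrite ?third1E ?third2E /=; split; lra.
move=> /closure_planeP H; split; rewrite leNgt; apply/negP => lt0.
- have [z [/Oz [z1 z2 z12] h1 h2]] := H (- (g s).1) ltac:(lra).
  by move: h1; rewrite ltr_norml => /andP[? ?]; lra.
- have [z [/Oz [z1 z2 z12] h1 h2]] := H (- (g s).2) ltac:(lra).
  by move: h2; rewrite ltr_norml => /andP[? ?]; lra.
- have [z [/Oz [z1 z2 z12] h1 h2]] := H (((g s).1 + (g s).2 - 1) / 2) ltac:(lra).
  by move: h1 h2; rewrite !ltr_norml => /andP[? ?] /andP[? ?]; lra.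
Qed.

(** Induction on the number of splits after which no interval is long enough to contain both [s] and
    [t]. Once a splitting point separates them, the simplices of the two halves are already in the
    right order. *)
Lemma system_weak r a b g s t : F r a b g -> a <= s -> s < t -> t <= b ->
  (g t).1 <= (g s).1 /\ (g s).2 <= (g t).2.
Proof.
move=> Fg as' st tb.
have [n] : exists n : nat, 2 < (t - s) * (r + n%:R).
  exists (Num.truncn (2 / (t - s))).+1.
  rewrite mulrC -ltr_pdivrMr ?subr_gt0//.
  apply: (lt_le_trans (truncnS_gt _)); rewrite lerDr.
  by have [[/ltW]] := subF Fg.
elim: n r a b g Fg as' tb => [|n IH] r a b g Fg as' tb;
  have [[r0 ab ba cg] [ga gb [c [g1 [g2 [/andP[ac cb] F1 F2 E1 E2]]]]]] := subF Fg => h.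
  have : (t - s) * r <= (b - a) * r by rewrite ler_pM2r//; lra.
  by lra.
have h' : 2 < (t - s) * (r + 1 + n%:R) by rewrite -addrA nat1r.
have [tc|ct] := leP t c.
  by have := IH _ _ _ _ F1 as' tc h'; rewrite !E1 !third1E /=; lra.
have [cs|sc] := leP c s.
  by have := IH _ _ _ _ F2 cs tb h'; rewrite !E2 !third2E /=; lra.
have [|x1 y1 xy1] := @system_simplex _ _ _ _ s F1; first by lra.
have [|x2 y2 xy2] := @system_simplex _ _ _ _ t F2; first by lra.
by rewrite (E1 s) (E2 t) third1E third2E /=; lra.
Qed.

(** A whole subdivision interval fits between [s] and [t], around their midpoint. The values at its
    ends are strictly ordered, being the images of (0, 1) and (1, 0) under a word in the two
    maps. *)
Lemma system_strict r a b g s t : F r a b g -> a <= s -> s < t -> t <= b ->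
  (g t).1 < (g s).1 /\ (g s).2 < (g t).2.
Proof.
move=> Fg as' st tb.
pose P (w : R * R -> R * R) := forall z z' : R * R,
  z.1 < z'.1 -> z'.2 < z.2 -> (w z).1 < (w z').1 /\ (w z').2 < (w z).2.
have HP w : P w -> P (w \o @third1 R) /\ P (w \o @third2 R).
  move=> Pw; split=> z z' h1 h2; apply: Pw; rewrite ?third1E ?third2E /=; lra.
have Gg : descendant P g r a b by exists g, id; split=> // z z'.
have [||r' [a' [b' [[g' [w [Fg' gw Pw]]] aa bb /andP[am mb] ba]]]] :=
    refinement (descendantP HP) Gg (s := (s + t) / 2) (e := (t - s) / 2).
- by apply/andP; split; lra.
- by lra.
have [[_ ab' _ _] [ga gb _]] := subF Fg'.
have [w1 w2] := Pw (0, 1) (1, 0) ltr01 ltr01.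
rewrite -ga -gb -!gw in w1 w2.
have := @system_weak _ _ _ _ s a' Fg as' ltac:(lra) ltac:(lra).
have := @system_weak _ _ _ _ b' t Fg ltac:(lra) ltac:(lra) tb.
lra.
Qed.

Lemma system_monotone_arc r a b g : F r a b g -> monotone_arc arc.
Proof.
move=> Fg; have [[r0 ab ba cg] [ga gb _]] := subF Fg.
have aE := system_image Fg.
have inarc s : a <= s <= b -> arc (g s) by move=> h; exact: system_sub_arc Fg h.
split.
- by rewrite -ga; apply: inarc; rewrite lexx ltW.
- by rewrite -gb; apply: inarc; rewrite lexx ltW.
- move=> k; rewrite aE => -[s]; rewrite /= in_itv /= => sab <-.
  by have [] := system_simplex Fg sab.
- move=> k k'; rewrite aE => -[s + <-] [t + <-]; rewrite /= !in_itv /=.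
  move=> /andP[as' sb] /andP[at' tb].
  case: (ltgtP s t) => [st|ts|->].
  + have [h1 h2] := system_strict Fg as' st tb.
    by rewrite ltNge (ltW h1) ltNge (ltW h2).
  + by have [-> ->] := system_strict Fg at' ts sb.
  + by rewrite !ltxx.
- move=> al be c h1 h2.
  pose f s := al * (g s).1 + - be * (g s).2 + 0.
  have cf : {within `[a, b], continuous f}.
    exact: (within_comp cg (@continuous_lin2 R al (- be) 0)).
  have fa : f a = al by rewrite /f ga /=; lra.
  have fb : f b = - be by rewrite /f gb /=; lra.
  have [|s sab fs] := IVT (v := c) (ltW ab) cf.
    rewrite fa fb; apply/andP; split; first by rewrite ge_min h1 orbT.
    by rewrite le_max h2.
  exists (g s); first by apply: inarc; move: sab; rewrite in_itv.
  by rewrite -fs /f; lra.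
Qed.

Lemma system_self_similar r a b g : F r a b g -> self_similar arc.
Proof.
move=> Fg.
have [[r0 ab ba cg] [ga gb [c [g1 [g2 [/andP[ac cb] F1 F2 E1 E2]]]]]] := subF Fg.
rewrite /self_similar {1}(system_image Fg) {1}(system_image F1) (system_image F2).
apply/seteqP; split=> z.
  move=> [s]; rewrite /= in_itv /= => /andP[as' sb] <-.
  have [sc|cs] := leP s c; [left|right].
    by exists (g1 s) => //; exists s => //=; rewrite in_itv /= as' sc.
  by exists (g2 s) => //; exists s => //=; rewrite in_itv /= (ltW cs).
case=> -[_ [s sc <-] <-]; move: sc; rewrite /= in_itv /= => /andP[? ?].
  by exists s; [rewrite /= in_itv /=; apply/andP; split; lra|rewrite E1].
by exists s; [rewrite /= in_itv /=; apply/andP; split; lra|rewrite E2].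
Qed.

End System.

(** [swap] exchanges [third1] and [third2]; this is what allows a curve to be run backwards. *)
Lemma arc_swap z : arc z -> arc (swap z).
Proof.
have Oz z' : arc_orbit z' -> arc_orbit (swap z').
  elim=> [||{}z' _|{}z' _]; [exact: arc_orbit_right|exact: arc_orbit_left| |].
    move/arc_orbit_third2; rewrite third2E third1E /swap /=.
    by congr arc_orbit; congr pair; ring.
  move/arc_orbit_third1; rewrite third2E third1E /swap /=.
  by congr arc_orbit; congr pair; ring.
move=> /closure_planeP H; apply/closure_planeP => e e0.
by have [z' [? ? ?]] := H e e0; exists (swap z'); split=> //; exact: Oz.
Qed.

End Subdivision.

(** * Star-shaped regions *)

Section Star.
Variable R : realType.
Implicit Types (z k v q e f : R * R) (s t c M : R) (X B T : set (R * R)).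

Lemma bounded_planeP X : bounded_set X <->
  exists M, forall z, X z -> `|z.1| <= M /\ `|z.2| <= M.
Proof.
split.
  move=> [M [_ HM]]; exists (M + 1) => z Xz.
  have /(_ z Xz) := HM (M + 1) ltac:(rewrite ltrDl ltr01//).
  by rewrite /= prod_normE ge_max => /andP.
move=> [M HM]; exists M; split; first exact: num_real.
move=> M' MM' z Xz /=; apply: le_trans (ltW MM').
by rewrite prod_normE ge_max; apply/andP; exact: HM.
Qed.

Lemma line_continuous q v : continuous (fun t : R => q + t *: v).
Proof.
move=> t.
have cl (a b : R) : a + s * b @[s --> t] --> a + t * b.
  by apply: cvgD; [exact: cvg_cst|apply: cvgM; [exact: cvg_id|exact: cvg_cst]].
exact: (cvg_pair (cl q.1 v.1) (cl q.2 v.2)).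
Qed.

Lemma line_connected q v (i : interval R) : connected ((fun t => q + t *: v) @` [set` i]).
Proof.
apply: connected_continuous_connected.
  by apply/connected_intervalP; exact: interval_is_interval.
by apply: continuous_subspaceT; exact: line_continuous.
Qed.

Lemma ray_unbounded q v c X : v != 0 -> (forall t, c <= t -> X (q + t *: v)) ->
  ~ bounded_set X.
Proof.
move=> v0 HX /bounded_planeP [M HM].
have [v1|v1] := eqVneq v.1 0; last first.
  pose t := Num.max c ((M + `|q.1| + 1) / `|v.1|).
  have [+ _] := HM _ (HX t ltac:(rewrite /t le_max lexx//)).
  rewrite /= leNgt => /negP; apply.
  have : (M + `|q.1| + 1) <= t * `|v.1|.
    by rewrite -ler_pdivrMr ?normr_gt0// /t le_max lexx orbT.
  have : t * `|v.1| <= `|t * v.1| by rewrite normrM ler_wpM2r// ler_norm.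
  have := ler_normB (q.1 + t * v.1) q.1; rewrite [in `|_ + _ - _|]addrC addKr.
  rewrite /GRing.scale /=; lra.
have v2 : v.2 != 0.
  by apply: contraNneq v0 => v2; apply/eqP; case: v v1 v2 {HX} => x y /= -> ->.
pose t := Num.max c ((M + `|q.2| + 1) / `|v.2|).
have [_] := HM _ (HX t ltac:(rewrite /t le_max lexx//)).
rewrite /= leNgt => /negP; apply.
have : (M + `|q.2| + 1) <= t * `|v.2|.
  by rewrite -ler_pdivrMr ?normr_gt0// /t le_max lexx orbT.
have : t * `|v.2| <= `|t * v.2| by rewrite normrM ler_wpM2r// ler_norm.
have := ler_normB (q.2 + t * v.2) q.2; rewrite [in `|_ + _ - _|]addrC addKr.
rewrite /GRing.scale /=; lra.
Qed.

(** The only access to the component: rays and segments that avoid the boundary and touch [T] lie in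
    it. *)
Lemma bounded_region_absorb A T X z : bounded_region A T -> T z ->
  X z -> X `<=` A -> connected X -> X `<=` T /\ bounded_set X.
Proof.
move=> [z0 Az0 [TE bT]] Tz Xz XA cX.
have XT : X `<=` T.
  by rewrite TE (@same_connected_component _ A z0 z) -?TE//; exact: connected_component_max.
split=> //; move/bounded_planeP : bT => [M HM].
by apply/bounded_planeP; exists M => x /XT; exact: HM.
Qed.

Section Frame.
Variables (q e f : R * R).
Hypothesis d0 : vdet e f != 0.
Let A := aff q e f.
Let dir k := k.1 *: e + k.2 *: f.

Lemma aff_inj : injective A.
Proof.
move=> [x y] [x' y'] []; rewrite /=.
case: e d0 => e1 e2; case: f => f1 f2; rewrite /vdet /= => d0' /= E1 E2.
have H1 : (x - x') * (e1 * f2 - e2 * f1) = 0.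
  rewrite /GRing.scale /= in E1 E2.
  have -> : (x - x') * (e1 * f2 - e2 * f1) =
     f2 * ((q.1 + x * e1 + y * f1) - (q.1 + x' * e1 + y' * f1)) -
     f1 * ((q.2 + x * e2 + y * f2) - (q.2 + x' * e2 + y' * f2)) by ring.
  by rewrite E1 E2 !subrr !mulr0 subrr.
have H2 : (y - y') * (e1 * f2 - e2 * f1) = 0.
  rewrite /GRing.scale /= in E1 E2.
  have -> : (y - y') * (e1 * f2 - e2 * f1) =
     e1 * ((q.2 + x * e2 + y * f2) - (q.2 + x' * e2 + y' * f2)) -
     e2 * ((q.1 + x * e1 + y * f1) - (q.1 + x' * e1 + y' * f1)) by ring.
  by rewrite E1 E2 !subrr !mulr0 subrr.
move/eqP: H1; rewrite mulf_eq0 (negPf d0') orbF subr_eq0 => /eqP ->.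
by move/eqP: H2; rewrite mulf_eq0 (negPf d0') orbF subr_eq0 => /eqP ->.
Qed.

Lemma aff_surj z : exists k, A k = z.
Proof.
have : ([set: R * R] : set (R * R)) z by [].
have -> : [set: R * R] = A @` setT.
  by rewrite /A aff_image// preimage_setT.
by move=> [k _ <-]; exists k.
Qed.

Lemma aff_scale t k : A (t *: k) = q + t *: dir k.
Proof.
rewrite /A /aff /dir !scale_pairE -addrA; congr (_ + _).
by congr pair => /=; ring.
Qed.

Lemma dir_neq0 k : k != 0 -> dir k != 0.
Proof.
apply: contra_neq => dk; apply: aff_inj.
have := aff_scale 1 k; rewrite scale1r => ->; have := aff_scale 0 k.
by rewrite dk !scaler0 scale0r => ->.
Qed.

Lemma aff_ray_connected k (i : interval R) :
  connected ((fun t => A (t *: k)) @` [set` i]).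
Proof.
have -> : (fun t => A (t *: k)) = (fun t => q + t *: dir k).
  by apply/funext => t; exact: aff_scale.
exact: line_connected.
Qed.

Lemma aff_ray_unbounded k c X : k != 0 -> (forall t, c <= t -> X (A (t *: k))) ->
  ~ bounded_set X.
Proof.
move=> k0 HX; apply: (@ray_unbounded q (dir k) c) => [|t ct]; first exact: dir_neq0.
by rewrite -aff_scale; exact: HX.
Qed.

Variable B : set (R * R).
Hypothesis ray_uniq : forall k k' t, B k -> B k' -> 0 <= t -> k' = t *: k -> t = 1.

(** The case [t = 0] of [ray_uniq]: a zero vector is 0 times itself. *)
Lemma ray_neq0 k : B k -> k != 0.
Proof.
move=> Bk; apply/eqP => k0.
have := ray_uniq Bk Bk (lexx 0); rewrite k0 scaler0 => /(_ erefl) /eqP.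
by rewrite eq_sym oner_eq0.
Qed.

Lemma ray_notin k t : B k -> 0 <= t -> t != 1 -> (~` (A @` B)) (A (t *: k)).
Proof.
move=> Bk t0 t1 [k' Bk' /aff_inj kE].
by move: t1; rewrite (ray_uniq Bk Bk' t0 kE) eqxx.
Qed.

(** Beyond the boundary point, the rest of the ray escapes to infinity without meeting the
    boundary. *)
Lemma no_outer T k c : bounded_region (~` (A @` B)) T -> B k -> 1 < c ->
  ~ T (A (c *: k)).
Proof.
move=> rT Bk c1 Tc.
pose X := (fun t => A (t *: k)) @` [set` `[c, +oo[].
have [||| _] := @bounded_region_absorb _ T X _ rT Tc.
- by exists c => //=; rewrite in_itv /= lexx.
- move=> _ [t ct <-]; move: ct; rewrite /= in_itv /= andbT => ct.
  have t1 := lt_le_trans c1 ct.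
  by apply: ray_notin => //; [exact: ltW (lt_trans ltr01 t1)|rewrite gt_eqF].
- exact: aff_ray_connected.
apply: (@aff_ray_unbounded k c); first exact: ray_neq0.
by move=> t ct; exists t => //; rewrite /= in_itv /= ct.
Qed.

(** Outer points are excluded by [no_outer]. Conversely the inner segments all contain the center,
    so their union is connected, and it avoids the boundary. *)
Lemma star_region T : (forall z, exists2 k, B k & exists2 t, 0 <= t & z = t *: k) ->
  bounded_region (~` (A @` B)) T ->
  T = A @` [set z | exists2 k, B k & exists2 t, 0 <= t < 1 & z = t *: k].
Proof.
move=> ray_ex rT; set I := A @` _.
have TI : T `<=` I.
  move=> z Tz; have [w wz] := aff_surj z.
  have [k Bk [t t0 wE]] := ray_ex w; exists w => //; exists k => //; exists t => //.
  rewrite t0 /= ltNge le_eqVlt; apply/negP => /orP[/eqP t1|t1].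
    have [z0 _ [TE _]] := rT.
    have : (~` (A @` B)) z by move: Tz; rewrite TE; exact: connected_component_sub.
    by apply; exists k => //; rewrite -wz wE -t1 scale1r.
  by apply: (no_outer rT Bk t1); rewrite -wE wz.
apply/seteqP; split=> // z Iz.
have [z0 Az0 [TE bT]] := rT.
have Tz0 : T z0 by rewrite TE; exact: connected_component_refl.
suff [XT _] : I `<=` T /\ bounded_set I by exact: XT.
apply: (bounded_region_absorb rT Tz0); first exact: TI.
  move=> _ [w [k Bk [t /andP[t0 t1] ->]] <-].
  by apply: ray_notin => //; rewrite lt_eqF.
have -> : I = \bigcup_(k in B) ((fun t => A (t *: k)) @` [set` `[0, 1[]).
  apply/seteqP; split=> x.
    by move=> [w [k Bk [t t01 ->]] <-]; exists k => //; exists t.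
  move=> [k Bk [t /= + <-]]; rewrite in_itv /= => t01.
  by exists (t *: k) => //; exists k => //; exists t.
apply: bigcup_connected; last by move=> k _; exact: aff_ray_connected.
by exists (A 0) => k _; exists 0; [rewrite /= in_itv /= lexx ltr01|rewrite scale0r].
Qed.

(** An inner point escapes by going back to the center and out along the free ray [v]; every other
    point goes out along its own ray. *)
Lemma no_bounded_region T v : v != 0 -> (forall t, 0 <= t -> ~ B (t *: v)) ->
  ~ bounded_region (~` (A @` B)) T.
Proof.
move=> v0 Bv rT.
have [z0 Az0 [TE _]] := rT.
have Tz0 : T z0 by rewrite TE; exact: connected_component_refl.
have [w wz] := aff_surj z0.
have [[k Bk [t t0 wE]]|nray] :=
    pselect (exists2 k, B k & exists2 t, 0 <= t & w = t *: k); last first.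
  have [w0|w0] := eqVneq w 0.
    have [||| _] := @bounded_region_absorb _ T
        ((fun t => A (t *: v)) @` [set` `[0, +oo[]) _ rT Tz0.
    - by exists 0; [rewrite /= in_itv /= lexx|rewrite scale0r -w0].
    - move=> _ [t /= t0 <-] [k' Bk' /aff_inj kE]; apply: (Bv t); rewrite -?kE//.
      by move: t0; rewrite in_itv /= andbT.
    - exact: aff_ray_connected.
    apply: (@aff_ray_unbounded v 0) => // t t0; exists t => //.
    by rewrite /= in_itv /= t0.
  have [||| _] := @bounded_region_absorb _ T
      ((fun t => A (t *: w)) @` [set` `[1, +oo[]) _ rT Tz0.
  - by exists 1; [rewrite /= in_itv /= lexx|rewrite scale1r].
  - move=> _ [t /= + <-] [k' Bk' /aff_inj kE]; rewrite in_itv /= andbT => t1.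
    have t0 : 0 < t := lt_le_trans ltr01 t1.
    apply: nray; exists k' => //; exists t^-1; first by rewrite invr_ge0 ltW.
    by rewrite kE scalerA mulVf ?gt_eqF// scale1r.
  - exact: aff_ray_connected.
  apply: (@aff_ray_unbounded w 1) => // t t1; exists t => //.
  by rewrite /= in_itv /= t1.
have [t1|t1|t1] := ltgtP t 1; last first.
- by apply: Az0; exists k => //; rewrite -wz wE t1 scale1r.
- by apply: (no_outer rT Bk t1); rewrite -wE wz.
have [||| _] := @bounded_region_absorb _ T
    ((fun t => A (t *: k)) @` [set` `[0, t]] `|`
     (fun t => A (t *: v)) @` [set` `[0, +oo[]) _ rT Tz0.
- by left; exists t; [rewrite /= in_itv /= t0 lexx|rewrite -wE].
- move=> _ [] [s /= + <-]; rewrite in_itv /=.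
    move=> /andP[s0 st]; apply: ray_notin => //.
    by rewrite lt_eqF//; exact: le_lt_trans t1.
  by rewrite andbT => s0 [k' Bk' /aff_inj kE]; apply: (Bv s); rewrite -?kE.
- apply: connectedU; [|exact: aff_ray_connected|exact: aff_ray_connected].
  exists (A 0); split; exists 0; try by rewrite scale0r.
    by rewrite /= in_itv /= lexx.
  by rewrite /= in_itv /= lexx.
apply: (@aff_ray_unbounded v 0) => // s s0; right; exists s => //.
by rewrite /= in_itv /= s0.
Qed.

End Frame.
End Star.

(** * The region enclosed by three arcs *)

Section ThreeArcs.
Variable R : realType.
Implicit Types (z k q e f : R * R) (t : R) (K T : set (R * R)).

(* Cycles e, f, - (e + f) in the frame (e, f). *)
Definition rot3 z : R * R := aff 0 (0, 1) (-1, -1) z.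

Lemma rot3E z : rot3 z = (- z.2, z.1 - z.2).
Proof. by rewrite /rot3 /aff add0r !scale_pairE; congr pair => /=; ring. Qed.

Lemma rot3Z t z : rot3 (t *: z) = t *: rot3 z.
Proof. by rewrite !rot3E !scale_pairE /=; congr pair; ring. Qed.

Lemma rot3K z : rot3 (rot3 (rot3 z)) = z.
Proof. by case: z => x y; rewrite !rot3E /=; congr pair; ring. Qed.

Lemma rot3_inj : injective rot3.
Proof. by move=> z z' E; rewrite -(rot3K z) E rot3K. Qed.

Lemma aff_rot3 q e f z : aff q e f (rot3 z) = aff q f (- (e + f)) z.
Proof.
rewrite rot3E /aff !scale_pairE -!addrA; congr (_ + _).
by congr pair => /=; ring.
Qed.

Lemma aff_rot33 q e f z : aff q e f (rot3 (rot3 z)) = aff q (- (e + f)) e z.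
Proof.
rewrite aff_rot3 rot3E /aff !scale_pairE -!addrA; congr (_ + _).
by congr pair => /=; ring.
Qed.

Section Arc.
Variable K : set (R * R).
Hypothesis mK : monotone_arc K.

Lemma arc_axis1 k : K k -> k.1 = 0 -> k = (0, 1).
Proof.
move=> Kk k1; have := arc_anti mK Kk (arc_right mK); have := arc_anti mK (arc_right mK) Kk.
case: k Kk k1 => x y /= _ ->; rewrite ltxx => /esym /negbT; rewrite -leNgt => h1.
by move=> /esym /negbT; rewrite -leNgt => h2; congr pair; apply/eqP; rewrite eq_le h1 h2.
Qed.

Lemma arc_axis2 k : K k -> k.2 = 0 -> k = (1, 0).
Proof.
move=> Kk k2; have := arc_anti mK Kk (arc_left mK); have := arc_anti mK (arc_left mK) Kk.
case: k Kk k2 => x y /= _ ->; rewrite ltxx => /negbT; rewrite -leNgt => h1.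
by move=> /negbT; rewrite -leNgt => h2; congr pair; apply/eqP; rewrite eq_le h1 h2.
Qed.

Lemma arc_sum_gt0 k : K k -> 0 < k.1 + k.2.
Proof.
move=> Kk; have [k1 k2] := arc_ge0 mK Kk; rewrite lt_neqAle addr_ge0// andbT eq_sym.
rewrite paddr_eq0//; apply/negP => /andP[/eqP h1 /eqP h2].
have := arc_axis1 Kk h1; rewrite [k]surjective_pairing h1 h2 => -[/eqP].
by rewrite eq_sym oner_eq0.
Qed.

(** Two points of one ray are comparable in both coordinates at once, against [arc_anti]. *)
Lemma arc_ray_uniq k k' t : K k -> K k' -> 0 <= t -> k' = t *: k -> t = 1.
Proof.
move=> Kk Kk' t0 E; have [k1 k2] := arc_ge0 mK Kk; have s := arc_sum_gt0 Kk.
have a1 := arc_anti mK Kk Kk'; have a2 := arc_anti mK Kk' Kk.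
move: a1 a2; rewrite E scale_pairE /= => a1 a2.
have [t1|t1|//] := ltgtP t 1.
  have h1 : t * k.1 <= k.1 by rewrite ler_piMl// ltW.
  have h2 : t * k.2 <= k.2 by rewrite ler_piMl// ltW.
  move: a1 a2; rewrite [_ < t * k.1]ltNge h1 [_ < t * k.2]ltNge h2 /=.
  move=> /esym /negbT; rewrite -leNgt => h3 /negbT; rewrite -leNgt => h4.
  have : t * (k.1 + k.2) < k.1 + k.2 by rewrite gtr_pMl.
  by rewrite mulrDr; lra.
have h1 : k.1 <= t * k.1 by rewrite ler_peMl// ltW.
have h2 : k.2 <= t * k.2 by rewrite ler_peMl// ltW.
move: a1 a2; rewrite [t * k.1 < _]ltNge h1 [t * k.2 < _]ltNge h2 /=.
move=> /negbT; rewrite -leNgt => h3 /esym /negbT; rewrite -leNgt => h4.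
have : k.1 + k.2 < t * (k.1 + k.2) by rewrite ltr_pMl.
by rewrite mulrDr; lra.
Qed.

Lemma arc_ray_ex z : 0 <= z.1 -> 0 <= z.2 ->
  exists2 k, K k & exists2 t, 0 <= t & z = t *: k.
Proof.
move=> z1 z2; have [k Kk kE] := arc_ray mK z1 z2; exists k => //.
have s := arc_sum_gt0 Kk.
exists ((z.1 + z.2) / (k.1 + k.2)); first by apply: divr_ge0; [exact: addr_ge0|exact: ltW].
case: z z1 z2 kE => x y /= x0 y0 kE; rewrite scale_pairE /=.
have s0 : k.1 + k.2 != 0 by rewrite gt_eqF.
congr pair; apply: (mulIf s0); rewrite mulrAC divfK//.
  by rewrite mulrDr mulrDl kE.
by rewrite mulrDr mulrDl -kE.
Qed.

Definition three_arcs : set (R * R) :=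
  K `|` rot3 @` K `|` (rot3 \o rot3) @` K.

Lemma three_arcs_rot k : three_arcs k -> three_arcs (rot3 k).
Proof.
case=> [[Kk|[l Kl <-]]|[l Kl <-]].
- by left; right; exists k.
- by right; exists l.
- by left; left; rewrite rot3K.
Qed.

(** The rotation brings [k] into the first sector. Other sectors share only an edge with it, where
    both arcs have the same end point. *)
Lemma three_arcs_uniq k k' t : three_arcs k -> three_arcs k' -> 0 <= t ->
  k' = t *: k -> t = 1.
Proof.
wlog Kk : k k' / K k.
  move=> H Bk Bk' t0 E; case: (Bk) => [[Kk|[l Kl lk]]|[l Kl lk]].
  - exact: (H k k').
  - apply: (H l (rot3 (rot3 k')) Kl) => //; first by left; left.
      by do 2 apply: three_arcs_rot.
    by rewrite E !rot3Z -lk rot3K.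
  - apply: (H l (rot3 k') Kl) => //; first by left; left.
      exact: three_arcs_rot.
    by rewrite E !rot3Z -lk /= rot3K.
move=> _ Bk' t0 E.
have [k1 k2] := arc_ge0 mK Kk; have s := arc_sum_gt0 Kk.
case: Bk' => [[Kk'|[l Kl lk]]|[l Kl lk]].
- exact: (arc_ray_uniq Kk Kk').
- have [l1 l2] := arc_ge0 mK Kl.
  move: E; rewrite -lk rot3E scale_pairE => -[E1 E2].
  have h1 := mulr_ge0 t0 k1.
  have l20 : l.2 = 0 by lra.
  move: E1 E2; rewrite (arc_axis2 Kl l20) /= => E1 E2.
  have tn0 : t != 0 by apply: contra_eq_neq E2 => ->; rewrite mul0r subr0 oner_neq0.
  have k10 : k.1 = 0.
    by apply/eqP; move/esym/eqP: E1; rewrite oppr0 mulf_eq0 (negPf tn0).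
  by move: E2; rewrite (arc_axis1 Kk k10) /= => E2; lra.
- have [l1 l2] := arc_ge0 mK Kl.
  move: E; rewrite -lk /= !rot3E scale_pairE => -[E1 E2].
  have h2 := mulr_ge0 t0 k2; rewrite /= in E1 E2.
  have l10 : l.1 = 0 by lra.
  move: E1 E2; rewrite (arc_axis1 Kl l10) /= => E1 E2.
  have tn0 : t != 0.
    by apply/eqP => t00; move: E1; rewrite t00 mul0r; lra.
  have k20 : k.2 = 0.
    have : t * k.2 = 0 by lra.
    by move/eqP; rewrite mulf_eq0 (negPf tn0) => /eqP.
  by move: E1; rewrite (arc_axis2 Kk k20) /= => E1; lra.
Qed.

Lemma three_arcs_ex z : exists2 k, three_arcs k & exists2 t, 0 <= t & z = t *: k.
Proof.
have [z12|z12] : (0 <= z.1 /\ 0 <= z.2) \/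
    ((z.1 <= 0 /\ z.1 <= z.2) \/ (z.2 <= 0 /\ z.2 <= z.1)).
- by case: (lerP 0 z.1) => ?; case: (lerP 0 z.2) => ?; case: (lerP z.1 z.2) => ?; lra.
- have [k Kk [t t0 E]] := arc_ray_ex z12.1 z12.2.
  by exists k; [left; left|exists t].
case: z12 => -[h1 h2].
  have [||k Kk [t t0 E]] := @arc_ray_ex (z.2 - z.1, - z.1) => /=; [lra|lra|].
  exists (rot3 k); first by left; right; exists k.
  exists t => //; rewrite -rot3Z -E rot3E /=.
  by case: z {h1 h2 E} => x y /=; congr pair; ring.
have [||k Kk [t t0 E]] := @arc_ray_ex (- z.2, z.1 - z.2) => /=; [lra|lra|].
exists (rot3 (rot3 k)); first by right; exists k.
exists t => //; rewrite -!rot3Z -E !rot3E /=.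
by case: z {h1 h2 E} => x y /=; congr pair; ring.
Qed.

Let W := under K.
Let H : set (R * R) := `[0, 1[%classic `*` [set 0].

Definition star3 : set (R * R) :=
  [set z | exists2 k, three_arcs k & exists2 t, 0 <= t < 1 & z = t *: k].

Let star3_rot z : star3 z -> star3 (rot3 z).
Proof.
move=> [k Bk [t t01 ->]]; exists (rot3 k); first exact: three_arcs_rot.
by exists t => //; rewrite rot3Z.
Qed.

(** Three open sectors and three spokes. The spoke along the second axis of a sector is the first
    spoke of the next sector, so [H] and its two rotations suffice; the center belongs to [H]. *)
Lemma star3E : star3 = W `|` rot3 @` W `|` (rot3 \o rot3) @` W `|`
  (H `|` rot3 @` H `|` (rot3 \o rot3) @` H).
Proof.
have KW k t : K k -> 0 <= t < 1 ->
    W (t *: k) \/ (H (t *: k) \/ exists2 h, H h & t *: k = rot3 h).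
  move=> Kk /andP[t0 t1].
  have [k1 k2] := arc_ge0 mK Kk.
  have [->|tn0] := eqVneq t 0.
    by right; left; rewrite scale0r; split => //=; rewrite in_itv /= lexx ltr01.
  have [k20|k2n0] := eqVneq k.2 0.
    right; left; rewrite (arc_axis2 Kk k20) scale_pairE; split=> /=.
      by rewrite in_itv /= mulr1 t0.
    by rewrite mulr0.
  have [k10|k1n0] := eqVneq k.1 0.
    right; right; exists (t, 0).
      by split=> //=; rewrite in_itv /= t0.
    rewrite (arc_axis1 Kk k10) scale_pairE rot3E /=.
    by congr pair; ring.
  have tp : 0 < t by rewrite lt_neqAle eq_sym tn0.
  have k1p : 0 < k.1 by rewrite lt_neqAle eq_sym k1n0.
  have k2p : 0 < k.2 by rewrite lt_neqAle eq_sym k2n0.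
  left; split=> /=; [by rewrite mulr_gt0|by rewrite mulr_gt0|].
  by exists k => //; rewrite !gtr_pMl.
apply/seteqP; split=> z.
  move=> [k Bk [t t01 ->]].
  case: Bk => [[Kk|[l Kl <-]]|[l Kl <-]].
  - have [w|[h|[h Hh ->]]] := KW k t Kk t01; first by left; left; left.
      by right; left; left.
    by right; left; right; exists h.
  - rewrite -rot3Z; have [w|[h|[h Hh ->]]] := KW l t Kl t01.
    + by left; left; right; exists (t *: l).
    + by right; left; right; exists (t *: l).
    + by right; right; exists h.
  - rewrite -[(rot3 \o rot3) l]/(rot3 (rot3 l)) -!rot3Z.
    have [w|[h|[h Hh ->]]] := KW l t Kl t01.
    + by left; right; exists (t *: l).
    + by right; right; exists (t *: l).
    + by right; left; left; rewrite rot3K.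
have Wstar w : W w -> star3 w.
  move=> [w1 w2 [k' Kk' [wk1 wk2]]].
  have [k Kk [t t0 E]] := arc_ray_ex (ltW w1) (ltW w2).
  exists k; first by left; left.
  exists t => //; rewrite t0 /= ltNge; apply/negP => t1.
  have [k1 k2] := arc_ge0 mK Kk.
  have h1 : k.1 <= w.1 by rewrite E scale_pairE /= ler_peMl.
  have h2 : k.2 <= w.2 by rewrite E scale_pairE /= ler_peMl.
  have := arc_anti mK Kk Kk'; rewrite (le_lt_trans h1 wk1) => /esym.
  by rewrite ltNge (le_trans h2 (ltW wk2)).
have Hstar h : H h -> star3 h.
  move=> [/=]; rewrite in_itv /= => h01 h2.
  exists (1, 0); first by left; left; exact: arc_left mK.
  exists h.1 => //; case: h h2 {h01} => x y /= ->; rewrite scale_pairE /=.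
  by rewrite mulr1 mulr0.
case=> -[[|]|].
- exact: Wstar.
- by move=> [w /Wstar ? <-]; exact: star3_rot.
- by move=> [w /Wstar ? <-]; do 2 apply: star3_rot.
- exact: Hstar.
- by move=> [w /Hstar ? <-]; exact: star3_rot.
- by move=> [w /Hstar ? <-]; do 2 apply: star3_rot.
Qed.

Lemma area_star3 : plane_measurable star3 /\ (area star3 = 3%:E * area W)%E.
Proof.
have d1 : vdet (0, 1) (-1, -1) = 1 :> R by rewrite /vdet /=; ring.
have dn0 : vdet (0, 1) (-1, -1) != 0 :> R by rewrite d1 oner_neq0.
have rotM X : plane_measurable X ->
    plane_measurable (rot3 @` X) /\ area (rot3 @` X) = area X.
  move=> mX; have [m ->] := area_aff_image 0 dn0 mX.
  by rewrite d1 normr1 mul1e.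
have rot2M X : plane_measurable X -> plane_measurable ((rot3 \o rot3) @` X) /\
    area ((rot3 \o rot3) @` X) = area X.
  move=> mX; rewrite -image_comp; have [m a] := rotM _ mX.
  have [m' a'] := rotM _ m; split; first exact: m'.
  exact: etrans a' a.
have mW : plane_measurable W by exact: measurable_under.
have mH : plane_measurable H.
  by apply: measurable_rect; [exact: measurable_itv|exact: measurable_set1].
have aH : area H = 0%E.
  have d01 : vdet (0, 1) (1, 0) != 0 :> R.
    by rewrite /vdet /= mul0r mul1r sub0r oppr_eq0 oner_neq0.
  have [n0 m0] := area_line 0 d01.
  apply: (area0_subset mH m0 _ n0) => -[x y] [_ /= ->]; exists (0, x) => //.
  by rewrite /aff !scale_pairE /=; congr pair => /=; ring.
have [mW1 aW1] := rotM _ mW; have [mW2 aW2] := rot2M _ mW.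
have [mH1 aH1] := rotM _ mH; have [mH2 aH2] := rot2M _ mH.
rewrite star3E; set X := W `|` _ `|` _; set Y := H `|` _ `|` _.
have mX : plane_measurable X by apply: measurableU => //; exact: measurableU.
have mY : plane_measurable Y by apply: measurableU => //; exact: measurableU.
have aY : area Y = 0%E.
  rewrite /Y (area_setU_null (measurableU _ _ mH mH1) mH2 (etrans aH2 aH)).
  by rewrite (area_setU_null mH mH1 (etrans aH1 aH)).
split; first exact: measurableU.
rewrite (area_setU_null mX mY aY) /X.
rewrite (area_setU (measurableU _ _ mW mW1) mW2); last first.
  apply/seteqP; split=> z // [[Wz|[w Ww <-]]].
    move=> [w Ww wz]; move: Wz; rewrite -wz /= !rot3E => -[/= z1 z2 _].
    by have [? ? _] := Ww; lra.
  move=> [w' Ww'] /rot3_inj wE; move: Ww; rewrite -wE rot3E => -[/= w1 w2 _].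
  by have [? ? _] := Ww'; lra.
rewrite (area_setU mW mW1); last first.
  apply/seteqP; split=> z // [Wz [w Ww wz]]; move: Wz; rewrite -wz rot3E => -[/= z1 _ _].
  by have [? ? _] := Ww; lra.
rewrite aW1 aW2.
have -> : 3 = 1 + 1 + 1 :> R by ring.
by rewrite !EFinD !ge0_muleDl ?mul1e ?adde_ge0 ?lee_fin.
Qed.

End Arc.

(** The edges 2 e + f and e + 2 f from the third vertex have determinant three times that of [e],
    [f]. *)
Lemma area_triangle q e f : vdet e f != 0 ->
  (area (triangle (q + e)%R (q + f)%R (q - (e + f))%R) =
   (3 * `|vdet e f|)%:E * area (@open_simplex R))%E.
Proof.
move=> d0; have -> : triangle (q + e) (q + f) (q - (e + f)) =
    aff (q - (e + f)) (e + (e + f)) (f + (e + f)) @` @closed_simplex R.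
  apply/seteqP; split=> z.
    move=> [a [b [c [a0 b0 c0 abc ->]]]]; exists (a, b).
      by split=> //=; lra.
    have -> : c = 1 - a - b by lra.
    rewrite /aff !scale_pairE; congr pair => /=; ring.
  move=> [[a b] [/= a0 b0 ab] <-]; exists a, b, (1 - a - b); split=> //; [lra|ring|].
  by rewrite /aff !scale_pairE; congr pair => /=; ring.
have dE : vdet (e + (e + f)) (f + (e + f)) = 3 * vdet e f.
  by rewrite /vdet /=; ring.
have d30 : vdet (e + (e + f)) (f + (e + f)) != 0.
  by rewrite dE mulf_neq0// pnatr_eq0.
have [_ ->] := area_aff_image (q - (e + f)) d30 (@measurable_closed_simplex R).
by rewrite area_closed_simplex dE normrM ger0_norm.
Qed.

Lemma area_three_arcs q e f K T : vdet e f != 0 -> monotone_arc K -> self_similar K ->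
  bounded_region (~` (aff q e f @` K `|` aff q f (- (e + f)) @` K `|`
                      aff q (- (e + f)) e @` K)) T ->
  (area T = (4 / 7)%:E * area (triangle (q + e)%R (q + f)%R (q - (e + f))%R))%E.
Proof.
move=> d0 mK sK.
have -> : aff q e f @` K `|` aff q f (- (e + f)) @` K `|` aff q (- (e + f)) e @` K =
    aff q e f @` three_arcs K.
  rewrite /three_arcs !image_setU !image_comp; congr (_ `|` _ `|` _).
    by congr (_ @` _); apply/funext => z /=; rewrite aff_rot3.
  by congr (_ @` _); apply/funext => z /=; rewrite aff_rot33.
move=> rT; have [mS aS] := area_star3 mK.
rewrite (star_region d0 (three_arcs_uniq mK) (three_arcs_ex mK) rT).
have [_ ->] := area_aff_image q d0 mS.
rewrite aS area_under// area_triangle//.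
rewrite EFinM [RHS]muleCA !muleA; congr (_ * _)%E.
by rewrite -!EFinM; congr EFin; ring.
Qed.

End ThreeArcs.

(** * Circles tangent to a fixed circle *)

Section CircleVectors.
Variable R : realType.
Variables (c0 : R * R) (r0 : R).
Hypothesis hr0 : 0 < r0.
Implicit Types (u v w z p : R * R) (C S : gcircle R).

Definition sq u : R * R := (u.1 ^+ 2 - u.2 ^+ 2, 2 * (u.1 * u.2)).

(** The identity cos 2x = 1 - 2 sin^2 x, with x the angle from [u] to [v]. *)
Lemma dotp_sq u v : dotp (sq u) (sq v) = dotp u u * dotp v v - 2 * vdet u v ^+ 2.
Proof. by rewrite /dotp /sq /vdet /=; ring. Qed.

Lemma dotp_ge0 z : 0 <= dotp z z.
Proof. by rewrite /dotp addr_ge0// -expr2 sqr_ge0. Qed.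

Lemma dotp_eq0 z : dotp z z = 0 -> z = 0.
Proof.
move/eqP; rewrite /dotp -!expr2 paddr_eq0 ?sqr_ge0// !sqrf_eq0.
by case: z => x y /= /andP[/eqP -> /eqP ->].
Qed.

Lemma lagrange u v : dotp u u * dotp v v = dotp u v ^+ 2 + vdet u v ^+ 2.
Proof. by rewrite /dotp /vdet; ring. Qed.

Lemma enorm_sqr z : enorm z ^+ 2 = dotp z z.
Proof. by rewrite /enorm sqr_sqrtr// dotp_ge0. Qed.

Lemma enorm_ge0 z : 0 <= enorm z. Proof. exact: sqrtr_ge0. Qed.

Lemma enorm_le z (r : R) : 0 <= r -> (enorm z <= r) = (dotp z z <= r ^+ 2).
Proof.
by move=> r_ge0; rewrite -enorm_sqr ler_pXn2r// nnegrE ?enorm_ge0.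
Qed.

Lemma enorm_eq z (r : R) : 0 <= r -> enorm z = r <-> dotp z z = r ^+ 2.
Proof.
move=> r_ge0; split=> [<-|E]; first by rewrite enorm_sqr.
by rewrite /enorm E sqrtr_sqr ger0_norm.
Qed.

(* u is the square root of v(C) normalized by |u|^2 = 1 + r0 / r, that is,
   |u| = 1 for a line; it is determined up to sign.  Two circles are tangent
   when vdet u v = 1 or -1, and the successor is represented by u + v if the
   signs are such that dotp u v > 0. *)
Definition represents C u : Prop :=
  match C with
  | Circle c r _ => c = c0 + r *: sq u /\ r * (dotp u u - 1) = r0
  | Line n d _ => dotp u u = 1 /\
      exists2 s, s != 0 & n = s *: sq u /\ d - dotp n c0 = s * r0
  end.

Lemma represents_ge1 C u : represents C u -> 1 <= dotp u u.
Proof.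
case: C => [c r r_gt0 [_ E]|n d n0 [->]]//.
by rewrite -subr_ge0 -(pmulr_rge0 _ r_gt0) E ltW.
Qed.

(* In complex notation, (z - c0) * conj u - r0 * u, a real-linear function of u
   of determinant - pw z.  The disc of the circle represented by u is
   |lmap z u|^2 <= pw z, so that by Lagrange's identity the relative position of
   the discs of u and v is governed by vdet u v. *)
Definition lmap z u : R * R :=
  ((z.1 - c0.1) * u.1 + (z.2 - c0.2) * u.2 - r0 * u.1,
   (z.2 - c0.2) * u.1 - (z.1 - c0.1) * u.2 - r0 * u.2).

Definition pw z : R := dotp (z - c0) (z - c0) - r0 ^+ 2.

Definition qf u z : R := dotp (lmap z u) (lmap z u) - pw z.

Definition disc u : set (R * R) := [set z | qf u z <= 0].

(** The quadratic coefficient vanishes exactly when |u| = 1, so proper circles and lines share one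
    equation. *)
Lemma qfE u z : qf u z = (dotp u u - 1) * dotp (z - c0) (z - c0)
   - 2 * r0 * dotp (z - c0) (sq u) + r0 ^+ 2 * (dotp u u + 1).
Proof. by rewrite /qf /pw /lmap /dotp /sq /=; ring. Qed.

Lemma qf_circle c r u z : c = c0 + r *: sq u -> r * (dotp u u - 1) = r0 ->
  r * qf u z = r0 * (dotp (z - c) (z - c) - r ^+ 2).
Proof.
move=> -> rE; rewrite qfE -rE /dotp /sq scale_pairE /=; ring.
Qed.

Lemma represents_points C u : represents C u -> points C = [set z | qf u z = 0].
Proof.
case: C => [c r r_gt0 [cE rE]|n d n0 [u1 [s s0 [nE dE]]]] /=.
  apply/seteqP; split=> z /=; rewrite enorm_eq ?ltW// => E.
    by apply: (mulfI (lt0r_neq0 r_gt0)); rewrite (qf_circle _ cE rE) E subrr !mulr0.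
  have := qf_circle z cE rE; rewrite E mulr0 => /esym/eqP.
  by rewrite mulf_eq0 (gt_eqF hr0) /= subr_eq0 => /eqP.
have qE z : s * qf u z = 2 * r0 * (d - dotp n z).
  rewrite qfE u1 -(subrK (dotp n c0) d) dE nE scale_pairE /dotp /=; ring.
apply/seteqP; split=> z /= E.
  by apply: (mulfI s0); rewrite qE E subrr !mulr0.
have := qE z; rewrite E mulr0 => /esym/eqP; rewrite !mulf_eq0 (gt_eqF hr0).
by rewrite pnatr_eq0 /= subr_eq0 => /eqP.
Qed.

Lemma represents_bounds C u : represents C u -> bounds C (disc u).
Proof.
case: C => [c r r_gt0 [cE rE]|n d n0 [u1 [s s0 [nE dE]]]] /=.
  apply/seteqP; split=> z; rewrite /disc /= (enorm_le _ (ltW r_gt0)) -(pmulr_rle0 _ r_gt0);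
    by rewrite (qf_circle _ cE rE) pmulr_rle0// subr_le0.
have qE z : s * qf u z = 2 * r0 * (d - dotp n z).
  rewrite qfE u1 -(subrK (dotp n c0) d) dE nE scale_pairE /dotp /=; ring.
have r2 : 0 < 2 * r0 by rewrite mulr_gt0.
case: (ltrgt0P s) s0 => // sp _; [right|left]; apply/seteqP; split=> z; rewrite /disc /=.
- by rewrite -(pmulr_rle0 _ sp) qE pmulr_rle0// subr_le0.
- by rewrite -(pmulr_rle0 _ sp) qE pmulr_rle0// subr_le0.
- by rewrite -(nmulr_rge0 _ sp) qE pmulr_rge0// subr_ge0.
- by rewrite -(nmulr_rge0 _ sp) qE pmulr_rge0// subr_ge0.
Qed.

Lemma points_base z : points (Circle c0 hr0) z <-> pw z = 0.
Proof.
rewrite /= enorm_eq ?ltW// /pw; split=> [->|/eqP]; first by rewrite subrr.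
by rewrite subr_eq0 => /eqP.
Qed.

Lemma disc_base z : (enorm (z - c0) <= r0) = (pw z <= 0).
Proof. by rewrite (enorm_le _ (ltW hr0)) /pw subr_le0. Qed.

Lemma lmapD z u v : lmap z (u + v) = lmap z u + lmap z v.
Proof. by rewrite /lmap; congr pair => /=; ring. Qed.

Lemma lmap_lagrange z u v : dotp (lmap z u) (lmap z u) * dotp (lmap z v) (lmap z v) =
  dotp (lmap z u) (lmap z v) ^+ 2 + pw z ^+ 2 * vdet u v ^+ 2.
Proof. by rewrite /lmap /pw /dotp /vdet /=; ring. Qed.

(** This is r0 times the sum of the two curvatures, positive unless both circles are lines. *)
Let bigK u v := dotp u u + dotp v v - 2.

Definition contact u v : R * R := c0 + (r0 / bigK u v) *: (sq u + sq v).

(** Completing the square leaves no constant: |u^2 + v^2|^2 = K (K + 4) for K = [bigK u v], by the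
    hypothesis on [vdet]. Hence the two discs share only the point where the square vanishes. *)
Lemma qf_sum u v z : vdet u v ^+ 2 = 1 ->
  let x := bigK u v *: (z - c0) - r0 *: (sq u + sq v) in
  bigK u v * (qf u z + qf v z) = dotp x x.
Proof.
move=> d1 x; rewrite !qfE /x.
have <- : bigK u v * (bigK u v * dotp (z - c0) (z - c0)
    - 2 * r0 * dotp (z - c0) (sq u + sq v) + r0 ^+ 2 * (bigK u v + 4)) =
   bigK u v * ((dotp u u - 1) * dotp (z - c0) (z - c0)
   - 2 * r0 * dotp (z - c0) (sq u) + r0 ^+ 2 * (dotp u u + 1) +
   ((dotp v v - 1) * dotp (z - c0) (z - c0)
   - 2 * r0 * dotp (z - c0) (sq v) + r0 ^+ 2 * (dotp v v + 1))).
  by rewrite /bigK /dotp /=; ring.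
have E : dotp (sq u + sq v) (sq u + sq v) = bigK u v * (bigK u v + 4).
  transitivity (dotp (sq u) (sq u) + dotp (sq v) (sq v) + 2 * dotp (sq u) (sq v)).
    by rewrite /dotp /=; ring.
  rewrite !dotp_sq d1 /bigK.
  have -> : vdet u u = 0 by rewrite /vdet; ring.
  have -> : vdet v v = 0 by rewrite /vdet; ring.
  by ring.
transitivity (bigK u v ^+ 2 * dotp (z - c0) (z - c0) -
  2 * r0 * bigK u v * dotp (z - c0) (sq u + sq v) +
  r0 ^+ 2 * dotp (sq u + sq v) (sq u + sq v)).
  by rewrite E; ring.
by rewrite !scale_pairE /dotp /=; ring.
Qed.

Lemma qf_sum_le0 u v z : vdet u v ^+ 2 = 1 -> 0 < bigK u v ->
  qf u z + qf v z <= 0 -> z = contact u v.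
Proof.
move=> d1 K0 q0; have := qf_sum z d1; set x := _ - _ => /= xE.
have : dotp x x = 0.
  by apply/eqP; rewrite eq_le dotp_ge0 -xE pmulr_rle0// q0.
move/dotp_eq0/eqP; rewrite subr_eq0 => /eqP E.
rewrite /contact mulrC -scalerA -E scalerA mulVf ?gt_eqF// scale1r.
by rewrite addrC subrK.
Qed.

(** Only the sum is known to vanish there, that is a + b = 2 p. Lagrange's identity a b = h^2 + p^2
    then gives (a - b)^2 = - 4 h^2, so a = b = p. *)
Lemma qf_contact u v : vdet u v ^+ 2 = 1 -> 0 < bigK u v ->
  qf u (contact u v) = 0 /\ qf v (contact u v) = 0.
Proof.
move=> d1 K0; have := qf_sum (contact u v) d1; set x := _ - _ => /= xE.
have x0 : x = 0.
  rewrite /x /contact [c0 + _]addrC addrK scalerA mulrCA mulfV ?gt_eqF// mulr1.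
  exact: subrr.
have /eqP : bigK u v * (qf u (contact u v) + qf v (contact u v)) = 0.
  by rewrite xE x0 /dotp /= !mulr0 addr0.
rewrite mulf_eq0 (gt_eqF K0) /= => /eqP.
have := lmap_lagrange (contact u v) u v; rewrite d1 mulr1 /qf.
set a := dotp _ _; set b := dotp _ _; set h := dotp _ _; set p := pw _ => E s0.
have h2 := sqr_ge0 h.
have : (a - b) ^+ 2 <= 0.
  have -> : (a - b) ^+ 2 = (a + b) ^+ 2 - 4 * (a * b) by ring.
  have -> : a + b = 2 * p by lra.
  rewrite E; have -> : (2 * p) ^+ 2 = 4 * p ^+ 2 by ring.
  lra.
have := sqr_ge0 (a - b) => h3 h4.
have /eqP : (a - b) ^+ 2 = 0 by apply/eqP; rewrite eq_le h4.
by rewrite sqrf_eq0 subr_eq0 => /eqP ab; lra.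
Qed.

Lemma tangent_at_represents C C' u v : represents C u -> represents C' v ->
  vdet u v ^+ 2 = 1 -> 0 < bigK u v -> tangent_at C C' (contact u v).
Proof.
move=> rC rC' d1 K0; split.
  move=> [l1 l2]; case: C rC l1 => // n d nn [u1 _] _.
  case: C' rC' l2 => // n' d' nn' [v1 _] _.
  by move: K0; rewrite /bigK u1 v1; lra.
rewrite (represents_points rC) (represents_points rC').
apply/seteqP; split=> z /=.
  by move=> [q1 q2]; apply: qf_sum_le0 => //; rewrite q1 q2 addr0.
by move=> ->; exact: qf_contact.
Qed.

Definition base_contact u : R * R := c0 + (r0 / dotp u u) *: sq u.

(** In complex notation, z - c0 = r0 u / conj u = r0 u^2 / |u|^2. *)
Lemma lmap_eq0 u z : 0 < dotp u u -> lmap z u = 0 -> z = base_contact u.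
Proof.
move=> u0 [E1 E2]; rewrite /base_contact scale_pairE.
have un0 : dotp u u != 0 by rewrite gt_eqF.
have H1 : (z.1 - c0.1) * dotp u u = r0 * (sq u).1.
  transitivity (r0 * (sq u).1 +
    u.1 * ((z.1 - c0.1) * u.1 + (z.2 - c0.2) * u.2 - r0 * u.1) -
    u.2 * ((z.2 - c0.2) * u.1 - (z.1 - c0.1) * u.2 - r0 * u.2)).
    by rewrite /dotp /sq /=; ring.
  by rewrite E1 E2; ring.
have H2 : (z.2 - c0.2) * dotp u u = r0 * (sq u).2.
  transitivity (r0 * (sq u).2 +
    u.2 * ((z.1 - c0.1) * u.1 + (z.2 - c0.2) * u.2 - r0 * u.1) +
    u.1 * ((z.2 - c0.2) * u.1 - (z.1 - c0.1) * u.2 - r0 * u.2)).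
    by rewrite /dotp /sq /=; ring.
  by rewrite E1 E2; ring.
rewrite [z]surjective_pairing; congr pair => /=; apply: (mulIf un0).
  by rewrite mulrDl mulrAC divfK// -H1; ring.
by rewrite mulrDl mulrAC divfK// -H2; ring.
Qed.

Lemma base_contactP u : 0 < dotp u u ->
  lmap (base_contact u) u = 0 /\ pw (base_contact u) = 0.
Proof.
move=> u0; have un0 : dotp u u != 0 by rewrite gt_eqF.
have E : base_contact u - c0 = (r0 / dotp u u) *: sq u.
  by rewrite /base_contact addrC addKr.
have E1 : (base_contact u).1 - c0.1 = r0 / dotp u u * (sq u).1.
  by rewrite -[LHS]/((base_contact u - c0).1) E.
have E2 : (base_contact u).2 - c0.2 = r0 / dotp u u * (sq u).2.
  by rewrite -[LHS]/((base_contact u - c0).2) E.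
split.
  rewrite /lmap E1 E2; congr pair => /=.
    transitivity (r0 / dotp u u * dotp u u * u.1 - r0 * u.1); last by rewrite divfK// subrr.
    by move: (r0 / dotp u u) => i; rewrite /dotp; ring.
  transitivity (r0 / dotp u u * dotp u u * u.2 - r0 * u.2); last by rewrite divfK// subrr.
  by move: (r0 / dotp u u) => i; rewrite /dotp; ring.
rewrite /pw E.
transitivity ((r0 / dotp u u) ^+ 2 * dotp (sq u) (sq u) - r0 ^+ 2).
  by rewrite /dotp scale_pairE /=; ring.
rewrite dotp_sq; have -> : vdet u u = 0 by rewrite /vdet; ring.
transitivity ((r0 / dotp u u * dotp u u) ^+ 2 - r0 ^+ 2); first by ring.
by rewrite divfK// subrr.
Qed.

Lemma base_disc u z : 0 < dotp u u -> pw z <= 0 -> qf u z <= 0 -> z = base_contact u.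
Proof.
move=> u0 p0; rewrite /qf subr_le0 => q0; apply: lmap_eq0 => //; apply: dotp_eq0.
by apply/eqP; rewrite eq_le dotp_ge0 (le_trans q0).
Qed.

Lemma tangent_at_base C u : represents C u -> tangent_at (Circle c0 hr0) C (base_contact u).
Proof.
move=> rC; have u1 := represents_ge1 rC.
have u0 : 0 < dotp u u by exact: lt_le_trans u1.
split; first by case=> [[]].
rewrite (represents_points rC); apply/seteqP; split=> z.
  by move=> [/points_base p0 /= q0]; apply: base_disc => //; rewrite ?p0 ?q0.
move=> ->; have [l0 p0] := base_contactP u0; split; first exact/points_base.
by rewrite /= /qf l0 p0 /dotp /= mulr0 addr0 subrr.
Qed.

(** The vector |v|^2 u^2 - |u|^2 v^2 has squared length 4 |u|^2 |v|^2 det(u, v)^2, which is not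
    zero. *)
Lemma base_contact_neq u v : 1 <= dotp u u -> 1 <= dotp v v -> vdet u v ^+ 2 = 1 ->
  base_contact u <> base_contact v.
Proof.
move=> u1 v1 d1; rewrite /base_contact => /addrI E.
have un0 : dotp u u != 0 by rewrite gt_eqF//; exact: lt_le_trans u1.
have vn0 : dotp v v != 0 by rewrite gt_eqF//; exact: lt_le_trans v1.
have E' : dotp v v *: sq u = dotp u u *: sq v.
  have := congr1 (fun z => (dotp u u * dotp v v / r0) *: z) E.
  have rn0 : r0 != 0 by rewrite gt_eqF.
  rewrite !scalerA.
  have -> : dotp u u * dotp v v / r0 * (r0 / dotp u u) = dotp v v.
    by move: (dotp u u) (dotp v v) un0 vn0 => a b a0 b0; field; rewrite rn0 a0.
  have -> // : dotp u u * dotp v v / r0 * (r0 / dotp v v) = dotp u u.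
  by move: (dotp u u) (dotp v v) un0 vn0 => a b a0 b0; field; rewrite rn0 b0.
have : dotp (dotp v v *: sq u - dotp u u *: sq v) (dotp v v *: sq u - dotp u u *: sq v) = 0.
  by rewrite E' subrr /dotp /= mulr0 addr0.
have -> : dotp (dotp v v *: sq u - dotp u u *: sq v) (dotp v v *: sq u - dotp u u *: sq v) =
   dotp v v ^+ 2 * dotp (sq u) (sq u) + dotp u u ^+ 2 * dotp (sq v) (sq v)
    - 2 * (dotp u u * dotp v v) * dotp (sq u) (sq v).
  move: (dotp u u) (dotp v v) => a b; rewrite !scale_pairE /dotp /=; ring.
rewrite !dotp_sq d1.
have -> : vdet u u = 0 by rewrite /vdet; ring.
have -> : vdet v v = 0 by rewrite /vdet; ring.
have -> : dotp v v ^+ 2 * (dotp u u * dotp u u - 2 * 0 ^+ 2) +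
   dotp u u ^+ 2 * (dotp v v * dotp v v - 2 * 0 ^+ 2) -
   2 * (dotp u u * dotp v v) * (dotp u u * dotp v v - 2 * 1) =
   4 * (dotp u u * dotp v v) by ring.
by move/eqP; rewrite !mulf_eq0 (negPf un0) (negPf vn0) pnatr_eq0.
Qed.

End CircleVectors.

(** * Successors *)

Section SuccessorVector.
Variable R : realType.
Variables (c0 : R * R) (r0 : R).
Hypothesis hr0 : 0 < r0.
Implicit Types (u v w z p : R * R) (C S : gcircle R) (D X : set (R * R)).

Lemma disjoint_interiors_sub1 D X p : D `&` X `<=` [set p] -> disjoint_interiors D X.
Proof.
move=> DX; apply/seteqP; split=> // z [].
rewrite /interior => /nbhs_planeP [a a0 Ha] /nbhs_planeP [b b0 Hb].
have zp t : 0 <= t -> t < a -> t < b -> (z.1 + t, z.2) = p.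
  move=> t0 ta tb; have h : `|z.1 - (z.1 + t)| = t.
    by rewrite opprD addNKr normrN ger0_norm.
  apply: DX; split; [apply: Ha|apply: Hb] => /=; rewrite ?h ?subrr ?normr0//.
pose t := Num.min a b / 2.
have ab0 : 0 < Num.min a b by rewrite lt_min a0.
have ma : Num.min a b <= a by rewrite ge_min lexx.
have mb : Num.min a b <= b by rewrite ge_min lexx orbT.
have := zp t ltac:(rewrite /t; lra) ltac:(rewrite /t; lra) ltac:(rewrite /t; lra).
rewrite -(zp 0 (lexx 0) a0 b0) => -[]; rewrite /t; lra.
Qed.

(** The complex product of [u] and [v]. *)
Let mid u v : R * R := (u.1 * v.1 - u.2 * v.2, u.1 * v.2 + u.2 * v.1).

(** For tangent circles, the zero set passes through the three tangency points: one factor vanishes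
    at each [base_contact], and the inner product at [contact]. It is a circle when [dotp u v] is
    not zero. *)
Let gap u v z := dotp (lmap c0 r0 z u) (lmap c0 r0 z v).

Lemma gapE u v z : gap u v z = dotp u v * (dotp (z - c0) (z - c0) + r0 ^+ 2)
   - 2 * r0 * dotp (z - c0) (mid u v).
Proof. by rewrite /gap /lmap /dotp /mid /=; ring. Qed.

Lemma gap_continuous u v : continuous (gap u v).
Proof.
have -> : gap u v = fun z => (dotp u v * (z.1 * z.1 + z.2 * z.2)) +
   ((- 2 * (dotp u v * c0.1 + r0 * (mid u v).1)) * z.1 +
    (- 2 * (dotp u v * c0.2 + r0 * (mid u v).2)) * z.2 +
    (dotp u v * (c0.1 ^+ 2 + c0.2 ^+ 2 + r0 ^+ 2) +
     2 * r0 * (c0.1 * (mid u v).1 + c0.2 * (mid u v).2))) : R.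
  by apply/funext => z; rewrite gapE; move: (mid u v) (dotp u v) => m d; rewrite /dotp /=; ring.
move=> z; apply: cvgD; last exact: continuous_lin2.
apply: cvgM; first exact: cvg_cst.
by apply: cvgD; apply: cvgM;
  [exact: plane_fst_continuous|exact: plane_fst_continuous
  |exact: plane_snd_continuous|exact: plane_snd_continuous].
Qed.

Lemma gap_bounded u v : 0 < dotp u v -> bounded_set [set z | gap u v z < 0].
Proof.
move=> d0; apply/bounded_planeP; pose m := mid u v.
pose M := 4 * r0 ^+ 2 * dotp m m / dotp u v ^+ 2.
have M0 : 0 <= M.
  by rewrite /M divr_ge0 ?sqr_ge0// mulr_ge0 ?dotp_ge0// mulr_ge0// sqr_ge0.
(* A bound without square roots: x^2 <= M <= (M + 1)^2. *)
have coord x : x ^+ 2 <= M -> `|x| <= M + 1.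
  move=> xM; rewrite -(ler_pXn2r (_ : 0 < 2)%N) ?nnegrE ?addr_ge0//.
  rewrite real_normK ?num_real//; apply: (le_trans xM).
  have := sqr_ge0 M; have -> : (M + 1) ^+ 2 = M ^+ 2 + 2 * M + 1 by ring.
  lra.
exists (M + 1 + `|c0.1| + `|c0.2|) => z; rewrite /= gapE -/m => gz.
have zM : dotp (z - c0) (z - c0) <= M.
  have H := sqr_ge0 r0.
  have h0 : dotp u v ^+ 2 * dotp (z - c0) (z - c0) <=
      2 * r0 * dotp u v * dotp (z - c0) m.
    have := mulr_ge0 (ltW d0) H.
    move=> h; rewrite expr2 -mulrA.
    have -> : 2 * r0 * dotp u v * dotp (z - c0) m = dotp u v * (2 * r0 * dotp (z - c0) m) by ring.
    rewrite ler_pM2l//; lra.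
  have := dotp_ge0 (dotp u v *: (z - c0) - (2 * r0) *: m).
  have -> : dotp (dotp u v *: (z - c0) - (2 * r0) *: m)
                 (dotp u v *: (z - c0) - (2 * r0) *: m) =
     dotp u v ^+ 2 * dotp (z - c0) (z - c0) -
     2 * (2 * r0 * dotp u v * dotp (z - c0) m) + 4 * r0 ^+ 2 * dotp m m.
    by move: (dotp u v) => d; rewrite !scale_pairE /dotp /=; ring.
  rewrite /M ler_pdivlMr ?exprn_gt0// [dotp (z - c0) (z - c0) * _]mulrC => h1.
  lra.
have sq1 : (z.1 - c0.1) ^+ 2 <= M.
  by apply: le_trans zM; rewrite /dotp /= -!expr2 lerDl sqr_ge0.
have sq2 : (z.2 - c0.2) ^+ 2 <= M.
  by apply: le_trans zM; rewrite /dotp /= -!expr2 lerDr sqr_ge0.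
have h1 := coord _ sq1; have h2 := coord _ sq2.
have t1 := ler_normD (z.1 - c0.1) c0.1; have t2 := ler_normD (z.2 - c0.2) c0.2.
rewrite !subrK in t1 t2.
by have := normr_ge0 c0.1; have := normr_ge0 c0.2; split; lra.
Qed.

Section Pair.
Variables (C C' : gcircle R) (u v : R * R).
Hypotheses (rC : represents c0 r0 C u) (rC' : represents c0 r0 C' v).
Hypotheses (d1 : vdet u v ^+ 2 = 1) (uv0 : 0 < dotp u v).
Let w := u + v.
Let A := ~` ([set z | enorm (z - c0) <= r0] `|` disc c0 r0 u `|` disc c0 r0 v).
Local Notation qf := (qf c0 r0).
Local Notation pw := (pw c0 r0).

Let u1 := represents_ge1 hr0 rC.
Let v1 := represents_ge1 hr0 rC'.
Let u0 : 0 < dotp u u := lt_le_trans ltr01 u1.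
Let v0 : 0 < dotp v v := lt_le_trans ltr01 v1.

Let dotw : dotp w w = dotp u u + dotp v v + 2 * dotp u v.
Proof. by rewrite /w /dotp /=; ring. Qed.

Let w1 : 1 < dotp w w.
Proof. by rewrite dotw; move: u1 v1 uv0; lra. Qed.

(** For two lines, Lagrange's identity would read 1 = (u . v)^2 + 1, against [uv0]. *)
Let Kuv : 0 < dotp u u + dotp v v - 2.
Proof.
have := lagrange u v; rewrite d1 => E.
have uv2 : 0 < dotp u v ^+ 2 by rewrite exprn_gt0.
rewrite ltNge; apply/negP => K0.
have ue : dotp u u = 1 by move: u1 v1; lra.
have ve : dotp v v = 1 by move: u1 v1; lra.
by move: E; rewrite ue ve; lra.
Qed.

Let vdetuw : vdet u w = vdet u v. Proof. by rewrite /w /vdet /=; ring. Qed.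
Let vdetvw : vdet v w = - vdet u v. Proof. by rewrite /w /vdet /=; ring. Qed.
Let vdetwu : vdet w u = - vdet u v. Proof. by rewrite /w /vdet /=; ring. Qed.
Let vdetwv : vdet w v = vdet u v. Proof. by rewrite /w /vdet /=; ring. Qed.

Lemma pairwise_tangent_represents : pairwise_tangent (Circle c0 hr0) C C'.
Proof.
have t1 := tangent_at_base hr0 rC; have t2 := tangent_at_base hr0 rC'.
have t12 := tangent_at_represents hr0 rC rC' d1 Kuv.
have neq := base_contact_neq (c0 := c0) hr0 u1 v1 d1.
have inC (E1 E2 : gcircle R) p q : tangent_at E1 E2 p -> p = q -> points E1 q /\ points E2 q.
  by move=> [_ E] <-; have : [set p] p by []; rewrite -E.
exists (base_contact c0 r0 u), (contact c0 r0 u v), (base_contact c0 r0 v); split=> //.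
  by case: t2 => n E; split; [move=> [? ?]; exact: n|rewrite setIC].
split=> E.
- have [_ p2] := inC _ _ _ _ t12 (esym E).
  have [p0 _] := inC _ _ _ _ t1 erefl.
  have : (points (Circle c0 hr0) `&` points C') (base_contact c0 r0 u) by [].
  by rewrite t2.2 => /neq.
- have [p2 _] := inC _ _ _ _ t12 E.
  have [p0 _] := inC _ _ _ _ t2 erefl.
  have : (points (Circle c0 hr0) `&` points C) (base_contact c0 r0 v) by [].
  by rewrite t1.2 => /esym /neq.
- by apply: neq; rewrite E.
Qed.

Lemma tangent_discs_represents : tangent_discs (Circle c0 hr0) C C'
  [set z | enorm (z - c0) <= r0] (disc c0 r0 u) (disc c0 r0 v).
Proof.
split=> //; [exact: represents_bounds|exact: represents_bounds|split].
- apply: (@disjoint_interiors_sub1 _ _ (base_contact c0 r0 u)) => z [/=].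
  by rewrite disc_base// => p0 q0; exact: base_disc.
- apply: (@disjoint_interiors_sub1 _ _ (contact c0 r0 u v)) => z [/= h1 h2].
  by apply: qf_sum_le0 => //; rewrite -(addr0 0) lerD.
- apply: (@disjoint_interiors_sub1 _ _ (base_contact c0 r0 v)) => z [/= q0].
  by rewrite disc_base// => p0; exact: base_disc.
Qed.

Let Aout z : A z -> [/\ 0 < pw z, 0 < qf u z & 0 < qf v z].
Proof.
move=> Az; split; rewrite ltNge; apply/negP => h; apply: Az.
- by left; left; rewrite /= disc_base.
- by left; right.
- by right.
Qed.

(** [w] has determinant 1 or -1 with both [u] and [v]. If z were in the disc of one of them, the
    product of the two squared lengths would be less than pw^2, against Lagrange's identity. *)
Let Ain z : qf w z < 0 -> A z.
Proof.
move=> qw; have pw0 : 0 < pw z.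
  rewrite ltNge; apply/negP => p0; move: qw; rewrite ltNge => /negP; apply.
  by rewrite subr_ge0 (le_trans p0)// dotp_ge0.
have key x : vdet x w ^+ 2 = 1 -> 0 < qf x z.
  move=> dx; rewrite ltNge; apply/negP => qx.
  have := lmap_lagrange c0 r0 z x w; rewrite dx mulr1.
  have h := sqr_ge0 (dotp (lmap c0 r0 z x) (lmap c0 r0 z w)).
  move: qx qw; rewrite subr_le0 subr_lt0 => qx qw E.
  have : dotp (lmap c0 r0 z x) (lmap c0 r0 z x) *
      dotp (lmap c0 r0 z w) (lmap c0 r0 z w) < pw z * pw z.
    apply: (@le_lt_trans _ _ (pw z * dotp (lmap c0 r0 z w) (lmap c0 r0 z w))).
      by rewrite ler_wpM2r// dotp_ge0.
    by rewrite ltr_pM2l.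
  by rewrite E -expr2; lra.
move=> [[|]|].
- by rewrite /= disc_base// leNgt pw0.
- by rewrite /disc /= leNgt key// vdetuw.
- by rewrite /disc /= leNgt key// vdetvw sqrrN.
Qed.

(* On the complement of the three discs [gap u v] does not vanish, by Lagrange's
   identity, and it is negative at the center of S; hence it is negative on the
   component of that center, and [gap u v < 0] is a bounded disc. *)
Lemma exists_successor :
  exists S, represents c0 r0 S w /\ successor (Circle c0 hr0) C C' S.
Proof.
have dw0 : 0 < dotp w w - 1 by rewrite subr_gt0.
pose r := r0 / (dotp w w - 1).
have hr : 0 < r by rewrite divr_gt0.
have rE : r * (dotp w w - 1) = r0 by rewrite divfK// gt_eqF.
pose s := c0 + r *: sq w.
pose S := Circle s hr.
have rS : represents c0 r0 S w by split.
have qfS z : r * qf w z = r0 * (dotp (z - s) (z - s) - r ^+ 2) by exact: qf_circle.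
have qs : qf w s < 0.
  rewrite -(pmulr_rlt0 _ hr) qfS subrr {1}/dotp /= mulr0 addr0 sub0r mulrN oppr_lt0.
  by rewrite mulr_gt0// exprn_gt0.
have As := Ain qs.
exists S; split=> //; split; first exact: pairwise_tangent_represents.
exists [set z | enorm (z - c0) <= r0], (disc c0 r0 u), (disc c0 r0 v),
  (connected_component A s).
split.
- exact: tangent_discs_represents.
- exists s => //; split=> //.
  have nb : 0 < dotp u v by [].
  have /bounded_planeP [M HM] := gap_bounded nb.
  apply/bounded_planeP; exists M => z Vz; apply: HM => /=.
  have gapA x : A x -> gap u v x != 0.
    move=> /Aout [p0 q1 q2]; apply/eqP => g0.
    have := lmap_lagrange c0 r0 x u v; rewrite d1 mulr1 -/(gap u v x) g0 expr0n /= add0r.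
    move: q1 q2; rewrite !subr_gt0 => q1 q2 E.
    have : pw x * pw x < dotp (lmap c0 r0 x u) (lmap c0 r0 x u) *
        dotp (lmap c0 r0 x v) (lmap c0 r0 x v).
      by apply: ltr_pM => //; exact: ltW.
    by rewrite E -expr2 ltxx.
  have gs : gap u v s < 0.
    have [p0] := Aout As; rewrite !subr_gt0 => q1 q2.
    move: qs; rewrite subr_lt0 lmapD.
    have -> : dotp (lmap c0 r0 s u + lmap c0 r0 s v) (lmap c0 r0 s u + lmap c0 r0 s v) =
      dotp (lmap c0 r0 s u) (lmap c0 r0 s u) + dotp (lmap c0 r0 s v) (lmap c0 r0 s v) +
      2 * gap u v s by rewrite /gap /dotp /=; ring.
    by move: q1 q2 p0; lra.
  have cV : connected (gap u v @` connected_component A s).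
    apply: connected_continuous_connected; first exact: component_connected.
    by apply: continuous_subspaceT; exact: gap_continuous.
  rewrite ltNge; apply/negP => gz.
  have Vs : connected_component A s s by exact: connected_component_refl.
  have [|||x Vx gx0] := (connected_intervalP _).1 cV (gap u v s) (gap u v z) _ _ 0.
  + by exists s.
  + by exists z.
  + by rewrite (ltW gs).
  by move: (gapA x (connected_component_sub Vx)); rewrite gx0 eqxx.
- move=> z zS; apply/closure_planeP => e e0.
  have dz : dotp (z - s) (z - s) = r ^+ 2 by apply/(enorm_eq _ (ltW hr)); exact: zS.
  (* A radius without its end stays in the open disc of [S], hence in the component of the center,
     and approaches [z]. *)
  have inV t : 0 <= t < 1 -> connected_component A s (s + t *: (z - s)).
    move=> t01; apply: (@connected_component_max _ _
      ((fun t => s + t *: (z - s)) @` [set` `[0, 1[])).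
    - by exists 0; [rewrite /= in_itv /= lexx ltr01|rewrite scale0r addr0].
    - move=> _ [x /= + <-]; rewrite in_itv /= => /andP[x0 x1]; apply: Ain.
      have xE : s + x *: (z - s) - s = x *: (z - s) by rewrite addrC addKr.
      rewrite -(pmulr_rlt0 _ hr) qfS xE.
      have -> : dotp (x *: (z - s)) (x *: (z - s)) = x ^+ 2 * dotp (z - s) (z - s).
        by rewrite !scale_pairE /dotp /=; ring.
      rewrite dz pmulr_rlt0// subr_lt0 gtr_pMl ?exprn_gt0//.
      by rewrite expr_lt1.
    - exact: line_connected.
    - by exists t => //=; rewrite in_itv.
  pose N := `|z.1 - s.1| + `|z.2 - s.2| + 1.
  have N1 : 1 <= N by rewrite /N lerDr addr_ge0.
  have N0 : 0 < N by exact: lt_le_trans N1.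
  pose d := Num.min 1 (e / (2 * N)).
  have eN : 0 < e / (2 * N) by rewrite divr_gt0// mulr_gt0.
  have d0 : 0 < d by rewrite lt_min ltr01 eN.
  have d1' : d <= 1 by rewrite ge_min lexx.
  have dN : d * N < e.
    have : d <= e / (2 * N) by rewrite ge_min lexx orbT.
    by rewrite ler_pdivlMr ?mulr_gt0// => h; lra.
  exists (s + (1 - d) *: (z - s)); split.
  - by apply: inV; apply/andP; split; lra.
  - have -> : z.1 - (s + (1 - d) *: (z - s)).1 = d * (z.1 - s.1).
      by rewrite scale_pairE /=; ring.
    rewrite normrM gtr0_norm//; apply: le_lt_trans dN; rewrite ler_pM2l// /N.
    by have := normr_ge0 (z.2 - s.2); lra.
  - have -> : z.2 - (s + (1 - d) *: (z - s)).2 = d * (z.2 - s.2).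
      by rewrite scale_pairE /=; ring.
    rewrite normrM gtr0_norm//; apply: le_lt_trans dN; rewrite ler_pM2l// /N.
    by have := normr_ge0 (z.1 - s.1); lra.
- have h1 : 0 < dotp w w + dotp u u - 2 by move: w1 u1; lra.
  have h2 : 0 < dotp w w + dotp v v - 2 by move: w1 v1; lra.
  split.
  + have [n E] := tangent_at_base hr0 rS.
    by exists (base_contact c0 r0 w); split; [move=> []|rewrite setIC].
  + exists (contact c0 r0 w u); apply: (tangent_at_represents hr0 rS rC) => //.
    by rewrite vdetwu sqrrN.
  + exists (contact c0 r0 w v); apply: (tangent_at_represents hr0 rS rC') => //.
    by rewrite vdetwv.
Qed.

Lemma tangent_represents : tangent C C'.
Proof. by exists (contact c0 r0 u v); exact: tangent_at_represents. Qed.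

End Pair.
End SuccessorVector.

(** * Vectors of externally tangent circles *)

Section External.
Variable R : realType.
Implicit Types (u v w z p c n : R * R) (C S : gcircle R) (D X : set (R * R)).

Lemma interior_sublevel (h : R * R -> R) (a : R) z : continuous h -> h z < a ->
  interior [set x | h x <= a] z.
Proof.
move=> ch hz; rewrite /interior /=.
have H : \forall x \near z, h x < a := cvgr_lt (h z) (ch z) _ hz.
near=> x; apply/ltW; near: x; exact: H.
Unshelve. all: by end_near. Qed.

Lemma dist2_continuous c : continuous (fun z => dotp (z - c) (z - c)).
Proof.
have -> : (fun z => dotp (z - c) (z - c)) = (fun z => (z.1 * z.1 + z.2 * z.2) +
    ((- 2 * c.1) * z.1 + (- 2 * c.2) * z.2 + (c.1 ^+ 2 + c.2 ^+ 2)) : R).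
  by apply/funext => z; rewrite /dotp /=; ring.
move=> z; apply: cvgD; last exact: continuous_lin2.
by apply: cvgD; apply: cvgM;
  [exact: plane_fst_continuous|exact: plane_fst_continuous
  |exact: plane_snd_continuous|exact: plane_snd_continuous].
Qed.

Lemma interior_disc c (r : R) z : 0 <= r -> dotp (z - c) (z - c) < r ^+ 2 ->
  interior [set x | enorm (x - c) <= r] z.
Proof.
move=> r0 zr; have -> : [set x | enorm (x - c) <= r] =
    [set x | dotp (x - c) (x - c) <= r ^+ 2].
  by apply/seteqP; split=> x /=; rewrite (enorm_le _ r0).
exact: (@interior_sublevel (fun x => dotp (x - c) (x - c)) _ z (@dist2_continuous c) zr).
Qed.

Lemma interior_halfplane n (d : R) z : dotp n z < d ->
  interior [set x | dotp n x <= d] z.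
Proof.
apply: (@interior_sublevel (fun x => dotp n x)).
have -> : (fun x => dotp n x) = (fun x : R * R => n.1 * x.1 + n.2 * x.2 + 0 : R).
  by apply/funext => x; rewrite /dotp addr0.
exact: continuous_lin2.
Qed.

Lemma cauchy_schwarz u v : dotp u v ^+ 2 <= dotp u u * dotp v v.
Proof. by rewrite lagrange lerDl sqr_ge0. Qed.

(** A common point gives the upper bound, by Cauchy-Schwarz. If the centers were closer, the point
    dividing their segment in the ratio r : r' would be interior to both discs. *)
Lemma external_circles c c' (r r' : R) p : 0 < r -> 0 < r' ->
  enorm (p - c) = r -> enorm (p - c') = r' ->
  disjoint_interiors [set z | enorm (z - c) <= r] [set z | enorm (z - c') <= r'] ->
  dotp (c' - c) (c' - c) = (r + r') ^+ 2.
Proof.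
move=> r0 r'0 /(enorm_eq _ (ltW r0)) pc /(enorm_eq _ (ltW r'0)) pc' dis.
have rr0 : 0 < r + r' by rewrite addr_gt0.
apply/eqP; rewrite eq_le; apply/andP; split.
  have E : dotp (c' - c) (c' - c) = r ^+ 2 + r' ^+ 2 - 2 * dotp (p - c) (p - c').
    by rewrite -pc -pc' /dotp /=; ring.
  have cs := cauchy_schwarz (p - c) (p - c'); rewrite pc pc' -exprMn in cs.
  have : - (r * r') <= dotp (p - c) (p - c').
    have : `|dotp (p - c) (p - c')| <= r * r'.
      rewrite -(ler_pXn2r (_ : 0 < 2)%N) ?nnegrE ?mulr_ge0 ?(ltW r0) ?(ltW r'0)//.
      by rewrite real_normK// num_real.
    by rewrite ler_norml => /andP[].
  rewrite E; have -> : (r + r') ^+ 2 = r ^+ 2 + r' ^+ 2 + 2 * (r * r') by ring.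
  lra.
rewrite leNgt; apply/negP => lt.
pose z := c + (r / (r + r')) *: (c' - c).
have rn0 : r + r' != 0 by rewrite gt_eqF.
have h1 : dotp (z - c) (z - c) < r ^+ 2.
  have -> : z - c = (r / (r + r')) *: (c' - c) by rewrite /z addrC addKr.
  have -> : dotp ((r / (r + r')) *: (c' - c)) ((r / (r + r')) *: (c' - c)) =
      r ^+ 2 * (dotp (c' - c) (c' - c) / (r + r') ^+ 2).
    rewrite -exprVn; move: (r + r')^-1 => i.
    by rewrite scale_pairE /dotp /=; ring.
  by rewrite gtr_pMr ?exprn_gt0// ltr_pdivrMr ?exprn_gt0// mul1r.
have h2 : dotp (z - c') (z - c') < r' ^+ 2.
  have -> : z - c' = (r' / (r + r')) *: (c - c').
    have -> : r' / (r + r') = 1 - r / (r + r') by field.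
    rewrite /z; move: (r / (r + r')) => t.
    by rewrite !scale_pairE; congr pair => /=; ring.
  have -> : dotp ((r' / (r + r')) *: (c - c')) ((r' / (r + r')) *: (c - c')) =
      r' ^+ 2 * (dotp (c' - c) (c' - c) / (r + r') ^+ 2).
    rewrite -exprVn; move: (r + r')^-1 => i.
    by rewrite scale_pairE /dotp /=; ring.
  by rewrite gtr_pMr ?exprn_gt0// ltr_pdivrMr ?exprn_gt0// mul1r.
have : set0 z.
  by rewrite -dis; split; apply: interior_disc => //; exact: ltW.
by [].
Qed.

Lemma external_circle_halfplane c (r : R) n (d : R) p : 0 < r -> n != 0 ->
  enorm (p - c) = r -> dotp n p = d ->
  disjoint_interiors [set z | enorm (z - c) <= r] [set z | dotp n z <= d] ->
  dotp n c - d = r * enorm n.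
Proof.
move=> r0 n0 /(enorm_eq _ (ltW r0)) pc pd dis.
have N0 : 0 < enorm n.
  rewrite lt_neqAle enorm_ge0 andbT eq_sym; apply: (contra _ n0) => /eqP N.
  by apply/eqP; apply: dotp_eq0; rewrite -enorm_sqr N expr0n.
have rN0 : 0 < r * enorm n by rewrite mulr_gt0.
set e := dotp n c - d.
apply/eqP; rewrite eq_le; apply/andP; split.
  have eE : e = dotp n (c - p) by rewrite /e -pd /dotp /=; ring.
  have cs := cauchy_schwarz n (c - p); rewrite -eE in cs.
  have E : dotp (c - p) (c - p) = r ^+ 2 by rewrite -pc /dotp /=; ring.
  rewrite E -enorm_sqr -exprMn mulrC in cs.
  have := ler_norm e; move=> /le_trans; apply.
  rewrite -(ler_pXn2r (_ : 0 < 2)%N) ?nnegrE ?(ltW rN0)//.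
  by rewrite real_normK ?num_real.
rewrite leNgt; apply/negP => lt.
(* Halfway between the parameters at which c - t n enters the half-plane and leaves the disc; the
   maximum covers a center already in the half-plane. *)
pose t := (Num.max e 0 / enorm n ^+ 2 + r / enorm n) / 2.
have N2 : 0 < enorm n ^+ 2 by rewrite exprn_gt0.
have mlt : Num.max e 0 / enorm n ^+ 2 < r / enorm n.
  rewrite ltr_pdivrMr// expr2 mulrA divfK ?gt_eqF// gt_max lt.
  exact: rN0.
have m0 : 0 <= Num.max e 0 / enorm n ^+ 2.
  by apply: divr_ge0; [rewrite le_max lexx orbT|exact: ltW].
have t1 : Num.max e 0 / enorm n ^+ 2 < t by rewrite /t; lra.
have t2 : t < r / enorm n by rewrite /t; lra.
have t0 : 0 < t by exact: le_lt_trans t1.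
have h1 : dotp (c - t *: n - c) (c - t *: n - c) < r ^+ 2.
  have -> : dotp (c - t *: n - c) (c - t *: n - c) = (t * enorm n) ^+ 2.
    by rewrite exprMn enorm_sqr scale_pairE /dotp /=; ring.
  have tn0 : 0 <= t * enorm n by apply: mulr_ge0; [exact: ltW|exact: enorm_ge0].
  by rewrite ltr_pXn2r ?nnegrE ?(ltW r0)// -ltr_pdivlMr.
have h2 : dotp n (c - t *: n) < d.
  have -> : dotp n (c - t *: n) = dotp n c - t * enorm n ^+ 2.
    by rewrite enorm_sqr scale_pairE /dotp /=; ring.
  rewrite ltrBlDl -ltrBlDr -/e; move: t1; rewrite ltr_pdivrMr// gt_max => /andP[].
  by [].
have : set0 (c - t *: n).
  by rewrite -dis; split; [exact: (interior_disc (ltW r0) h1)|exact: interior_halfplane].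
by [].
Qed.

(** A unit square root of the direction of angle [t], continuous in [t]; adding 2 pi to [t] changes
    its sign. *)
Definition half (t : R) : R * R := (cos (t / 2), sin (t / 2)).

Lemma half_norm t : dotp (half t) (half t) = 1.
Proof. by rewrite /dotp /half /= -!expr2 cos2Dsin2. Qed.

Lemma sq_half t : sq (half t) = (cos t, sin t).
Proof.
rewrite /sq /half /=; have {5 6}-> : t = t / 2 + t / 2 by field.
by rewrite cosD sinD; congr pair; ring.
Qed.

Lemma sqZ (m : R) u : sq (m *: u) = m ^+ 2 *: sq u.
Proof. by rewrite /sq !scale_pairE /=; congr pair; ring. Qed.

Lemma dotpZ (m : R) u : dotp (m *: u) (m *: u) = m ^+ 2 * dotp u u.
Proof. by rewrite !scale_pairE /dotp /=; ring. Qed.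

Lemma angle_of_unique z t : angle_of z t -> z = enorm z *: sq (half t) /\ 0 < enorm z.
Proof.
move=> [z0 zE]; rewrite sq_half; split; first by rewrite {1}zE.
rewrite lt_neqAle enorm_ge0 andbT eq_sym; apply: contra z0 => /eqP N.
by rewrite zE N !mul0r.
Qed.

Section Base.
Variables (c0 : R * R) (r0 : R).
Hypothesis hr0 : 0 < r0.

Lemma vec_from_represents C u : represents c0 r0 C u ->
  exists2 s, 0 < s & vec_from c0 C = s *: sq u.
Proof.
case: C => [c r r_gt0 [cE rE]|n d n0 [u1 [s s0 [nE dE]]]] /=.
  by exists r => //; rewrite cE addrC addKr.
exists r0 => //; rewrite dE.
have -> : dotp n n = s ^+ 2.
  rewrite nE dotpZ dotp_sq u1; have -> : vdet u u = 0 by rewrite /vdet; ring.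
  by ring.
by rewrite nE scalerA; congr (_ *: _); field.
Qed.

Lemma represents_angle C t (m : R) : 0 < m -> represents c0 r0 C (m *: half t) ->
  angle_of (vec_from c0 C) t.
Proof.
move=> m0 /vec_from_represents [s s0 ->]; rewrite sqZ scalerA sq_half.
have k0 : 0 < s * m ^+ 2 by rewrite mulr_gt0// exprn_gt0.
have E : enorm ((s * m ^+ 2) *: (cos t, sin t)) = s * m ^+ 2.
  rewrite (enorm_eq _ (ltW k0)) dotpZ.
  by rewrite {1}/dotp /= -!expr2 cos2Dsin2 mulr1.
split; last by rewrite E.
by apply/eqP => z0; move: E k0; rewrite z0 => <-; rewrite /enorm /dotp /= mulr0 addr0 sqrtr0 ltxx.
Qed.

(** If u^2 = s w^2 with s > 0, then u conj w has a positive square, so it is real and u is parallel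
    to w. The orthogonal alternative would make that square nonpositive. *)
Lemma sqrt_line_represents C w z : represents c0 r0 C w ->
  sqrt_line (vec_from c0 C) z -> exists t : R, z = t *: w.
Proof.
move=> rC; have w1 := represents_ge1 hr0 rC.
have w0 : 0 < dotp w w by exact: lt_le_trans w1.
have [s s0 ->] := vec_from_represents rC.
move=> [[a b] [t []]]; rewrite expr2 /to_complex => -[E1 E2] [z1 z2].
have zE : z = (t * a, t * b).
  by case: z z1 z2 => x y /= -> ->; congr pair; ring.
rewrite /sq /GRing.scale /= in E1 E2.
have key : (a * w.2 - b * w.1) * (a * w.1 + b * w.2) = 0.
  have -> : (a * w.2 - b * w.1) * (a * w.1 + b * w.2) =
    w.1 * w.2 * (a * a - b * b) - (w.1 ^+ 2 - w.2 ^+ 2) * (a * b + b * a) / 2 by field.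
  by rewrite E1 E2; field.
move/eqP: key; rewrite mulf_eq0 => /orP[/eqP par|/eqP orth].
  exists (t * (a * w.1 + b * w.2) / dotp w w); rewrite zE.
  have wn0 : dotp w w != 0 by rewrite gt_eqF.
  rewrite !scale_pairE /=; congr pair; apply: (mulIf wn0).
    rewrite mulrAC [RHS]mulrAC divfK// /dotp.
    transitivity (t * (a * w.1 + b * w.2) * w.1 + t * w.2 * (a * w.2 - b * w.1)); first by ring.
    by rewrite par; ring.
  rewrite mulrAC [RHS]mulrAC divfK// /dotp.
  transitivity (t * (a * w.1 + b * w.2) * w.2 - t * w.1 * (a * w.2 - b * w.1)); first by ring.
  by rewrite par; ring.
have key : dotp w w ^+ 2 * (s + (a * a + b * b) / dotp w w) = 0.
  have wn0 : dotp w w != 0 by rewrite gt_eqF.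
  have -> : dotp w w ^+ 2 * (s + (a * a + b * b) / dotp w w) =
    s * dotp w w ^+ 2 + (a * a + b * b) * dotp w w.
    by move: (dotp w w) wn0 => W W0; field.
  have -> : s * dotp w w ^+ 2 + (a * a + b * b) * dotp w w =
    (w.1 ^+ 2 - w.2 ^+ 2) * (s * (w.1 ^+ 2 - w.2 ^+ 2) - (a * a - b * b)) +
    (2 * (w.1 * w.2)) * (s * (2 * (w.1 * w.2)) - (a * b + b * a)) +
    2 * (a * w.1 + b * w.2) ^+ 2.
    by rewrite /dotp; ring.
  by rewrite E1 E2 orth; ring.
have : 0 < dotp w w ^+ 2 * (s + (a * a + b * b) / dotp w w).
  rewrite mulr_gt0 ?exprn_gt0// ltr_pwDl//; apply: divr_ge0; last exact: ltW.
  by rewrite addr_ge0// -expr2 sqr_ge0.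
by rewrite key ltxx.
Qed.

(** External tangency gives |v(C)| = r0 + r for a circle, hence m^2 = 1 + r0 / r, and |v(C)| = r0
    for a line, hence m = 1. The given angle fixes the sign of the vector. *)
Lemma represents_of_external C D p t : tangent_at (Circle c0 hr0) C p ->
  bounds C D -> disjoint_interiors [set z | enorm (z - c0) <= r0] D ->
  angle_of (vec_from c0 C) t ->
  exists2 m, 0 < m & represents c0 r0 C (m *: half t) /\ D = disc c0 r0 (m *: half t).
Proof.
move=> [_ tE]; have : [set p] p by [].
rewrite -tE => -[]; case: C {tE} => [c r r_gt0|n d n0] p0 pC bD dis.
  move=> /angle_of_unique [vE v0]; rewrite /= in vE v0.
  rewrite /= in bD pC p0; rewrite bD in dis.
  have E := external_circles hr0 r_gt0 p0 pC dis.
  have rr0 : 0 < r0 + r by rewrite addr_gt0.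
  move/(enorm_eq _ (ltW rr0)) : E => E; rewrite E in vE.
  pose m := Num.sqrt ((r0 + r) / r).
  have m2 : m ^+ 2 = (r0 + r) / r by rewrite sqr_sqrtr// divr_ge0 ?ltW.
  have m0 : 0 < m by rewrite sqrtr_gt0 divr_gt0.
  have rn0 : r != 0 by rewrite gt_eqF.
  have rC : represents c0 r0 (Circle c r_gt0) (m *: half t).
    split; last by rewrite dotpZ half_norm m2; field.
    by rewrite sqZ m2 scalerA mulrCA mulfV// mulr1 -vE addrC subrK.
  exists m => //; split=> //; have := represents_bounds hr0 rC; rewrite /= => ->.
  exact: bD.
move=> /angle_of_unique [vE v0]; rewrite /= in vE v0.
have N0 : 0 < enorm n.
  rewrite lt_neqAle enorm_ge0 andbT eq_sym; apply: (contra _ n0) => /eqP N.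
  by apply/eqP; apply: dotp_eq0; rewrite -enorm_sqr N expr0n.
have Nn0 : enorm n != 0 by rewrite gt_eqF.
rewrite /= in bD pC p0.
(* The sign [s] tells which of the two half-planes is [D], so that both are treated at once. *)
suff [s [s1 dE sD]] : exists s : R, [/\ s = 1 \/ s = -1, s * (d - dotp n c0) = r0 * enorm n &
     D = [set z | s * d <= s * dotp n z]].
  have s2 : s * s = 1 by case: s1 => ->; ring.
  have s0 : s != 0 by case: s1 => ->; rewrite ?oppr_eq0 oner_neq0.
  have dE' : d - dotp n c0 = s * r0 * enorm n.
    by rewrite -mulrA -dE mulrA s2 mul1r.
  have vE' : vec_from c0 (Line d n0) = (s * r0 / enorm n) *: n.
    rewrite /= dE' -enorm_sqr; congr (_ *: _); field; exact: Nn0.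
  have nrm : enorm (vec_from c0 (Line d n0)) = r0.
    rewrite vE' (enorm_eq _ (ltW hr0)) dotpZ -enorm_sqr.
    transitivity (s * s * (r0 * r0)); first by field.
    by rewrite s2 mul1r expr2.
  have nE : n = (s * enorm n) *: sq (half t).
    have := vE; rewrite -[X in X *: n]/((d - dotp n c0) / dotp n n).
    rewrite -[LHS]/(vec_from c0 (Line d n0)) -[X in enorm X]/(vec_from c0 (Line d n0)) nrm vE'.
    move=> h; have := congr1 (fun z => (s * enorm n / r0) *: z) h.
    have rn0 : r0 != 0 by rewrite gt_eqF.
    rewrite !scalerA; have -> : s * enorm n / r0 * (s * r0 / enorm n) = s * s.
      by field; rewrite rn0 Nn0.
    by rewrite s2 scale1r => hn; rewrite [LHS]hn; congr (_ *: _); field.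
  have rC : represents c0 r0 (Line d n0) (1 *: half t).
    rewrite scale1r; split; first exact: half_norm.
    by exists (s * enorm n); [rewrite mulf_neq0|split=> //; rewrite dE'; ring].
  exists 1 => //; split=> //; rewrite sD; apply/seteqP.
  have qE z : enorm n * qf c0 r0 (1 *: half t) z = 2 * r0 * (s * d - s * dotp n z).
    rewrite qfE scale1r half_norm.
    transitivity (2 * r0 * (s * (d - dotp n c0) - s * dotp n (z - c0))); last first.
      by rewrite /dotp /=; ring.
    rewrite dE {3}nE.
    have -> : dotp ((s * enorm n) *: sq (half t)) (z - c0) =
       s * enorm n * dotp (z - c0) (sq (half t)).
      by rewrite scale_pairE /dotp /=; ring.
    have -> : s * (s * enorm n * dotp (z - c0) (sq (half t))) =
       s * s * (enorm n * dotp (z - c0) (sq (half t))) by ring.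
    rewrite s2; ring.
  have r2 : 0 < 2 * r0 by rewrite mulr_gt0.
  by split=> z; rewrite /disc /= -[qf _ _ _ _ <= 0](pmulr_rle0 _ N0) qE pmulr_rle0// subr_le0.
case: bD => bD; rewrite bD in dis.
  have E := external_circle_halfplane hr0 n0 p0 pC dis.
  exists (-1); split; [by right|by rewrite -E; ring|].
  by rewrite bD; apply/seteqP; split=> z /=; rewrite !mulN1r lerN2.
have n0' : - n != 0 by rewrite oppr_eq0.
have dN z : dotp (- n) z = - dotp n z by rewrite /dotp /=; ring.
have pC' : dotp (- n) p = - d by rewrite dN pC.
have DE : [set z | d <= dotp n z] = [set z | dotp (- n) z <= - d].
  by apply/seteqP; split=> z /=; rewrite dN lerN2.
rewrite DE in dis.
have E := external_circle_halfplane hr0 n0' p0 pC' dis.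
have eN : enorm (- n) = enorm n.
  by rewrite /enorm; congr Num.sqrt; rewrite /dotp /=; ring.
rewrite eN dN in E.
exists 1; split; [by left|by rewrite -E; ring|].
by rewrite bD; apply/seteqP; split=> z /=; rewrite !mul1r.
Qed.

(** For circles, c' - c = r' v^2 - r u^2 and r |u|^2 = r0 + r, so 4 r r' det^2 = |c' - c|^2 - (r -
    r')^2 = (r + r')^2 - (r - r')^2. A circle and a line are handled by [circ_line], in either
    order. *)
Lemma vdet_of_external C C' u v p : represents c0 r0 C u -> represents c0 r0 C' v ->
  tangent_at C C' p -> disjoint_interiors (disc c0 r0 u) (disc c0 r0 v) ->
  vdet u v ^+ 2 = 1.
Proof.
have circ_line (c : R * R) (r : R) (r_gt0 : 0 < r) C2 x y q :
    represents c0 r0 (Circle c r_gt0) x -> represents c0 r0 C2 y -> is_line C2 ->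
    points (Circle c r_gt0) q -> points C2 q ->
    disjoint_interiors (disc c0 r0 x) (disc c0 r0 y) -> vdet x y ^+ 2 = 1.
  move=> rC rC2 l2 qC qC2 dis.
  have y1 : dotp y y = 1 by case: C2 rC2 l2 {qC2} => // ? ? ? [].
  have E1 := represents_bounds hr0 rC; rewrite /= in E1; rewrite E1 in dis.
  have dE : disc c0 r0 y = [set z | dotp (- sq y) z <= - r0 - dotp (sq y) c0].
    apply/seteqP.
    have qE z : qf c0 r0 y z = 2 * r0 * (dotp (- sq y) z - (- r0 - dotp (sq y) c0)).
      by rewrite qfE y1 /dotp /=; ring.
    have r2 : 0 < 2 * r0 by rewrite mulr_gt0.
    by split=> z; rewrite /disc /= qE pmulr_rle0// subr_le0.
  have qq : dotp (- sq y) q = - r0 - dotp (sq y) c0.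
    move: qC2; rewrite (represents_points hr0 rC2) /=.
    have -> : qf c0 r0 y q = 2 * r0 * (dotp (- sq y) q - (- r0 - dotp (sq y) c0)).
      by rewrite qfE y1 /dotp /=; ring.
    move/eqP; rewrite !mulf_eq0 pnatr_eq0 (gt_eqF hr0) /= subr_eq0 => /eqP ->.
    by [].
  have dsq : dotp (sq y) (sq y) = 1.
    rewrite dotp_sq y1; have -> : vdet y y = 0 by rewrite /vdet; ring.
    by ring.
  have n0 : - sq y != 0.
    rewrite oppr_eq0; apply/eqP => s0; move: dsq; rewrite s0 /dotp /= mulr0 addr0.
    by move/eqP; rewrite eq_sym oner_eq0.
  rewrite dE in dis.
  have := external_circle_halfplane r_gt0 n0 qC qq dis.
  have -> : enorm (- sq y) = 1.
    rewrite (enorm_eq _ ler01) expr1n -dsq /dotp /=; ring.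
  case: rC => cE rE.
  have -> : dotp (- sq y) c - (- r0 - dotp (sq y) c0) = r0 - dotp (sq y) (c - c0).
    by rewrite /dotp /=; ring.
  have -> : c - c0 = r *: sq x by rewrite cE addrC addKr.
  have -> : dotp (sq y) (r *: sq x) = r * dotp (sq x) (sq y).
    by rewrite scale_pairE /dotp /=; ring.
  rewrite dotp_sq y1 mulr1 => E.
  have rn0 : r != 0 by rewrite gt_eqF.
  apply: (mulfI rn0); move: rE E; rewrite !mulrBr; move: (vdet x y ^+ 2) => D2.
  rewrite !mulr1; lra.
move=> rC rC' [nl tE] dis.
have : [set p] p by [].
rewrite -tE => -[pC pC'].
case: C rC nl tE pC => [c r r_gt0|n d n0] rC nl tE pC; last first.
  case: C' rC' nl tE pC' => [c' r' r'_gt0|n' d' n0'] rC' nl tE pC'; last by case: nl.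
  have -> : vdet u v ^+ 2 = vdet v u ^+ 2 by rewrite /vdet; ring.
  apply: (circ_line _ _ _ _ _ _ _ rC' rC) => //; first exact: pC'.
    exact: pC.
  by rewrite /disjoint_interiors setIC.
case: C' rC' nl tE pC' => [c' r' r'_gt0|n' d' n0'] rC' nl tE pC'; last first.
  by apply: (circ_line _ _ _ _ _ _ _ rC rC') => //; [exact: pC|exact: pC'].
have E1 := represents_bounds hr0 rC; rewrite /= in E1; rewrite E1 in dis.
have E2 := represents_bounds hr0 rC'; rewrite /= in E2; rewrite E2 in dis.
have := external_circles r_gt0 r'_gt0 pC pC' dis.
case: rC => cE rE; case: rC' => cE' rE'.
have -> : c' - c = r' *: sq v - r *: sq u by rewrite cE cE' opprD addrACA subrr add0r.
have -> : dotp (r' *: sq v - r *: sq u) (r' *: sq v - r *: sq u) =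
  r' ^+ 2 * dotp (sq v) (sq v) + r ^+ 2 * dotp (sq u) (sq u) -
  2 * (r * r') * dotp (sq u) (sq v).
  by rewrite !scale_pairE /dotp /=; ring.
rewrite !dotp_sq.
have -> : vdet u u = 0 by rewrite /vdet; ring.
have -> : vdet v v = 0 by rewrite /vdet; ring.
have {}rE : r * dotp u u - r = r0 by rewrite -rE mulrBr mulr1.
have {}rE' : r' * dotp v v - r' = r0 by rewrite -rE' mulrBr mulr1.
move: rE rE'; move: (dotp u u) (dotp v v) (vdet u v ^+ 2) => a b D2 rE rE' E.
have rr : 4 * (r * r') != 0 by rewrite !mulf_neq0 ?pnatr_eq0// gt_eqF.
apply: (mulfI rr); rewrite mulr1.
have -> : 4 * (r * r') * D2 = r' ^+ 2 * (b * b - 2 * 0 ^+ 2) + r ^+ 2 * (a * a - 2 * 0 ^+ 2) -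
  2 * (r * r') * (a * b - 2 * D2) - (r * a - r' * b) ^+ 2 by ring.
rewrite E.
have -> : r * a - r' * b = r - r' by lra.
by ring.
Qed.

End Base.
End External.

(** * The Farey subdivision of an Apollonian curve *)

Section HalfAngle.
Variable R : realType.
Implicit Types (s t a b m r h : R) (u v w z : R * R).

Lemma vdet_half s t : vdet (half s) (half t) = sin ((t - s) / 2).
Proof. by rewrite mulrBl sinB /vdet /half /=; ring. Qed.

Lemma dotp_half s t : dotp (half s) (half t) = cos ((t - s) / 2).
Proof. by rewrite mulrBl cosB /dotp /half /=; ring. Qed.

Lemma vdetZ s t u v : vdet (s *: u) (t *: v) = s * t * vdet u v.
Proof. by rewrite !scale_pairE /vdet /=; ring. Qed.

Lemma dotpZZ s t u v : dotp (s *: u) (t *: v) = s * t * dotp u v.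
Proof. by rewrite !scale_pairE /dotp /=; ring. Qed.

Lemma mul_cos_le_sin h : 0 < h -> h < pi -> h * cos h <= sin h.
Proof.
move=> h0 hpi.
have der (x : R) : x \in `]0, h[ -> is_derive x 1 sin (cos x).
  by move=> _; exact: is_derive_sin.
have cs : {within `[0, h], continuous (@sin R)}.
  by apply: continuous_subspaceT; exact: continuous_sin.
have [c] := MVT h0 der cs.
rewrite in_itv /= => /andP[c0 ch]; rewrite sin0 !subr0 => ->.
rewrite mulrC ler_pM2r//; apply/ltW; rewrite ltr_cos// in_itv /=; apply/andP; split; lra.
Qed.

Lemma half_continuous w : continuous (fun t => vdet (half t) w).
Proof.
have cd : continuous (fun t : R => t / 2).
  by move=> t; apply: cvgM; [exact: cvg_id|exact: cvg_cst].
have cc : continuous (fun t : R => cos (t / 2)).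
  by move=> t; apply: (cvg_comp _ _ (cd t)); exact: continuous_cos.
have cs : continuous (fun t : R => sin (t / 2)).
  by move=> t; apply: (cvg_comp _ _ (cd t)); exact: continuous_sin.
move=> t; rewrite /vdet /half /=; apply: cvgB.
  by apply: cvgM; [exact: cc|exact: cvg_cst].
by apply: cvgM; [exact: cs|exact: cvg_cst].
Qed.

Lemma parallel_half t w : vdet (half t) w = 0 -> w = dotp (half t) w *: half t.
Proof.
move=> d0; have n1 := half_norm t; move: d0 n1; case: (half t) => x y; case: w => p q.
rewrite /vdet /dotp scale_pairE /= => d0 n1; congr pair.
  transitivity (p * (x * x + y * y) + y * (x * q - y * p)); first by rewrite d0 n1; ring.
  by ring.
transitivity (q * (x * x + y * y) - x * (x * q - y * p)); last by ring.
by rewrite d0 n1; ring.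
Qed.

(** The determinant of [half t] and [w] changes sign between [a] and [b]. At a zero the vectors are
    parallel, and their positive inner product rules out opposite directions. *)
Lemma mediant_angle a b m m' : a < b -> b < a + pi -> 0 < m -> 0 < m' ->
  exists c, [/\ a < c, c < b & exists2 k, 0 < k & m *: half a + m' *: half b = k *: half c].
Proof.
move=> ab bpi m0 m'0; set w := m *: half a + m' *: half b.
have vw s : vdet (half s) w = m * sin ((a - s) / 2) + m' * sin ((b - s) / 2).
  rewrite -!vdet_half /w !scale_pairE /vdet /=; ring.
have fa : 0 < vdet (half a) w.
  rewrite vw subrr mul0r sin0 mulr0 add0r mulr_gt0// sin_gt0_pi//.
  by have pi0 := pi_gt0 R; apply/andP; split; lra.
have fb : vdet (half b) w < 0.
  rewrite vw subrr mul0r sin0 mulr0 addr0 pmulr_rlt0//.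
  rewrite -oppr_gt0 -sinN sin_gt0_pi//.
  by have pi0 := pi_gt0 R; apply/andP; split; lra.
have cf : {within `[a, b], continuous (fun t => vdet (half t) w)}.
  by apply: continuous_subspaceT; exact: half_continuous.
have [|c cab fc] := IVT (v := 0) (ltW ab) cf.
  by rewrite ge_min le_max (ltW fa) (ltW fb) orbT.
move: cab; rewrite in_itv /= => /andP[ac cb].
have ac' : a < c.
  rewrite lt_neqAle ac andbT; apply/eqP => E; move: fa; rewrite E fc ltxx //.
have cb' : c < b.
  rewrite lt_neqAle cb andbT; apply/eqP => E; move: fb; rewrite -E fc ltxx //.
exists c; split=> //; exists (dotp (half c) w); last exact: parallel_half.
have -> : dotp (half c) w = m * cos ((a - c) / 2) + m' * cos ((b - c) / 2).
  by rewrite -!dotp_half /w !scale_pairE /dotp /=; ring.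
by rewrite addr_gt0// mulr_gt0// cos_gt0_pihalf//; apply/andP; split; lra.
Qed.

Lemma vdet_comb_inj u v (x y x' y' : R) : vdet u v != 0 ->
  x *: u + y *: v = x' *: u + y' *: v -> x = x' /\ y = y'.
Proof.
move=> d0 E; have := @aff_inj R 0 u v d0 (x, y) (x', y').
by rewrite /aff /= !add0r => /(_ E) [].
Qed.

End HalfAngle.

(** * One Apollonian curve along the Farey tree *)

Section CurveArc.
Variable R : realType.
Variables (c0 : R * R) (r0 : R).
Hypothesis hr0 : 0 < r0.
Variables (C1 C2 : gcircle R) (a1 a2 : R) (gamma : R -> R * R).
Implicit Types (u v w p : R * R) (r a b c s t m l : R).
Let C0 := Circle c0 hr0.
Let lo := Num.min a1 a2.
Let hi := Num.max a1 a2.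

Hypothesis cgamma : {within angular_interval a1 a2, continuous gamma}.
Hypothesis gammaP : forall (C C' S : gcircle R) (t t' : R),
  Defs.family C0 C1 C2 C -> Defs.family C0 C1 C2 C' -> tangent C C' ->
  successor C0 C C' S ->
  angular_interval a1 a2 t -> angle_of (vec_from c0 C) t ->
  angular_interval a1 a2 t' -> angle_of (vec_from c0 C') t' ->
  sqrt_line (vec_from c0 S) (gamma t - gamma t').

(* The rank is a lower bound for dotp u v, the cotangent of (b - a) / 2. *)
Definition farey_node r a b u v : Prop :=
  [/\ [/\ 0 < r, r <= dotp u v, vdet u v = 1, a < b & b < a + pi],
      [/\ lo <= a, b <= hi, exists2 m, 0 < m & u = m *: half a &
          exists2 m, 0 < m & v = m *: half b] &
      exists C C', [/\ Defs.family C0 C1 C2 C, Defs.family C0 C1 C2 C',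
        represents c0 r0 C u & represents c0 r0 C' v]].

(** With h = (b - a) / 2, one has |u| |v| sin h = 1 and |u| |v| cos h >= r, so h cos h <= sin h
    yields h r <= 1. *)
Lemma farey_node_bound r a b u v : farey_node r a b u v -> (b - a) * r <= 2.
Proof.
move=> [[r_gt0 ruv d1 ab bpi] [_ _ [m m0 uE] [m' m'0 vE]] _].
move: d1 ruv; rewrite uE vE vdetZ dotpZZ vdet_half dotp_half.
set h := (b - a) / 2 => d1 ruv.
have h0 : 0 < h by rewrite /h; lra.
have hpi : h < pi by rewrite /h; have := pi_gt0 R; lra.
have := mul_cos_le_sin h0 hpi => hc.
have mm : 0 < m * m' by rewrite mulr_gt0.
have h1 : h * r <= h * (m * m' * cos h) by rewrite ler_pM2l.
have h2 : h * (m * m' * cos h) <= m * m' * sin h.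
  by rewrite mulrCA ler_pM2l.
have -> : (b - a) * r = 2 * (h * r) by rewrite /h; field.
by rewrite d1 in h2; lra.
Qed.

Lemma farey_node_diff r a b u v : farey_node r a b u v ->
  exists2 S, Defs.family C0 C1 C2 S & represents c0 r0 S (u + v) /\
    exists l, gamma b - gamma a = l *: (u + v).
Proof.
move=> [[r_gt0 ruv d1 ab bpi] [la bh [m m0 uE] [m' m'0 vE]] [C [C' [FC FC' rC rC']]]].
have d12 : vdet u v ^+ 2 = 1 by rewrite d1 expr1n.
have uv0 : 0 < dotp u v by exact: lt_le_trans ruv.
have [S [rS sS]] := exists_successor hr0 rC rC' d12 uv0.
have tCC := tangent_represents hr0 rC rC' d12 uv0.
exists S; first exact: family_succ FC FC' tCC sS.
split=> //.
have Ia : angular_interval a1 a2 a.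
  by rewrite /angular_interval /= in_itv /= -/lo -/hi la; lra.
have Ib : angular_interval a1 a2 b.
  by rewrite /angular_interval /= in_itv /= -/lo -/hi bh andbT; lra.
have angC : angle_of (vec_from c0 C) a.
  by apply: (represents_angle hr0 m0); rewrite -uE.
have angC' : angle_of (vec_from c0 C') b.
  by apply: (represents_angle hr0 m'0); rewrite -vE.
have := gammaP FC FC' tCC sS Ia angC Ib angC'.
move=> /(sqrt_line_represents hr0 rS) [l E].
by exists (- l); rewrite scaleNr -E opprB.
Qed.

(** The rank grows because u . (u + v) = |u|^2 + u . v and |u| >= 1, and likewise for [v]. *)
Lemma farey_node_split r a b u v l : farey_node r a b u v ->
  gamma b - gamma a = l *: (u + v) ->
  exists c, [/\ a < c, c < b, farey_node (r + 1) a c u (u + v),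
    farey_node (r + 1) c b (u + v) v &
    gamma c - gamma a = (l / 3) *: (u + (u + v)) /\
    gamma b - gamma c = (l / 3) *: ((u + v) + v)].
Proof.
move=> N gab; have [S FS [rS _]] := farey_node_diff N.
case: N => -[r_gt0 ruv d1 ab bpi] [la bh [m m0 uE] [m' m'0 vE]] [C [C' [FC FC' rC rC']]].
have [c [ac cb [k k0 wE]]] := mediant_angle ab bpi m0 m'0.
rewrite -uE -vE in wE.
have u1 := represents_ge1 hr0 rC; have v1 := represents_ge1 hr0 rC'.
have N1 : farey_node (r + 1) a c u (u + v).
  split; [split|split|exists C, S; split] => //; [lra| | |lra| |by exists m|by exists k].
  - have -> : dotp u (u + v) = dotp u u + dotp u v by rewrite /dotp /=; ring.
    lra.
  - by rewrite -d1 /vdet /=; ring.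
  - by apply: (le_trans _ bh); exact: ltW.
have N2 : farey_node (r + 1) c b (u + v) v.
  split; [split|split|exists S, C'; split] => //; [lra| | |lra| |by exists k|by exists m'].
  - have -> : dotp (u + v) v = dotp v v + dotp u v by rewrite /dotp /=; ring.
    lra.
  - by rewrite -d1 /vdet /=; ring.
  - by apply: (le_trans la); exact: ltW.
have [_ _ [_ [l1 E1]]] := farey_node_diff N1.
have [_ _ [_ [l2 E2]]] := farey_node_diff N2.
have d0 : vdet u v != 0 by rewrite d1 oner_neq0.
have E : (2 * l1 + l2) *: u + (l1 + 2 * l2) *: v = l *: u + l *: v.
  rewrite -scalerDr -gab -(subrK (gamma c) (gamma b)) -addrA E1 E2.
  by rewrite !scale_pairE; congr pair => /=; ring.
have [e1 e2] := vdet_comb_inj d0 E.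
have l1E : l1 = l / 3 by lra.
have l2E : l2 = l / 3 by lra.
by exists c; split=> //; rewrite E1 E2 l1E l2E.
Qed.

Let within_sub a b : lo <= a -> b <= hi -> {within `[a, b], continuous gamma}.
Proof.
move=> la bh; apply: continuous_subspaceW cgamma => x.
rewrite /angular_interval /= !in_itv /= -/lo -/hi => /andP[ax xb].
by rewrite (le_trans la)// (le_trans xb).
Qed.

(** The scale 0 is inherited by both halves, so the value is the same at all subdivision points. *)
Lemma farey_constant r a b u v s : farey_node r a b u v -> gamma b = gamma a ->
  a <= s <= b -> gamma s = gamma a.
Proof.
move=> N gba sab.
pose G r' a' b' := exists u' v', [/\ farey_node r' a' b' u' v', gamma a' = gamma a &
  gamma b' = gamma a].
have HG r' a' b' : G r' a' b' -> [/\ 0 < r', a' <= b' & (b' - a') * r' <= 2] /\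
     exists c, [/\ a' <= c, c <= b', G (r' + 1) a' c & G (r' + 1) c b'].
  move=> [u' [v' [N' ga gb]]]; split.
    split; [by case: N' => -[]|by case: N' => -[_ _ _ /ltW]|exact: farey_node_bound N'].
  have g0 : gamma b' - gamma a' = 0 *: (u' + v') by rewrite ga gb scale0r subrr.
  have [c [ac cb N1 N2 [E1 E2]]] := farey_node_split N' g0.
  have gc : gamma c = gamma a.
    by apply/eqP; rewrite -ga -subr_eq0 E1 mul0r scale0r.
  exists c; split; [exact: ltW|exact: ltW| |].
    by exists u', (u' + v').
  by exists (u' + v'), v'.
have Gr : G r a b by exists u, v.
apply: (@refinement_closed R G [set gamma a] gamma HG _ _ r a b s Gr _ sab).
- by move=> r' a' b' [u' [v' [_ -> _]]].
- by apply: accessible_closed_set1; apply: hausdorff_accessible; exact: norm_hausdorff.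
- by case: N => _ [la bh _ _] _; exact: within_sub.
Qed.

(** [g] is [gamma] in the coordinates of the frame, whose origin [q] is determined by the value at
    either end. *)
Definition farey_system r a b (g : R -> R * R) : Prop :=
  exists u v q l, [/\ farey_node r a b u v, l != 0,
    [/\ gamma a = q - l *: u & gamma b = q + l *: v],
    {within `[a, b], continuous g} &
    forall t, gamma t = aff q (- l *: u) (l *: v) (g t)].

Lemma farey_system_subdivides : subdivides farey_system.
Proof.
move=> r a b g [u [v [q [l [N l0 [ga gb] cg gE]]]]].
have [[r_gt0 ruv d1 ab bpi] [la bh _ _] _] := N.
have dn0 : vdet (- l *: u) (l *: v) != 0.
  by rewrite vdetZ d1 mulr1 mulf_neq0 ?oppr_eq0.
split; first by split=> //; exact: farey_node_bound N.
have affl : aff q (- l *: u) (l *: v) (1, 0) = q - l *: u.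
  by rewrite /aff !scale_pairE; congr pair => /=; ring.
have affr : aff q (- l *: u) (l *: v) (0, 1) = q + l *: v.
  by rewrite /aff !scale_pairE; congr pair => /=; ring.
split.
- by apply: (aff_inj (q := q) dn0); rewrite -gE affl.
- by apply: (aff_inj (q := q) dn0); rewrite -gE affr.
have gab : gamma b - gamma a = l *: (u + v).
  by rewrite ga gb !scale_pairE; congr pair => /=; ring.
have [c [ac cb N1 N2 [E1 E2]]] := farey_node_split N gab.
have l30 : l / 3 != 0 by rewrite mulf_neq0// invr_eq0 pnatr_eq0.
have gc : gamma c = q - (l / 3) *: u + (l / 3) *: v.
  by rewrite -(subrK (gamma a) (gamma c)) E1 ga !scale_pairE; congr pair => /=; field.
(* These affine maps are the inverses of [third1] and [third2]. *)
pose g1 := aff (-2, 0) (3, 0) (3, 3) \o g.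
pose g2 := aff (0, -2) (3, 3) (0, 3) \o g.
have sub (x y : R) : a <= x -> y <= b -> {within `[x, y], continuous g}.
  move=> ax yb; apply: continuous_subspaceW cg => s.
  by rewrite /= !in_itv /= => /andP[? ?]; apply/andP; split; lra.
exists c, g1, g2; split.
- by rewrite ac cb.
(* The new origin solves [gamma a = q' - (l / 3) *: u]; in the other half,
   [gamma b = q' + (l / 3) *: v]. *)
- exists u, (u + v), (q - (2 / 3 * l) *: u), (l / 3); split=> //.
  + split; first by rewrite ga !scale_pairE; congr pair => /=; field.
    by rewrite gc !scale_pairE; congr pair => /=; field.
  + by apply: within_compP; [apply: sub => //; exact: ltW|exact: aff_continuous].
  + move=> t; rewrite gE /g1 /=; move: (g t) => [x y].
    by rewrite /aff !scale_pairE; congr pair => /=; field.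
- exists (u + v), v, (q + (2 / 3 * l) *: v), (l / 3); split=> //.
  + split; first by rewrite gc !scale_pairE; congr pair => /=; field.
    by rewrite gb !scale_pairE; congr pair => /=; field.
  + by apply: within_compP; [apply: sub => //; exact: ltW|exact: aff_continuous].
  + move=> t; rewrite gE /g2 /=; move: (g t) => [x y].
    by rewrite /aff !scale_pairE; congr pair => /=; field.
- move=> t; rewrite /g1 /third1 [in RHS]/comp; move: (g t) => [x y].
  by rewrite /aff !scale_pairE; congr pair => /=; field.
- move=> t; rewrite /g2 /third2 [in RHS]/comp; move: (g t) => [x y].
  by rewrite /aff !scale_pairE; congr pair => /=; field.
Qed.

Lemma farey_arc r a b u v l : farey_node r a b u v ->
  gamma b - gamma a = l *: (u + v) -> l != 0 ->
  [/\ monotone_arc (@arc R), self_similar (@arc R) &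
   gamma @` `[a, b] = aff (gamma a + l *: u) (- l *: u) (l *: v) @` @arc R].
Proof.
move=> N gab l0; have [[_ _ d1 ab _] [la bh _ _] _] := N.
set q := gamma a + l *: u; set e := - l *: u; set f := l *: v.
have dn0 : vdet e f != 0.
  by rewrite vdetZ d1 mulr1 mulf_neq0 ?oppr_eq0.
have [q' [e' [f' K]]] : exists q' e' f', forall z, aff q e f (aff q' e' f' z) = z.
  exists (- vdet q f / vdet e f, - vdet e q / vdet e f),
    (f.2 / vdet e f, - e.2 / vdet e f), (- f.1 / vdet e f, e.1 / vdet e f) => z.
  have [k kz] := aff_surj q dn0 z.
  have : (aff q e f @` [set k]) z by exists k.
  by rewrite aff_image//= => ->.
pose g := aff q' e' f' \o gamma.
have Fg : farey_system r a b g.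
  exists u, v, q, l; split=> //; last by move=> t; rewrite /g /= K.
  - split; first by rewrite /q addrK.
    by rewrite -[LHS](subrK (gamma a)) gab /q scalerDr addrC addrA.
  - by apply: within_compP; [exact: within_sub|exact: aff_continuous].
split.
- exact: (system_monotone_arc farey_system_subdivides Fg).
- exact: (system_self_similar farey_system_subdivides Fg).
rewrite (system_image farey_system_subdivides Fg) image_comp.
by congr (_ @` _); apply/funext => t; rewrite /g /= K.
Qed.

End CurveArc.

(** * Apollonian triangles *)

Section Assembly.
Variable R : realType.
Implicit Types (u v w p q : R * R) (K T : set (R * R)) (l : R).

(** The properties of the fixed set [arc] are carried along with [l != 0], because they are deduced
    from a nonconstant curve. *)
Definition arc_between w w' p p' K : Prop := exists l,
  [/\ p' - p = l *: (w + w'), l = 0 -> K = [set p] &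
      l != 0 -> [/\ monotone_arc (@arc R), self_similar (@arc R) &
        K = aff (p + l *: w) (- l *: w) (l *: w') @` @arc R]].

Lemma arc_between_opp w w' p p' K : arc_between w w' p p' K ->
  arc_between (- w) (- w') p p' K.
Proof.
move=> [l [E H0 H1]]; exists (- l); split.
- by rewrite E !scale_pairE; congr pair => /=; ring.
- by move/eqP; rewrite oppr_eq0 => /eqP; exact: H0.
- by rewrite oppr_eq0 => /H1 [mK sK KE]; rewrite !scaleNr !scalerN !opprK -!scaleNr.
Qed.

Lemma arc_between_swap w w' p p' K : arc_between w w' p p' K ->
  arc_between w' w p' p K.
Proof.
move=> [l [E H0 H1]]; exists (- l); split.
- by rewrite -opprB E scaleNr addrC.
- move/eqP; rewrite oppr_eq0 => /eqP l0; rewrite (H0 l0); congr [set _].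
  by apply/esym/eqP; rewrite -subr_eq0 E l0 scale0r.
- rewrite oppr_eq0 => /H1 [mK sK KE]; split=> //; rewrite KE.
  have E' : p' = p + l *: (w + w') by rewrite -E addrC subrK.
  have affE z : aff (p' + - l *: w') (- - l *: w') (- l *: w) z =
      aff (p + l *: w) (- l *: w) (l *: w') (swap z).
    by rewrite E' /aff !scale_pairE; congr pair => /=; ring.
  apply/seteqP; split=> _ [z az <-]; exists (swap z); rewrite ?affE//;
    exact: arc_swap.
Qed.

Section Base.
Variables (c0 : R * R) (r0 : R).
Hypothesis hr0 : 0 < r0.
Let C0 := Circle c0 hr0.

Lemma represents_opp C u : represents c0 r0 C u -> represents c0 r0 C (- u).
Proof.
have -> : represents c0 r0 C (- u) = represents c0 r0 C u.
  rewrite /represents; have -> : sq (- u) = sq u by rewrite /sq /=; congr pair; ring.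
  by have -> : dotp (- u) (- u) = dotp u u by rewrite /dotp /=; ring.
by [].
Qed.

Lemma represents_uniq C u u' : represents c0 r0 C u -> represents c0 r0 C u' ->
  u' = u \/ u' = - u.
Proof.
move=> rC rC'; have sqE : sq u' = sq u.
  case: C rC rC' => [c r r_gt0 [cE rE] [cE' rE']|n d n0
    [u1 [s s0 [nE dE]]] [u1' [s' s'0 [nE' dE']]]].
    have rn0 : r != 0 by rewrite gt_eqF.
    have : r *: sq u' = r *: sq u by apply: (addrI c0); rewrite -cE -cE'.
    move/(congr1 (fun z => r^-1 *: z)).
    by rewrite !scalerA mulVf// !scale1r.
  have rn0 : r0 != 0 by rewrite gt_eqF.
  have ss : s = s' by apply: (mulIf rn0); rewrite -dE -dE'.
  have : s *: sq u' = s *: sq u by rewrite -nE ss -nE'.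
  move/(congr1 (fun z => s^-1 *: z)).
  by rewrite !scalerA mulVf// !scale1r.
have : dotp (u' - u) (u' - u) * dotp (u' + u) (u' + u) = 0.
  transitivity (dotp (sq u' - sq u) (sq u' - sq u)).
    by rewrite /dotp /sq /=; ring.
  by rewrite sqE subrr /dotp /= mulr0 addr0.
move/eqP; rewrite mulf_eq0 => /orP[] /eqP /dotp_eq0 /eqP.
  by rewrite subr_eq0 => /eqP; left.
by rewrite addr_eq0 => /eqP; right.
Qed.

(** The bound [|a1 - a2| < pi] makes the inner product positive, and the order of the angles gives
    the sign of the determinant. When a1 > a2, the Farey tree is grown from the reversed pair. *)
Lemma apollonian_curve_arc C1 C2 a1 a2 (gamma : R -> R * R) :
  apollonian_curve c0 hr0 C1 C2 a1 a2 gamma ->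
  exists u v, [/\ represents c0 r0 C1 u, represents c0 r0 C2 v,
    vdet u v ^+ 2 = 1, 0 < dotp u v &
    arc_between u v (gamma a1) (gamma a2) (gamma @` angular_interval a1 a2)].
Proof.
move=> [[[p01 [p12 [p20 [t01 t12 t20 _]]]] [D0 [D1 [D2 [b0 b1 b2 [i01 i12 i20]]]]]]
  [ang1 ang2 a12] cg gP].
rewrite /= in b0; rewrite b0 in i01 i20.
have t02 : tangent_at (Circle c0 hr0) C2 p20.
  by case: t20 => n E; split; [move=> [? ?]; exact: n|rewrite setIC].
have i02 : disjoint_interiors [set z | enorm (z - c0) <= r0] D2.
  by rewrite /disjoint_interiors setIC.
have [m1 m10 [rC1 D1E]] := represents_of_external t01 b1 i01 ang1.
have [m2 m20 [rC2 D2E]] := represents_of_external t02 b2 i02 ang2.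
set u := m1 *: half a1 in rC1 D1E *; set v := m2 *: half a2 in rC2 D2E *.
rewrite D1E D2E in i12.
have d1 := vdet_of_external hr0 rC1 rC2 t12 i12.
have [a12l a12u] : - pi < a1 - a2 /\ a1 - a2 < pi.
  by move: a12; rewrite ltr_norml => /andP.
have mm : 0 < m1 * m2 by rewrite mulr_gt0.
have uv : 0 < dotp u v.
  rewrite dotpZZ dotp_half mulr_gt0// cos_gt0_pihalf//; apply/andP; split; lra.
exists u, v; split=> //.
have dE : vdet u v = m1 * m2 * sin ((a2 - a1) / 2) by rewrite vdetZ vdet_half.
have vuN : vdet v u = - vdet u v by rewrite /vdet; ring.
have vuC : dotp v u = dotp u v by rewrite /dotp; ring.
have sgn1 x : 0 < x -> x ^+ 2 = 1 -> x = 1 :> R.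
  by move=> x0 /eqP; rewrite sqrf_eq1 => /orP[/eqP//|/eqP E]; move: x0; rewrite E; lra.
case: (ltgtP a1 a2) => aa.
- have d0 : vdet u v = 1.
    apply: sgn1 => //; rewrite dE mulr_gt0// sin_gt0_pi//.
    by have pi0 := pi_gt0 R; apply/andP; split; lra.
  have N : farey_node c0 hr0 C1 C2 a1 a2 (dotp u v) a1 a2 u v.
    split; [split|split|exists C1, C2; split] => //.
    + lra.
    + by rewrite ge_min lexx.
    + by rewrite le_max lexx orbT.
    + by exists m1.
    + by exists m2.
    + exact: family_left.
    + exact: family_right.
  have [S _ [_ [l gl]]] := farey_node_diff gP N.
  have JE : angular_interval a1 a2 = `[a1, a2]%classic.
    by rewrite /angular_interval min_l ?max_r// ltW.
  exists l; split=> // [l0|l0]; last first.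
    by rewrite JE; exact: farey_arc cg gP _ _ _ _ _ _ N gl l0.
  rewrite JE; apply/seteqP; split=> [_ [s sab <-]|_ ->].
    apply: (farey_constant cg gP N); last by move: sab; rewrite /= in_itv.
    by apply/eqP; rewrite -subr_eq0 gl l0 scale0r.
  by exists a1 => //; rewrite /= in_itv /= lexx ltW.
- apply: arc_between_swap.
  have d0 : vdet v u = 1.
    apply: sgn1; last by rewrite vuN sqrrN.
    rewrite vuN dE -mulrN -sinN mulr_gt0// sin_gt0_pi//.
    by have pi0 := pi_gt0 R; apply/andP; split; lra.
  have N : farey_node c0 hr0 C1 C2 a1 a2 (dotp u v) a2 a1 v u.
    split; [split|split|exists C2, C1; split] => //.
    + by rewrite vuC.
    + lra.
    + by rewrite ge_min lexx orbT.
    + by rewrite le_max lexx.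
    + by exists m2.
    + by exists m1.
    + exact: family_right.
    + exact: family_left.
  have [S _ [_ [l gl]]] := farey_node_diff gP N.
  have JE : angular_interval a1 a2 = `[a2, a1]%classic.
    by rewrite /angular_interval min_r ?max_l// ltW.
  exists l; split=> // [l0|l0]; last first.
    by rewrite JE; exact: farey_arc cg gP _ _ _ _ _ _ N gl l0.
  rewrite JE; apply/seteqP; split=> [_ [s sab <-]|_ ->].
    apply: (farey_constant cg gP N); last by move: sab; rewrite /= in_itv.
    by apply/eqP; rewrite -subr_eq0 gl l0 scale0r.
  by exists a2 => //; rewrite /= in_itv /= lexx ltW.
- by move: d1; rewrite dE aa subrr mul0r sin0 mulr0 expr0n /= => /eqP; rewrite eq_sym oner_eq0.
Qed.

(** Vectors are unique up to sign, and only the relative sign that makes the inner product positive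
    describes the arc. *)
Lemma apollonian_curve_alternative C1 C2 a1 a2 (gamma : R -> R * R) w w' :
  apollonian_curve c0 hr0 C1 C2 a1 a2 gamma ->
  represents c0 r0 C1 w -> represents c0 r0 C2 w' ->
  vdet w w' ^+ 2 = 1 /\
  (0 < dotp w w' /\
     arc_between w w' (gamma a1) (gamma a2) (gamma @` angular_interval a1 a2) \/
   dotp w w' < 0 /\
     arc_between w (- w') (gamma a1) (gamma a2) (gamma @` angular_interval a1 a2)).
Proof.
move=> /apollonian_curve_arc [u [v [rC1 rC2 d1 uv ar]]] rw rw'.
have dN x y : dotp x (- y) = - dotp x y :> R by rewrite /dotp /=; ring.
have Nd x y : dotp (- x) y = - dotp x y :> R by rewrite /dotp /=; ring.
have vN x y : vdet x (- y) = - vdet x y :> R by rewrite /vdet /=; ring.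
have Nv x y : vdet (- x) y = - vdet x y :> R by rewrite /vdet /=; ring.
case: (represents_uniq rC1 rw) => ->; case: (represents_uniq rC2 rw') => ->.
- by split=> //; left.
- by rewrite vN sqrrN; split=> //; right; rewrite dN oppr_lt0 opprK.
- rewrite Nv sqrrN; split=> //; right; rewrite Nd oppr_lt0; split=> //.
  exact: arc_between_opp.
- rewrite vN Nv opprK; split=> //; left; rewrite dN Nd opprK; split=> //.
  exact: arc_between_opp.
Qed.

End Base.

Lemma no_bounded_region_point p T : ~ bounded_region (~` [set p]) T.
Proof.
have d0 : vdet (1, 0) (0, 1) != 0 :> R.
  by rewrite /vdet /= mulr1 mul0r subr0 oner_neq0.
pose B : set (R * R) := [set (1, 0)].
have BE : [set p] = aff (p - (1, 0)) (1, 0) (0, 1) @` B.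
  rewrite image_set1; congr [set _]; case: p => x y.
  by rewrite /aff !scale_pairE; congr pair => /=; ring.
rewrite BE; apply: (no_bounded_region d0 _ (v := (-1, 0))).
- by move=> k k' t -> -> t0; rewrite scale_pairE => -[]; rewrite mulr1.
- by apply/eqP => -[/eqP]; rewrite oppr_eq0 oner_eq0.
- by move=> t t0; rewrite /B scale_pairE => -[]; lra.
Qed.

Lemma no_bounded_region_arc q e f T : vdet e f != 0 -> monotone_arc (@arc R) ->
  ~ bounded_region (~` (aff q e f @` @arc R)) T.
Proof.
move=> d0 mK; apply: (no_bounded_region d0 (arc_ray_uniq mK) (v := (-1, -1))).
  by apply/eqP => -[/eqP]; rewrite oppr_eq0 oner_eq0.
move=> t t0 at'; have [/= h1 h2] := arc_ge0 mK at'.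
by have := arc_sum_gt0 mK at'; rewrite scale_pairE /= in h1 h2 *; lra.
Qed.

(** * Three arcs that close up *)

Section Triangle.
Variables (w1 w2 w3 p1 p2 p3 : R * R) (K12 K23 K31 : set (R * R)).
Hypotheses (w0 : w1 + w2 + w3 = 0) (d0 : vdet w1 w2 != 0).

Let w3E : w3 = - (w1 + w2).
Proof. by apply/eqP; rewrite -addr_eq0 addrC w0. Qed.

Let closed_up : (p2 - p1) + (p3 - p2) + (p1 - p3) = 0.
Proof. by congr pair => /=; ring. Qed.

Lemma degenerate_triangle T :
  arc_between w1 w2 p1 p2 K12 -> arc_between w2 (- w3) p2 p3 K23 ->
  arc_between w3 (- w1) p3 p1 K31 -> ~ bounded_region (~` (K12 `|` K23 `|` K31)) T.
Proof.
move=> [l [E H0 H1]] [l2 [E2 H20 H21]] [l3 [E3 H30 H31]].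
have Ec : (l + l2 - 2 * l3) *: w1 + (l + 2 * l2 - l3) *: w2 = 0 *: w1 + 0 *: w2.
  rewrite -[RHS]/(0 *: w1 + 0 *: w2) !scale0r addr0 -closed_up E E2 E3 w3E.
  by rewrite !scale_pairE; congr pair => /=; ring.
have [e1 e2] := vdet_comb_inj d0 Ec.
have l2E : l2 = - (l / 3) by lra.
have l3E : l3 = l / 3 by lra.
have [l0|l0] := eqVneq l 0.
  rewrite H0// H20 ?H30 ?l2E ?l3E ?l0 ?mul0r ?oppr0//.
  have -> : p2 = p1 by apply/eqP; rewrite -subr_eq0 E l0 scale0r.
  have -> : p3 = p1 by apply/eqP; rewrite eq_sym -subr_eq0 E3 l3E l0 mul0r scale0r.
  by rewrite !setUid; exact: no_bounded_region_point.
have [mK sK KE] := H1 l0.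
have l30 : l3 != 0 by rewrite l3E mulf_neq0// invr_eq0 pnatr_eq0.
have l20 : l2 != 0 by rewrite l2E oppr_eq0 -l3E.
have [_ _ KE2] := H21 l20; have [_ _ KE3] := H31 l30.
set A := aff (p1 + l *: w1) (- l *: w1) (l *: w2) in KE.
have p2E : p2 = p1 + l *: (w1 + w2) by rewrite -E addrC subrK.
have p3E : p3 = p1 - l3 *: (w3 - w1) by rewrite -E3 opprB addrC subrK.
have K23S : K23 `<=` K12.
  rewrite KE2 KE => _ [z az <-]; exists (third2 (swap z)).
    by rewrite sK; right; exists (swap z) => //; exact: arc_swap.
  rewrite /A /third2 l2E w3E p2E; case: z {az} => x y.
  by rewrite /aff /swap !scale_pairE; congr pair => /=; field.
have K31S : K31 `<=` K12.
  rewrite KE3 KE => _ [z az <-]; exists (third1 (swap z)).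
    by rewrite sK; left; exists (swap z) => //; exact: arc_swap.
  rewrite /A /third1 p3E l3E w3E; case: z {az} => x y.
  by rewrite /aff /swap !scale_pairE; congr pair => /=; field.
have -> : K12 `|` K23 `|` K31 = K12.
  by apply/seteqP; split=> [z [[|/K23S]|/K31S]|z ?] //; left; left.
rewrite KE; apply: no_bounded_region_arc => //.
by rewrite vdetZ !mulf_neq0// oppr_eq0.
Qed.

(** Closing up forces the three scales to agree, and then the three frames have the same origin. *)
Lemma nondegenerate_triangle T :
  arc_between w1 (- w2) p1 p2 K12 -> arc_between w2 (- w3) p2 p3 K23 ->
  arc_between w3 (- w1) p3 p1 K31 -> bounded_region (~` (K12 `|` K23 `|` K31)) T ->
  (area T = (4 / 7)%:E * area (triangle p1 p2 p3))%E.
Proof.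
move=> [l [E H0 H1]] [l2 [E2 H20 H21]] [l3 [E3 H30 H31]] rT.
have Ec : (l + l2 - 2 * l3) *: w1 + (- l + 2 * l2 - l3) *: w2 = 0 *: w1 + 0 *: w2.
  rewrite -[RHS]/(0 *: w1 + 0 *: w2) !scale0r addr0 -closed_up E E2 E3 w3E.
  by rewrite !scale_pairE; congr pair => /=; ring.
have [e1 e2] := vdet_comb_inj d0 Ec.
have l2E : l2 = l by lra.
have l3E : l3 = l by lra.
have p21 : p2 = p1 + l *: (w1 - w2) by rewrite -E addrC subrK.
have p31 : p3 = p1 - l *: (w3 - w1) by rewrite -l3E -E3 opprB addrC subrK.
have [l0|l0] := eqVneq l 0.
  exfalso; move: rT; rewrite H0// H20 ?H30 ?l2E ?l3E//.
  rewrite p21 p31 l0 !scale0r subr0 addr0 !setUid.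
  exact: no_bounded_region_point.
have [mK sK KE] := H1 l0.
have [_ _ KE2] := H21 ltac:(by rewrite l2E).
have [_ _ KE3] := H31 ltac:(by rewrite l3E).
set q := p1 + l *: w1; set e := - l *: w1; set f := - l *: w2.
have fE : l *: (- w2) = f by rewrite /f scalerN scaleNr.
have gE : - (e + f) = - l *: w3.
  by rewrite w3E /e /f !scale_pairE; congr pair => /=; ring.
have K12E : K12 = aff q e f @` @arc R by rewrite KE fE.
have K23E : K23 = aff q f (- (e + f)) @` @arc R.
  rewrite KE2 l2E gE; congr (_ @` _); congr aff; last by rewrite scalerN scaleNr.
  by rewrite p21 /q !scale_pairE; congr pair => /=; ring.
have K31E : K31 = aff q (- (e + f)) e @` @arc R.
  rewrite KE3 l3E gE; congr (_ @` _); congr aff; last by rewrite scalerN /e scaleNr.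
  by rewrite p31 /q !scale_pairE; congr pair => /=; ring.
have ef0 : vdet e f != 0 by rewrite vdetZ !mulf_neq0// oppr_eq0.
have t1 : q + e = p1 by rewrite /q /e scaleNr addrK.
have t2 : q + f = p2 by rewrite /q /f p21 !scale_pairE; congr pair => /=; ring.
have t3 : q - (e + f) = p3.
  by rewrite gE /q p31 !scale_pairE; congr pair => /=; ring.
move: rT; rewrite K12E K23E K31E => /(area_three_arcs ef0 mK sK).
by rewrite t1 t2 t3.
Qed.

End Triangle.

(** The relation det(u2, u3) u1 + det(u3, u1) u2 + det(u1, u2) u3 = 0 of three plane vectors,
    multiplied by det(u1, u2). *)
Lemma sum_zero_signs u1 u2 u3 : vdet u1 u2 ^+ 2 = 1 -> vdet u2 u3 ^+ 2 = 1 ->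
  vdet u3 u1 ^+ 2 = 1 ->
  exists w1 w2, [/\ w1 = u1 \/ w1 = - u1, w2 = u2 \/ w2 = - u2 & w1 + w2 + u3 = 0].
Proof.
move=> d12 d23 d31.
pose s := vdet u1 u2 * vdet u2 u3; pose t := vdet u1 u2 * vdet u3 u1.
have E : s *: u1 + t *: u2 + u3 = 0.
  have -> : s *: u1 + t *: u2 + u3 = (1 - vdet u1 u2 ^+ 2) *: u3.
    by rewrite /s /t /vdet !scale_pairE; congr pair => /=; ring.
  by rewrite d12 subrr scale0r.
have sgn x u : x ^+ 2 = 1 -> x *: u = u \/ x *: u = - u.
  move=> /eqP; rewrite sqrf_eq1 => /orP[/eqP ->|/eqP ->]; first by left; rewrite scale1r.
  by right; rewrite scaleN1r.
exists (s *: u1), (t *: u2); split=> //.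
- by apply: sgn; rewrite /s exprMn d12 d23 mulr1.
- by apply: sgn; rewrite /t exprMn d12 d31 mulr1.
Qed.

End Assembly.

Theorem lemma6p4 (R : realType) (c0 : R * R) (r0 : R) (hr0 : (0 < r0)%R)
    (C1 C2 C3 : gcircle R) (p1 p2 p3 : R * R) (T : set (R * R)) :
  apollonian_triangle c0 hr0 C1 C2 C3 p1 p2 p3 T ->
  area T = ((4 / 7)%R%:E * area (triangle p1 p2 p3))%E.
Proof.
move=> [_ _ [g12 [g23 [g31 [a1 [a2 [b2 [b3 [e3 [e1
  [[c12 c23 c31] [[g31e1 g12a1] [g12a2 g23b2] [g23b3 g31e3]] rT]]]]]]]]]]].
have [u1 [u2 [r1 r2 _ _ _]]] := apollonian_curve_arc c12.
have [_ [u3 [_ r3 _ _ _]]] := apollonian_curve_arc c23.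
have [d12 _] := apollonian_curve_alternative c12 r1 r2.
have [d23 _] := apollonian_curve_alternative c23 r2 r3.
have [d31 _] := apollonian_curve_alternative c31 r3 r1.
have [w1 [w2 [w1E w2E w0]]] := sum_zero_signs d12 d23 d31.
have rw1 : represents c0 r0 C1 w1.
  by case: w1E => ->; [exact: r1|exact: represents_opp].
have rw2 : represents c0 r0 C2 w2.
  by case: w2E => ->; [exact: r2|exact: represents_opp].
have [v12 A12] := apollonian_curve_alternative c12 rw1 rw2.
have [v23 A23] := apollonian_curve_alternative c23 rw2 r3.
have [v31 A31] := apollonian_curve_alternative c31 r3 rw1.
rewrite g12a1 g12a2 in A12; rewrite g23b2 g23b3 in A23; rewrite g31e3 g31e1 in A31.
have vn0 x : x ^+ 2 = 1 -> x != 0 :> R.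
  by move=> x2; apply/eqP => x0; move: x2 => /eqP; rewrite x0 expr0n /= eq_sym oner_eq0.
have rot1 : w2 + u3 + w1 = 0 by rewrite addrC addrA.
have rot2 : u3 + w1 + w2 = 0 by rewrite -addrA addrC.
(* w_i . (w_j + w_k) = - |w_i|^2 < 0, so at most one pair has a positive product. *)
have two (x y z : R * R) : 1 <= dotp y y -> x + y + z = 0 ->
    0 < dotp x y -> 0 < dotp y z -> False.
  move=> y1 s0 xy yz; have : dotp y (x + y + z) = dotp y y + dotp x y + dotp y z.
    by rewrite /dotp /=; ring.
  by rewrite s0 {1}/dotp /= !mulr0; lra.
have n1 := represents_ge1 hr0 rw1; have n2 := represents_ge1 hr0 rw2.
have n3 := represents_ge1 hr0 r3.
(* Eight sign patterns: two positive products are contradictory, a single one is degenerate after a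
   cyclic relabelling, and the last has none. *)
case: A12 => -[s12 K12]; case: A23 => -[s23 K23]; case: A31 => -[s31 K31].
- by case: (two w1 w2 u3).
- by case: (two w1 w2 u3).
- by case: (two u3 w1 w2).
- by case: (degenerate_triangle w0 (vn0 _ v12) K12 K23 K31 rT).
- by case: (two w2 u3 w1).
- case: (degenerate_triangle rot1 (vn0 _ v23) K23 K31 K12 (T := T)).
  by move: rT; rewrite -setUA setUC.
- case: (degenerate_triangle rot2 (vn0 _ v31) K31 K12 K23 (T := T)).
  by move: rT; rewrite setUC setUA.
- exact: (nondegenerate_triangle w0 (vn0 _ v12) K12 K23 K31 rT).
Qed.
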